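(* Let $\mathcal{D}$ be the closed symmetric operator $\frac{1}{i}\frac{d}{dx}$ on $L^2([0,1])$ with domain $\{f\in AC([0,1]): f'\in L^2([0,1]),\ f(0)=f(1)=0\}$, and let $\mathcal{D}_0$ be its self-adjoint extension $\frac{1}{i}\frac{d}{dx}$ with domain $\{f\in AC([0,1]): f'\in L^2([0,1]),\ f(0)=f(1)\}$. Then $\mathcal{D}_0$ has compact resolvent, and for all $a\in C^\infty([0,1])$ the commutator $[\mathcal{D}_0,a]$ is defined on $\mathrm{dom}\,\mathcal{D}$ and is bounded on this dense subspace. The bounded transform $F:=\mathcal{D}_0(1+\mathcal{D}_0^2)^{-1/2}$ has the property that the commutator $[F,x]$ is not a compact operator, where $x$ denotes the operator of multiplication by the identity function $x\mapsto x$ on $[0,1]$. Therefore $(C([0,1]),L^2([0,1]),F)$ does not define a Fredholm module.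
   Context: $AC([0,1])$ denotes the absolutely continuous functions on $[0,1]$. Functions $a\in C([0,1])$ act on $L^2([0,1])$ by multiplication, and $[T,a]=Ta-aT$. A Fredholm module $(A,\mathcal{H},F)$ consists of an algebra $A$ of bounded operators on a Hilbert space $\mathcal{H}$ and a bounded operator $F$ on $\mathcal{H}$ such that $a(F-F^* )$, $a(1-F^2)$ and $[F,a]$ are compact for all $a\in A$. *)

(* Defs.v *)
From HB Require Import structures.
From mathcomp Require Import all_boot all_order all_algebra.
From mathcomp Require Import complex ring lra.
From mathcomp Require Import all_classical all_reals all_analysis.
From mathcomp Require Import measurable_realfun.

Set Implicit Arguments.
Unset Strict Implicit.
Unset Printing Implicit Defensive.

Import Order.TTheory GRing.Theory Num.Theory.
Import numFieldNormedType.Exports.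

Local Open Scope classical_set_scope.
Local Open Scope ring_scope.
Local Open Scope complex_scope.

(* [Num.Theory] shadows the projections of [R[i]]. *)
Local Notation Re := complex.Re.
Local Notation Im := complex.Im.

HB.instance Definition _ (R : realType) := NormedModule.copy R[i] R[i]^o.

Section DotTriangle.
Variables (C : numClosedFieldType) (U : lmodType C) (form : {dot U for Num.conj}).
Local Notation "''[' u , v ]" := (form u%R v%R) : ring_scope.
Local Notation "''[' u ]" := '[u, u]%R : ring_scope.

Lemma dot_CauchySchwarz (u v : U) : `|'[u, v]| ^+ 2 <= '[u] * '[v].
Proof.
have [-> | nz_v] := eqVneq v 0.
  have e0 w : '[w, 0] = 0 by exact: linear0r.
  by rewrite !e0 normr0 expr0n /= mulr0.
pose a := '[u, v] / '[v]; pose u1 := u - a *: v.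
have ou : '[u1, v] = 0.
  by rewrite linearBl/= linearZl_LR/= divfK ?dnorm_eq0 ?subrr.
have -> : u = u1 + a *: v by rewrite subrK.
rewrite linearDl /= ou add0r linearZl_LR/= normrM (ger0_norm (dnorm_ge0 _ _)).
rewrite exprMn (expr2 '[v]) mulrA -dnormZ.
apply: ler_wpM2r; first exact: dnorm_ge0.
by rewrite hnormDd/= ?linearZr_LR/= ?ou ?mulr0 // lerDr dnorm_ge0.
Qed.

Lemma dot_triangle u v : sqrtC '[u + v] <= sqrtC '[u] + sqrtC '[v].
Proof.
rewrite -ler_sqr ?nnegrE ?addr_ge0 ?sqrtC_ge0 ?dnorm_ge0//.
rewrite sqrrD !sqrtCK addrAC dnormD lerD2l -mulr_natr.
rewrite -[_ + _](divfK (negbT (pnatr_eq0 C 2))) ler_pM2r ?ltr0n//.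
have [reuv _] := leif_Re_Creal '[u, v]; rewrite ReE in reuv; apply: (le_trans reuv).
rewrite -ler_sqr ?nnegrE ?mulr_ge0 ?sqrtC_ge0 ?dnorm_ge0//.
by rewrite exprMn !sqrtCK dot_CauchySchwarz.
Qed.
End DotTriangle.

HB.mixin Record NormedModule_hasDot (R : realType) H of NormedModule R[i] H := {
  hdot : {dot H for @Num.conj R[i]} ;
  hnormE : forall u : H, `|u| = sqrtC (hdot u u) }.

#[short(type="hilbertType")]
HB.structure Definition Hilbert (R : realType) :=
  {H of CompleteNormedModule R[i] H & NormedModule_hasDot R H}.


(* An operator in [H], in general unbounded, is identified with its graph, a
   subset of [H * H]; its domain is the first projection of the graph. *)
Section Operators.
Context {R : realType} {H : hilbertType R}.
Implicit Types (S T : set (H * H)) (A F : H -> H).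

Definition op_dom T : set H := [set u | exists v, T (u, v)].

Definition op_graph A : set (H * H) := [set p | p.2 = A p.1].

Definition op_add S T : set (H * H) :=
  [set p | exists v w, [/\ S (p.1, v), T (p.1, w) & p.2 = v + w]].

Definition op_comp S T : set (H * H) :=
  [set p | exists2 w, T (p.1, w) & S (w, p.2)].

Definition op_inv T : set (H * H) := [set p | T (p.2, p.1)].

(* [T, A] = T A - A T, on the natural domain
   { u in dom T | A u in dom T } *)
Definition op_commutator T A : set (H * H) :=
  [set p | exists v w, [/\ op_comp T (op_graph A) (p.1, v),
                           op_comp (op_graph A) T (p.1, w) & p.2 = v - w]].

Definition op_adjoint T : set (H * H) :=
  [set p | forall q, T q -> hdot q.2 p.1 = hdot q.1 p.2].

Definition linear_operator T : Prop :=
  [/\ T (0, 0),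
      forall (c : R[i]) p q, T p -> T q -> T (c *: p.1 + q.1, c *: p.2 + q.2) &
      forall v, T (0, v) -> v = 0].

Definition symmetric_operator T : Prop :=
  [/\ linear_operator T, dense (op_dom T) & T `<=` op_adjoint T].

Definition selfadjoint_operator T : Prop :=
  [/\ linear_operator T, dense (op_dom T) & op_adjoint T = T].

Definition bounded_operator A : Prop :=
  linear A /\ exists M : R[i], forall u, `|A u| <= M * `|u|.

Definition compact_operator A : Prop :=
  linear A /\ precompact (A @` [set u | `|u| <= 1]).

(* [A] is the resolvent (T - z)^{-1} *)
Definition is_resolvent T (z : R[i]) A : Prop :=
  bounded_operator A /\
  op_inv (op_add T (op_graph (fun u => - (z *: u)))) = op_graph A.

Definition compact_resolvent T : Prop :=
  (exists z A, is_resolvent T z A) /\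
  (forall z A, is_resolvent T z A -> compact_operator A).

(* [S] is (1 + T^2)^{-1/2}, the bounded positive square root of
   (1 + T^2)^{-1} *)
Definition is_inv_sqrt_1sqr T (S : H -> H) : Prop :=
  [/\ bounded_operator S, forall u, 0 <= hdot (S u) u &
      op_graph (S \o S) = op_inv (op_add (op_graph id) (op_comp T T))].

Definition bounded_transform T F : Prop :=
  bounded_operator F /\
  exists2 S, is_inv_sqrt_1sqr T S & op_graph F = op_comp T (op_graph S).

Definition commutator F A : H -> H := fun u => F (A u) - A (F u).

Definition operator_algebra (alg : set (H -> H)) : Prop :=
  [/\ forall A, alg A -> bounded_operator A, alg (fun=> 0),
      forall A B, alg A -> alg B -> alg (fun u => A u + B u),
      forall (c : R[i]) A, alg A -> alg (fun u => c *: A u) &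
      forall A B, alg A -> alg B -> alg (A \o B)].

(* [Fs] is the adjoint of [F] *)
Definition fredholm_module (alg : set (H -> H)) F : Prop :=
  [/\ operator_algebra alg, bounded_operator F &
      exists2 Fs : H -> H, forall u v, hdot (F u) v = hdot u (Fs v) &
      forall A, alg A ->
        [/\ compact_operator (fun u => A (F u - Fs u)),
            compact_operator (fun u => A (u - F (F u))) &
            compact_operator (commutator F A)]].

End Operators.

Section L2.
Context d (T : measurableType d) (R : realType).
Variable mu : {measure set T -> \bar R}.

Definition cintegral (h : T -> R[i]) : R[i] :=
  (\int[mu]_x Re (h x)) +i* (\int[mu]_x Im (h x)).

Definition cintegrable (h : T -> R[i]) :=
  mu.-integrable setT (EFin \o (fun x => Re (h x))) /\
  mu.-integrable setT (EFin \o (fun x => Im (h x))).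

Lemma cReD (x y : R[i]) : Re (x + y) = Re x + Re y. Proof. by case: x y => [? ?] []. Qed.
Lemma cImD (x y : R[i]) : Im (x + y) = Im x + Im y. Proof. by case: x y => [? ?] []. Qed.
Lemma cReM (x y : R[i]) : Re (x * y) = Re x * Re y - Im x * Im y.
Proof. by case: x y => [? ?] []. Qed.
Lemma cImM (x y : R[i]) : Im (x * y) = Re x * Im y + Im x * Re y.
Proof. by case: x y => [? ?] []. Qed.
Lemma cReJ (x : R[i]) : Re (Num.conj x) = Re x. Proof. by case: x. Qed.
Lemma cImJ (x : R[i]) : Im (Num.conj x) = - Im x. Proof. by case: x. Qed.
Lemma cReIm_eq (x y : R[i]) : Re x = Re y -> Im x = Im y -> x = y.
Proof. by case: x y => [? ?] [? ?] /= -> ->. Qed.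

Let intD f g : mu.-integrable setT (EFin \o f) -> mu.-integrable setT (EFin \o g) ->
  mu.-integrable setT (EFin \o (fun x => f x + g x)).
Proof.
move=> fi gi; rewrite (_ : _ \o _ = (EFin \o f) \+ (EFin \o g))%E//.
exact: integrableD.
Qed.
Let intZ a f : mu.-integrable setT (EFin \o f) ->
  mu.-integrable setT (EFin \o (fun x => a * f x)).
Proof.
move=> fi; rewrite (_ : _ \o _ = (fun x => a%:E * (EFin \o f) x)%E)//.
exact: integrableZl.
Qed.
Let intB f g : mu.-integrable setT (EFin \o f) -> mu.-integrable setT (EFin \o g) ->
  mu.-integrable setT (EFin \o (fun x => f x - g x)).
Proof.
move=> fi gi; rewrite (_ : _ \o _ = (EFin \o f) \- (EFin \o g))%E//.
exact: integrableB.
Qed.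

Lemma cintegralD f g : cintegrable f -> cintegrable g ->
  cintegral (fun x => f x + g x) = cintegral f + cintegral g.
Proof.
move=> [f1 f2] [g1 g2]; apply: cReIm_eq; rewrite ?cReD ?cImD /=.
- by under eq_Rintegral do rewrite cReD; rewrite RintegralD.
- by under eq_Rintegral do rewrite cImD; rewrite RintegralD.
Qed.

Lemma cintegralZ a f : cintegrable f ->
  cintegral (fun x => a * f x) = a * cintegral f.
Proof.
move=> [f1 f2]; apply: cReIm_eq; rewrite ?cReM ?cImM /=.
- under eq_Rintegral do rewrite cReM.
  by rewrite RintegralB// ?RintegralZl//; exact: intZ.
- under eq_Rintegral do rewrite cImM.
  by rewrite RintegralD// ?RintegralZl//; exact: intZ.
Qed.

Lemma cintegralJ f : cintegrable f ->
  cintegral (fun x => Num.conj (f x)) = Num.conj (cintegral f).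
Proof.
move=> [f1 f2]; apply: cReIm_eq; rewrite ?cReJ ?cImJ /=.
- by under eq_Rintegral do rewrite cReJ.
- under eq_Rintegral do rewrite cImJ -mulN1r.
  by rewrite RintegralZl// mulN1r.
Qed.

Lemma eq_cintegral_ae f g : cintegrable f -> cintegrable g ->
  {ae mu, forall x, f x = g x} -> cintegral f = cintegral g.
Proof.
move=> [/integrableP[f1 _] /integrableP[f2 _]] [/integrableP[g1 _] /integrableP[g2 _]] fg.
apply: cReIm_eq; rewrite /= /Rintegral; congr fine; apply: ae_eq_integral => //;
by apply: filterS fg => x -> _.
Qed.

Definition L2_pred : {pred T -> R[i]} :=
  [pred f | ((fun x => Re (f x)) \in Lfun mu 2%:E) &&
            ((fun x => Im (f x)) \in Lfun mu 2%:E)].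

Let L12 : (1 <= 2%:E :> \bar R)%E. Proof. by rewrite lee_fin ler1n. Qed.

Let LfD (f g : T -> R) : f \in Lfun mu 2%:E -> g \in Lfun mu 2%:E ->
  (fun x => f x + g x) \in Lfun mu 2%:E.
Proof.
move=> fL gL; have [_ h] := Lfun_submod_closed mu L12.
by have := h 1 g f gL fL; rewrite scale1r addrC.
Qed.

Let LfZ a (f : T -> R) : f \in Lfun mu 2%:E ->
  (fun x => a * f x) \in Lfun mu 2%:E.
Proof.
move=> fL; have [h0 h] := Lfun_submod_closed mu L12.
by have := h a f 0 fL h0; rewrite addr0.
Qed.

Let Lf0 : cst 0 \in Lfun mu 2%:E.
Proof. by have [] := Lfun_submod_closed mu L12. Qed.

Let LfM (f g : T -> R) : f \in Lfun mu 2%:E -> g \in Lfun mu 2%:E ->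
  mu.-integrable setT (EFin \o (fun x => f x * g x)).
Proof. by move=> fL gL; apply/Lfun1_integrable; exact: Lfun2_mul_Lfun1. Qed.

Lemma L2_pred_submod_closed : submod_closed L2_pred.
Proof.
split; first by rewrite inE; apply/andP; split; exact: Lf0.
move=> a f g /andP[f1 f2] /andP[g1 g2]; apply/andP; split.
- rewrite (_ : (fun x => _) =
    (fun x => (Re a * Re (f x) + (- Im a) * Im (f x)) + Re (g x))).
    by apply: LfD => //; apply: LfD; exact: LfZ.
  by apply/funext => x; rewrite !fctE cReD [_ *: _]mulrC -[_ * a]mulrC cReM mulNr.
- rewrite (_ : (fun x => _) =
    (fun x => (Re a * Im (f x) + Im a * Re (f x)) + Im (g x))).
    by apply: LfD => //; apply: LfD; exact: LfZ.
  by apply/funext => x; rewrite !fctE cImD [_ *: _]mulrC -[_ * a]mulrC cImM.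
Qed.

HB.instance Definition _ :=
  GRing.isSubmodClosed.Build R[i] (T -> R[i]) L2_pred L2_pred_submod_closed.

Record L2_fun := L2Fun { L2_fun_val :> T -> R[i] ; _ : L2_fun_val \in L2_pred }.
HB.instance Definition _ := [isSub for L2_fun_val].
HB.instance Definition _ := [Choice of L2_fun by <:].
HB.instance Definition _ := [SubChoice_isSubLmodule of L2_fun by <:].

Lemma L2_funP (f : L2_fun) : (f : T -> R[i]) \in L2_pred. Proof. exact: valP. Qed.
Lemma L2_funDE (f g : L2_fun) x : (f + g) x = f x + g x. Proof. by []. Qed.
Lemma L2_funZE a (f : L2_fun) x : (a *: f) x = a * f x. Proof. by []. Qed.
Lemma L2_funNE (f : L2_fun) x : (- f) x = - f x. Proof. by []. Qed.
Lemma L2_fun0E x : (0 : L2_fun) x = 0. Proof. by []. Qed.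

Lemma L2_cintegrable (f g : L2_fun) : cintegrable (fun x => f x * Num.conj (g x)).
Proof.
case: f g => [f /andP[/= f1 f2]] [g /andP[/= g1 g2]]; split => /=.
- rewrite (_ : (fun x => _) = (fun x => Re (f x) * Re (g x) + Im (f x) * Im (g x))).
    by apply: intD; exact: LfM.
  by apply/funext => x; rewrite cReM cReJ cImJ mulrN opprK.
- rewrite (_ : (fun x => _) = (fun x => Im (f x) * Re (g x) - Re (f x) * Im (g x))).
    by apply: intB; exact: LfM.
  by apply/funext => x; rewrite cImM cReJ cImJ mulrN addrC.
Qed.

Definition L2_null : {pred L2_fun} :=
  [pred f : L2_fun | `[< {ae mu, forall x, f x = 0} >]].

Lemma L2_null_zmod_closed : zmod_closed L2_null.
Proof.
split; first by apply/asboolP; exact: aeW.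
move=> f g /asboolP f0 /asboolP g0; apply/asboolP.
by apply: filterS2 f0 g0 => x fx gx; rewrite L2_funDE L2_funNE fx gx subr0.
Qed.

HB.instance Definition _ := GRing.isZmodClosed.Build L2_fun L2_null L2_null_zmod_closed.

Definition L2 := Quotient.quot L2_null.
HB.instance Definition _ := GRing.Zmodule.on L2.
HB.instance Definition _ := EqQuotient.on L2.
End L2.

Section L2_lmodule.
Context d (T : measurableType d) (R : realType).
Variable mu : {measure set T -> \bar R}.
Local Open Scope quotient_scope.
Local Notation L2 := (L2 mu).
Local Notation L2_fun := (L2_fun mu).

Definition L2_class (f : L2_fun) : L2 := \pi_L2 f.

Lemma L2_classP (f g : L2_fun) :
  L2_class f = L2_class g <-> {ae mu, forall x, f x = g x}.
Proof.
split.
- move/eqP; rewrite -Quotient.idealrBE => /asboolP.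
  apply: filterS => x; rewrite L2_funDE L2_funNE => /eqP.
  by rewrite subr_eq0 => /eqP.
- move=> fg; apply/eqP; rewrite -Quotient.idealrBE; apply/asboolP.
  by apply: filterS fg => x fg; rewrite L2_funDE L2_funNE fg subrr.
Qed.

Lemma L2_classK (u : L2) : L2_class (repr u) = u.
Proof. exact: reprK. Qed.

Lemma L2_repr_class (f : L2_fun) : {ae mu, forall x, repr (L2_class f) x = f x}.
Proof. by apply/L2_classP; rewrite L2_classK. Qed.

Lemma L2_classD f g : L2_class (f + g) = L2_class f + L2_class g.
Proof. by rewrite /L2_class Quotient.pi_add. Qed.

Lemma L2_class0 : L2_class 0 = 0.
Proof. by rewrite /L2_class; apply/esym; rewrite /GRing.zero /= /Quotient.zero; unlock. Qed.

Definition L2_scale (a : R[i]) (u : L2) : L2 := L2_class (a *: repr u).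

Lemma L2_class_scale a f : L2_scale a (L2_class f) = L2_class (a *: f).
Proof.
apply/L2_classP; apply: filterS (L2_repr_class f) => x fx.
by rewrite !L2_funZE fx.
Qed.

Lemma L2_scaleA a b u : L2_scale a (L2_scale b u) = L2_scale (a * b) u.
Proof. by rewrite -[u]L2_classK !L2_class_scale scalerA. Qed.
Lemma L2_scale1 : left_id 1 L2_scale.
Proof. by move=> u; rewrite -[u]L2_classK !L2_class_scale scale1r. Qed.
Lemma L2_scaleDr : right_distributive L2_scale +%R.
Proof.
move=> a u v; rewrite -[u]L2_classK -[v]L2_classK -L2_classD !L2_class_scale.
by rewrite scalerDr L2_classD.
Qed.
Lemma L2_scaleDl u : {morph L2_scale^~ u : a b / a + b}.
Proof.
by move=> a b; rewrite -[u]L2_classK !L2_class_scale scalerDl L2_classD.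
Qed.

HB.instance Definition _ := GRing.Zmodule_isLmodule.Build R[i] L2
  L2_scaleA L2_scale1 L2_scaleDr L2_scaleDl.

Lemma L2_classZ a f : L2_class (a *: f) = a *: L2_class f.
Proof. by rewrite -L2_class_scale. Qed.

Definition L2_dot (u v : L2) : R[i] :=
  cintegral mu (fun x => repr u x * Num.conj (repr v x)).

Lemma L2_dotE f g : L2_dot (L2_class f) (L2_class g) =
  cintegral mu (fun x => f x * Num.conj (g x)).
Proof.
apply: eq_cintegral_ae; [exact: L2_cintegrable|exact: L2_cintegrable|].
by apply: filterS2 (L2_repr_class f) (L2_repr_class g) => x -> ->.
Qed.

Lemma L2_dotPl a u v w : L2_dot (a *: u + v) w = a * L2_dot u w + L2_dot v w.
Proof.
rewrite -[u]L2_classK -[v]L2_classK -[w]L2_classK -L2_classZ -L2_classD !L2_dotE.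
move: (repr u) (repr v) (repr w) => f g h.
rewrite -cintegralZ; last exact: L2_cintegrable.
have e : (fun x => a * (f x * Num.conj (h x))) =
         (fun x => (a *: f) x * Num.conj (h x)).
  by apply/funext => x; rewrite L2_funZE mulrA.
rewrite -cintegralD; first last.
- exact: L2_cintegrable.
- by rewrite e; exact: L2_cintegrable.
by congr cintegral; apply/funext => x; rewrite L2_funDE L2_funZE mulrDl mulrA.
Qed.

Lemma L2_dotC u v : L2_dot u v = Num.conj (L2_dot v u).
Proof.
rewrite /L2_dot -cintegralJ; last exact: L2_cintegrable.
by congr cintegral; apply/funext => x; rewrite rmorphM /= (conjCK (repr u x)) mulrC.
Qed.

Lemma L2_dotPr w a u v : L2_dot w (a *: u + v) = Num.conj a * L2_dot w u + L2_dot w v.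
Proof.
by rewrite L2_dotC L2_dotPl rmorphD rmorphM (L2_dotC w u) (L2_dotC w v).
Qed.

Lemma L2_dotxx u :
  L2_dot u u = (\int[mu]_x ((Re (repr u x)) ^+ 2 + (Im (repr u x)) ^+ 2))%:C.
Proof.
apply: cReIm_eq => /=.
- congr Rintegral; apply/funext => x.
  by rewrite cReM cReJ cImJ mulrN opprK !expr2.
- rewrite (_ : (fun x => _) = cst 0) ?Rintegral_cst ?mul0r//.
  by apply/funext => x; rewrite cImM cReJ cImJ mulrN addrC mulrC subrr.
Qed.

Lemma L2_dot_gt0 u : u != 0 -> 0 < L2_dot u u.
Proof.
move=> u0; rewrite lt_neqAle; apply/andP; split; last first.
  rewrite L2_dotxx ler0c; apply: Rintegral_ge0 => x _.
  by rewrite addr_ge0// sqr_ge0.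
apply: contra_neq u0 => /esym; rewrite L2_dotxx => -[].
set F := fun x => _ => F0.
have [FI _] := L2_cintegrable (repr u) (repr u).
have {}FI : mu.-integrable setT (EFin \o F).
  congr (mu.-integrable _ _): FI; apply/funext => x /=.
  by rewrite /F cReM cReJ cImJ mulrN opprK !expr2.
have Fge0 x : 0 <= F x by rewrite addr_ge0// sqr_ge0.
have [mF _] := integrableP _ _ _ FI.
have : (\int[mu]_x `|(EFin \o F) x| = 0)%E.
  under eq_integral do rewrite gee0_abs ?lee_fin//.
  by rewrite -[LHS]fineK ?integrable_fin_num// [fine _]F0.
move/(ae_eq_integral_abs mu measurableT mF) => {}F0.
rewrite -[u]L2_classK -L2_class0; apply/L2_classP.
apply: filterS F0 => x /(_ I) [] /eqP.
rewrite /F paddr_eq0 ?sqr_ge0// !sqrf_eq0 => /andP[/eqP a /eqP b].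
exact: cReIm_eq.
Qed.
End L2_lmodule.

Section fast_cauchy.
Context d (T : measurableType d) (R : realType).
Variable mu : {measure set T -> \bar R}.

Lemma fast_cauchy_ae (g : nat -> T -> R) :
  (forall n, measurable_fun setT (g n)) ->
  (forall n, (\int[mu]_x ((g n.+1 x - g n x) ^+ 2)%:E <= (16^-1 ^+ n)%:E)%E) ->
  exists2 h : T -> R, measurable_fun setT h &
    {ae mu, forall x, g n x @[n --> \oo] --> h x}.
Proof.
move=> mg g16.
pose F n x := ((4 ^+ n * (g n.+1 x - g n x) ^+ 2)%:E : \bar R).
have mdg n : measurable_fun setT (fun x => (g n.+1 x - g n x) ^+ 2).
  by apply: measurable_funX; exact: measurable_funB.
have mF n : measurable_fun setT (F n).
  apply: (@measurableT_comp _ _ _ _ _ _ EFin) => //.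
  by apply: measurable_funM; [exact: measurable_cst|exact: mdg].
have F0 n x : (0 <= F n x)%E.
  by rewrite lee_fin; apply: mulr_ge0; [exact: exprn_ge0|exact: sqr_ge0].
pose S x := (\sum_(n <oo) F n x)%E.
have S0 x : (0 <= S x)%E by apply: nneseries_ge0 => n _ _; exact: F0.
have mS : measurable_fun setT S.
  by apply: ge0_emeasurable_sum => // k x _ _; exact: F0.
have iS : mu.-integrable setT S.
  apply/integrableP; split => //.
  under eq_integral do rewrite gee0_abs//.
  rewrite integral_nneseries//.
  have half : (\sum_(n <oo) (2 / (2 ^ (n + 1))%:R)%:E = 2%:E :> \bar R)%E.
    apply/cvg_lim => //; have := @cvg_geometric_eseries_half R 2 0.
    by rewrite expr0 divr1; exact.
  apply: (@le_lt_trans _ _ 2%:E); last exact: ltry.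
  rewrite -half; apply: lee_nneseries => [n _ _|n _].
    by apply: integral_ge0 => x _; exact: F0.
  rewrite (_ : (\int[mu]_x F n x)%E =
    ((4 ^+ n)%:E * \int[mu]_x ((g n.+1 x - g n x) ^+ 2)%:E)%E); last first.
    rewrite -ge0_integralZl_EFin//.
    + by move=> x _; rewrite lee_fin sqr_ge0.
    + by apply: (@measurableT_comp _ _ _ _ _ _ EFin).
  apply: (@le_trans _ _ ((4 ^+ n)%:E * (16^-1 ^+ n)%:E)%E).
    by apply: lee_wpmul2l => //; rewrite lee_fin exprn_ge0.
  rewrite -EFinM lee_fin -exprMn addn1 expnS natrM invfM mulrA divff// mul1r.
  rewrite natrX -exprVn; apply: lerXn2r; rewrite ?nnegrE//; lra.
pose h x := fine (limn_esup (fun n => (g n x)%:E)).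
exists h.
  apply: (measurableT_comp (fine_measurable measurableT)).
  by apply: measurable_fun_limn_esup => n; apply: (@measurableT_comp _ _ _ _ _ _ EFin).
apply: filterS (integrable_ae measurableT iS) => x /(_ I) Sfin.
suff /cvg_ex[l gl] : cvgn (fun n => g n x).
  have /cvg_limn_einf_sup [_ hl] : (fun n => (g n x)%:E) @ \oo --> l%:E.
    by apply: cvg_EFin => //; exact: nearW.
  by rewrite /h hl.
pose s := fine (S x).
have s0 : 0 <= s by rewrite fine_ge0.
have bd n : `|g n.+1 x - g n x| <= (s + 1) * 2^-1 ^+ n.
  have : (F n x <= s%:E)%E.
    rewrite /s fineK//; apply: (le_trans _ (nneseries_lim_ge n.+1 _)).
      rewrite big_nat_recr//= leeDr//.
      by apply: sume_ge0 => i _; exact: F0.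
    by move=> k _ _; exact: F0.
  rewrite lee_fin => Fs.
  rewrite exprVn ler_pdivlMr ?exprn_gt0// -ler_sqr ?nnegrE ?mulr_ge0 ?addr_ge0//.
  rewrite exprMn real_normK ?num_real// -exprM mulnC exprM mulrC.
  rewrite (_ : 2 ^+ 2 = 4); last by rewrite expr2 -natrM.
  apply: (le_trans Fs); nra.
have : cvgn (series (telescope (fun n => g n x))).
  apply: (@normed_cvg R R^o).
  apply: (@series_le_cvg _ _ (geometric (s + 1) 2^-1)).
  - by move=> n /=; exact: normr_ge0.
  - by move=> n /=; rewrite mulr_ge0 ?addr_ge0 ?exprn_ge0.
  - by move=> n; exact: bd.
  by apply: is_cvg_geometric_series; rewrite ger0_norm//; lra.
rewrite telescopeK => /cvg_ex[l gl]; apply/cvg_ex; exists (l + g 0 x).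
have -> : (fun n => g n x) = (fun n => [sequence g n x - g 0 x]_n n + g 0 x).
  by apply/funext => n /=; rewrite subrK.
by apply: cvgD => //; exact: cvg_cst.
Qed.
End fast_cauchy.

Section L2_normed.
Context d (T : measurableType d) (R : realType).
Variable mu : {measure set T -> \bar R}.
Local Notation L2 := (L2 mu).
Local Notation L2_fun := (L2_fun mu).
Local Notation sqmod z := (Re z ^+ 2 + Im z ^+ 2).

HB.instance Definition _ := bilinear_isBilinear.Build R[i] L2 L2 R[i] *%R
  (Num.conj \; *%R) (@L2_dot _ T R mu) ((fun w a u v => L2_dotPl a u v w),
    (fun w a u v => L2_dotPr w a u v)).
HB.instance Definition _ := isHermitianSesquilinear.Build R[i] L2 false Num.conj
  (@L2_dot _ T R mu) (fun u v => etrans (L2_dotC u v) (esym (mul1r _))).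
HB.instance Definition _ := isDotProduct.Build R[i] L2 (@L2_dot _ T R mu)
  (@L2_dot_gt0 _ T R mu).

Definition L2_dotform : {dot L2 for @Num.conj R[i]} := @L2_dot _ T R mu.

Definition L2_norm (u : L2) : R[i] := sqrtC (L2_dotform u u).

Lemma L2_normD u v : L2_norm (u + v) <= L2_norm u + L2_norm v.
Proof. exact: dot_triangle. Qed.
Lemma L2_normZ a u : L2_norm (a *: u) = `|a| * L2_norm u.
Proof.
rewrite /L2_norm dnormZ rootCMl ?exprn_ge0//.
by rewrite sqrCK.
Qed.
Lemma L2_norm0_eq0 u : L2_norm u = 0 -> u = 0.
Proof. by move/eqP; rewrite sqrt_dnorm_eq0 => /eqP. Qed.

HB.instance Definition _ := Lmodule_isNormed.Build R[i] L2
  L2_normD L2_normZ L2_norm0_eq0.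

Lemma L2_normE (u : L2) : `|u| = sqrtC (L2_dotform u u).
Proof. by []. Qed.

Let sqmod_ge0 (z : R[i]) : 0 <= sqmod z.
Proof. by rewrite addr_ge0// sqr_ge0. Qed.

Lemma L2_fun_measurable (f : L2_fun) : measurable_fun setT (fun x => Re (f x)) /\
  measurable_fun setT (fun x => Im (f x)).
Proof.
have /andP[/andP[m1 _] /andP[m2 _]] := L2_funP f.
by move: m1 m2; rewrite !inE.
Qed.

Lemma measurable_sqmod (f : T -> R[i]) : measurable_fun setT (fun x => Re (f x)) ->
  measurable_fun setT (fun x => Im (f x)) ->
  measurable_fun setT (fun x => (sqmod (f x))%:E).
Proof.
move=> m1 m2; apply: (@measurableT_comp _ _ _ _ _ _ EFin) => //.
by apply: measurable_funD; exact: measurable_funX.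
Qed.

Lemma L2_dot_le f (r : R) : (L2_dot (L2_class f) (L2_class f) <= r%:C) =
  (\int[mu]_x (sqmod ((f : L2_fun) x))%:E <= r%:E)%E.
Proof.
rewrite L2_dotE /=; have [FI _] := L2_cintegrable f f.
have e x : Re (f x * Num.conj (f x)) = sqmod (f x).
  by rewrite cReM cReJ cImJ mulrN opprK !expr2.
have e' x : Im (f x * Num.conj (f x)) = 0.
  by rewrite cImM cReJ cImJ mulrN addrC mulrC subrr.
rewrite /cintegral; under eq_Rintegral do rewrite e.
under [X in _ +i* X]eq_Rintegral do rewrite e'.
rewrite Rintegral_cst// mul0r lecR -lee_fin /Rintegral fineK//.
move/integrable_fin_num : FI => /(_ measurableT).
by congr (is_true (_ \is a fin_num)); apply: eq_integral => x _ /=; rewrite e.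
Qed.

Lemma L2_pred_sqmod (f : T -> R[i]) : measurable_fun setT (fun x => Re (f x)) ->
  measurable_fun setT (fun x => Im (f x)) ->
  (\int[mu]_x (sqmod (f x))%:E < +oo)%E -> f \in L2_pred mu.
Proof.
move=> m1 m2 foo.
have key (g : T -> R) : measurable_fun setT g ->
    (forall x, g x ^+ 2 <= sqmod (f x)) -> g \in Lfun mu 2%:E.
  move=> mg gf; rewrite inE; apply/andP; split; first by rewrite inE.
  rewrite inE /= /finite_norm unlock poweR_lty//.
  apply: le_lt_trans foo; apply: ge0_le_integral => //.
  - by move=> x _; rewrite lee_fin powR_ge0.
  - apply: (@measurableT_comp _ _ _ _ _ _ EFin) => //.
    by apply: (measurableT_comp (measurable_powR _)); exact: measurableT_comp.
  - exact: measurable_sqmod.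
  - by move=> x _; rewrite lee_fin powR_mulrn// real_normK ?num_real.
by apply/andP; split; apply: key => // x; rewrite ?lerDl ?lerDr sqr_ge0.
Qed.

Lemma limn_einf_le (u : (\bar R)^nat) c : (forall n, u n <= c)%E ->
  (limn_einf u <= c)%E.
Proof.
move=> uc; rewrite limn_einf_lim; apply: lime_le; first exact: is_cvg_einfs.
apply: nearW => n; apply: le_trans (uc n).
by apply: ereal_inf_lbound; exists n => /=.
Qed.

Lemma L2_fast_cauchy (x : nat -> L2) :
  (forall n m, (n <= m)%N -> L2_dot (x m - x n) (x m - x n) <= (16^-1 ^+ n)%:C) ->
  exists y, forall n, L2_dot (y - x n) (y - x n) <= (16^-1 ^+ n)%:C.
Proof.
move=> x16; pose f n : L2_fun := repr (x n).
have xE m n : x m - x n = L2_class (f m - f n).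
  rewrite -[x m]L2_classK -[x n]L2_classK -scaleN1r -L2_classZ -L2_classD.
  by rewrite scaleN1r.
have f16 n m : (n <= m)%N ->
    (\int[mu]_t (sqmod (f m t - f n t))%:E <= (16^-1 ^+ n)%:E)%E.
  by move=> nm; have := x16 _ _ nm; rewrite xE L2_dot_le.
have mRe n : measurable_fun setT (fun t => Re (f n t)) by case: (L2_fun_measurable (f n)).
have mIm n : measurable_fun setT (fun t => Im (f n t)) by case: (L2_fun_measurable (f n)).
have ReB (z w : R[i]) : Re (z - w) = Re z - Re w by case: z w => [? ?] [].
have ImB (z w : R[i]) : Im (z - w) = Im z - Im w by case: z w => [? ?] [].
have mB n m : measurable_fun setT (fun t => (sqmod (f m t - f n t))%:E).
  apply: measurable_sqmod.
    by under eq_fun do rewrite ReB; exact: measurable_funB.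
  by under eq_fun do rewrite ImB; exact: measurable_funB.
have [h1 mh1 fh1] : exists2 h, measurable_fun setT h &
    {ae mu, forall t, Re (f n t) @[n --> \oo] --> (h t : R)}.
  apply: (@fast_cauchy_ae _ _ _ mu (fun n t => Re (f n t))) => // n.
  apply: le_trans (f16 n n.+1 _) => //; apply: ge0_le_integral => //.
  - by move=> t _; rewrite lee_fin sqr_ge0.
  - apply: (@measurableT_comp _ _ _ _ _ _ EFin) => //.
    by apply: measurable_funX; exact: measurable_funB.
  - by move=> t _; rewrite lee_fin ReB lerDl sqr_ge0.
have [h2 mh2 fh2] : exists2 h, measurable_fun setT h &
    {ae mu, forall t, Im (f n t) @[n --> \oo] --> (h t : R)}.
  apply: (@fast_cauchy_ae _ _ _ mu (fun n t => Im (f n t))) => // n.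
  apply: le_trans (f16 n n.+1 _) => //; apply: ge0_le_integral => //.
  - by move=> t _; rewrite lee_fin sqr_ge0.
  - apply: (@measurableT_comp _ _ _ _ _ _ EFin) => //.
    by apply: measurable_funX; exact: measurable_funB.
  - by move=> t _; rewrite lee_fin ImB lerDr sqr_ge0.
pose h t : R[i] := h1 t +i* h2 t.
have mhB n : measurable_fun setT (fun t => Re (h t - f n t)) /\
             measurable_fun setT (fun t => Im (h t - f n t)).
  split.
    by under eq_fun do rewrite ReB; exact: measurable_funB.
  by under eq_fun do rewrite ImB; exact: measurable_funB.
have h16 n : (\int[mu]_t (sqmod (h t - f n t))%:E <= (16^-1 ^+ n)%:E)%E.
  pose G k t := (sqmod (f (n + k)%N t - f n t))%:E.
  have -> : (\int[mu]_t (sqmod (h t - f n t))%:E = \int[mu]_t limn_einf (G^~ t))%E.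
    apply: ae_eq_integral => //.
    - by case: (mhB n) => ? ?; exact: measurable_sqmod.
    - rewrite /limn_einf; apply: measurableT_comp => //.
      apply: measurable_fun_limn_esup => k.
      by apply: measurableT_comp => //; exact: mB.
    apply: filterS2 fh1 fh2 => t c1 c2 _.
    apply/esym; apply: (cvg_limn_einf_sup _).1.
    apply: cvg_EFin; first exact: nearW.
    rewrite /G /= ReB ImB; under eq_fun do rewrite ReB ImB.
    have sh (u : R^nat) (l : R) : u @ \oo --> l -> u (n + k)%N @[k --> \oo] --> l.
      move=> ul; rewrite (_ : (fun k => u (n + k)%N) = [sequence u (k + n)%N]_k).
        by rewrite cvg_shiftn.
      by apply/funext => k; rewrite /= addnC.
    have c1' := sh (fun k => Re (f k t)) _ c1.
    have c2' := sh (fun k => Im (f k t)) _ c2.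
    apply: cvgD; rewrite ?expr2.
      under eq_fun do rewrite expr2.
      by apply: cvgM; (apply: cvgB; [by []|exact: cvg_cst]).
    under eq_fun do rewrite expr2.
    by apply: cvgM; (apply: cvgB; [by []|exact: cvg_cst]).
  apply: le_trans (fatou _ _ _ _) _ => //.
  - by move=> k; exact: mB.
  - by move=> k t _; rewrite lee_fin.
  by apply: limn_einf_le => k; apply: f16; rewrite leq_addr.
have hf0 : (fun t => h t - f 0%N t) \in L2_pred mu.
  case: (mhB 0%N) => a b; apply: L2_pred_sqmod => //.
  by apply: le_lt_trans (h16 0%N) _; exact: ltry.
pose y0 : L2_fun := L2Fun hf0.
exists (L2_class (y0 + f 0%N)) => n.
rewrite -[x n]L2_classK -scaleN1r -L2_classZ -L2_classD L2_dot_le.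
apply: le_trans (h16 n); rewrite le_eqVlt; apply/orP; left; apply/eqP.
apply: eq_integral => t _; congr ((sqmod _)%:E).
  by rewrite L2_funDE L2_funZE mulN1r L2_funDE subrK.
by rewrite L2_funDE L2_funZE mulN1r L2_funDE subrK.
Qed.

Lemma L2_dot_norm (u : L2) (r : R) : 0 <= r ->
  (L2_dot u u <= (r ^+ 2)%:C) = (`|u| <= r%:C).
Proof.
move=> r0; rewrite -[RHS]ler_sqr ?nnegrE ?ler0c//.
by rewrite L2_normE sqrtCK rmorphXn.
Qed.

Lemma L2_complete (F : set_system L2) : ProperFilter F -> cauchy F -> cvg F.
Proof.
move=> FF /cauchyP Fc.
pose r n : R := 4^-1 ^+ n / 2.
have rr n : r n + r n = 4^-1 ^+ n by rewrite -splitr.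
have r0 n : 0 < r n by rewrite divr_gt0 ?exprn_gt0 ?invr_gt0.
have rle n m : (n <= m)%N -> r m <= r n.
  move=> nm; rewrite ler_pM2r ?invr_gt0//; apply: ler_wiXn2l => //; lra.
have e16 n : 16^-1 ^+ n = (4^-1 ^+ n) ^+ 2 :> R.
  by rewrite -exprM mulnC exprM; congr (_ ^+ _); rewrite expr2; lra.
have p4 n : 0 <= 4^-1 ^+ n :> R by rewrite exprn_ge0 ?invr_ge0.
have /choice[x Fx] n : exists x, F (ball x (r n)%:C).
  by apply: Fc; rewrite ltcR.
have [|y xy] := @L2_fast_cauchy x.
  move=> n m nm.
  have FI : F (ball (x n) (r n)%:C `&` ball (x m) (r m)%:C) by exact: filterI.
  have [z []] := filter_ex FI; rewrite -!ball_normE /= => zn zm.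
  rewrite e16 L2_dot_norm//.
  rewrite -(subrK z (x m)) -addrA; apply: (le_trans (ler_normD _ _)).
  rewrite -rr rmorphD/=; apply: lerD.
    by apply: (le_trans (ltW zm)); rewrite lecR rle.
  by rewrite distrC ltW.
apply/cvg_ex; exists y; apply/cvgrPdist_lt => e e0.
have /complex_realP[s es] : e \is Num.real by rewrite gtr0_real.
move: e0; rewrite es ltcR => s0.
have [n ns] : exists n, 4^-1 ^+ n + r n < s.
  have /cvgrPdist_lt /(_ (s / 2)) : 4^-1 ^+ n @[n --> \oo] --> (0 : R).
    by apply: cvg_expr; rewrite ger0_norm//; lra.
  rewrite divr_gt0// => /(_ isT)[n _ /(_ n (leqnn n))] /=.
  rewrite sub0r normrN ger0_norm// => ns; exists n.
  by have := p4 n; rewrite /r; lra.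
apply: filterS (Fx n) => t; rewrite -ball_normE /= => xt.
rewrite -(subrK (x n) y) -addrA; apply: (le_lt_trans (ler_normD _ _)).
apply: (@lt_le_trans _ _ ((4^-1 ^+ n)%:C + (r n)%:C)).
  by apply: ler_ltD => //; rewrite -L2_dot_norm// -e16.
by rewrite -rmorphD lecR ltW.
Qed.

HB.instance Definition _ := Uniform_isComplete.Build L2 L2_complete.
HB.instance Definition _ := NormedModule_hasDot.Build R L2 L2_normE.
End L2_normed.


Section UnitInterval.
Context (R : realType).
Local Notation C := R[i].
Local Notation I01 := (`[0, 1]%classic : set R).

Definition leb01 : {measure set (measurableTypeR R) -> \bar R} :=
  mrestr (@lebesgue_measure R) (measurable_itv `[0%R, 1%R]).

(* The functions representing the elements of L^2([0,1]) are defined on the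
   whole line, but their values outside [0,1] are irrelevant. *)
Definition L2_01 : hilbertType R := L2 leb01.

(* the derivative of [f] at [x] relative to [A]; it is one-sided at the end
   points of an interval [A] *)
Definition has_derivative_within (A : set R) (f : R -> C) (x : R) (l : C) : Prop :=
  (f y - f x) / (y - x)%:C @[y --> within A x^'] --> l.

Definition absolutely_continuous (a b : R) (f : R -> C) : Prop :=
  forall e : R, 0 < e -> exists2 d : R, 0 < d &
    forall (n : nat) (s t : 'I_n -> R),
      (forall i, [/\ a <= s i, s i <= t i & t i <= b]) ->
      trivIset setT (fun i => `]s i, t i[%classic) ->
      \sum_(i < n) (t i - s i) < d ->
      \sum_(i < n) `|f (t i) - f (s i)| < e%:C.

(* (1/i) d/dx with domain { f in AC([0,1]) | f' in L^2([0,1]), bc f };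
   [df] is the almost everywhere defined derivative of [f] *)
Definition momentum_op (bc : (R -> C) -> Prop) : set (L2_01 * L2_01) :=
  [set p | exists f df : L2_fun leb01,
    [/\ p = (L2_class f, 'i^-1 *: L2_class df),
        absolutely_continuous 0 1 f, bc f &
        {ae @lebesgue_measure R, forall x, x \in `[0, 1] ->
          has_derivative_within I01 f x (df x)}]].

Definition D_op : set (L2_01 * L2_01) :=
  momentum_op (fun f => f 0 = 0 /\ f 1 = 0).

Definition D0_op : set (L2_01 * L2_01) := momentum_op (fun f => f 0 = f 1).

(* smoothness on [0,1], with one-sided derivatives at the end points; [d n] is
   the n-th derivative *)
Definition smooth01 (a : R -> C) : Prop :=
  exists d : nat -> R -> C, {in `[0, 1], d 0%N =1 a} /\
    forall n, {in `[0, 1], forall x, has_derivative_within I01 (d n) x (d n.+1 x)}.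

Definition mul01 (a f : R -> C) (x : R) : C :=
  if x \in `[0, 1] then a x * f x else 0.

(* The value 0 given by [insubd] is never used when [a] is continuous on
   [0,1], see [mul01_L2] below. *)
Definition mul_op (a : R -> C) (u : L2_01) : L2_01 :=
  L2_class (insubd (0 : L2_fun leb01) (mul01 a (repr (u : L2 leb01)))).

Definition cont_alg : set (L2_01 -> L2_01) :=
  [set mul_op a | a in [set a | {within I01, continuous a}]].

Definition id01 : R -> C := fun x => x%:C.

End UnitInterval.

Arguments leb01 R : clear implicits.
Arguments L2_01 R : clear implicits.
Arguments D_op R : clear implicits.
Arguments D0_op R : clear implicits.
Arguments cont_alg R : clear implicits.
Arguments id01 R : clear implicits.

Section MulOp.
Context (R : realType).
Local Notation C := R[i].
Local Notation I01 := (`[0, 1]%classic : set R).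
Local Notation sqmod z := (Re z ^+ 2 + Im z ^+ 2).
Implicit Types a b : R -> C.

Lemma cRe_continuous : continuous (@complex.Re R : C -> R).
Proof.
move=> z; apply/(@cvgrPdist_lt _ _ _ (nbhs (z : C))) => e e0.
have e0' : 0 < e%:C by rewrite ltcR.
have := nbhsx_ballx z _ e0'; apply: filterS => w; rewrite -ball_normE /= => zw.
rewrite -ltcR; apply: le_lt_trans zw.
have := normc_ge_Re (z - w); congr (is_true (`|_|%:C <= _)).
by case: (z) (w) => [? ?] [].
Qed.

Lemma cIm_continuous : continuous (@complex.Im R : C -> R).
Proof.
move=> z; apply/(@cvgrPdist_lt _ _ _ (nbhs (z : C))) => e e0.
have e0' : 0 < e%:C by rewrite ltcR.
have := nbhsx_ballx z _ e0'; apply: filterS => w; rewrite -ball_normE /= => zw.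
rewrite -ltcR; apply: le_lt_trans zw.
have := normc_ge_Re ((z - w) * 'i); rewrite ReiNIm normrM normrN.
rewrite [X in _ * X]normc_def /= expr0n expr1n add0r sqrtr1 mulr1.
by congr (is_true (`|_|%:C <= _)); case: (z) (w) => [? ?] [].
Qed.

Lemma within_ReIm a : {within I01, continuous a} ->
  {within I01, continuous (fun x => Re (a x))} /\
  {within I01, continuous (fun x => Im (a x))}.
Proof.
move=> ca; split=> x; apply: continuous_comp (ca x) _.
  exact: cRe_continuous.
exact: cIm_continuous.
Qed.

Lemma within_sqmod_bounded a : {within I01, continuous a} ->
  exists2 K : R, 0 <= K & forall x, x \in `[0, 1] -> sqmod (a x) <= K.
Proof.
move=> /within_ReIm[c1 c2].
have [|c _ Hc] := @EVT_max R
  (fun x => Re (a x) * Re (a x) + Im (a x) * Im (a x)) 0 1 ler01.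
  by move=> x; apply: cvgD; apply: cvgM; [exact: c1|exact: c1|exact: c2|exact: c2].
exists (sqmod (a c)) => [|x xI]; first by rewrite addr_ge0// sqr_ge0.
by rewrite !expr2; exact: Hc.
Qed.

Lemma sqmodM (z w : C) : sqmod (z * w) = sqmod z * sqmod w.
Proof. by rewrite cReM cImM; ring. Qed.

Lemma mul01_measurable a (f : L2_fun (leb01 R)) : {within I01, continuous a} ->
  measurable_fun setT (fun x => Re (mul01 a f x)) /\
  measurable_fun setT (fun x => Im (mul01 a f x)).
Proof.
move=> /within_ReIm[c1 c2].
have mI : measurable I01 by exact: measurable_itv.
have m1 := subspace_continuous_measurable_fun mI c1.
have m2 := subspace_continuous_measurable_fun mI c2.
have [f1 f2] := L2_fun_measurable f.
have fI1 : measurable_fun I01 (fun x => Re (f x)) by exact: measurable_funTS f1.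
have fI2 : measurable_fun I01 (fun x => Im (f x)) by exact: measurable_funTS f2.
split.
- rewrite (_ : (fun x => _) =
    (fun x => Re (a x) * Re (f x) - Im (a x) * Im (f x)) \_ I01).
    apply: (iffLR (measurable_restrictT _ mI)).
    by apply: measurable_funB; exact: measurable_funM.
  apply/funext => x; rewrite patchE /mul01 mem_setE.
  by case: ifPn => // _; rewrite cReM.
- rewrite (_ : (fun x => _) =
    (fun x => Re (a x) * Im (f x) + Im (a x) * Re (f x)) \_ I01).
    apply: (iffLR (measurable_restrictT _ mI)).
    by apply: measurable_funD; exact: measurable_funM.
  apply/funext => x; rewrite patchE /mul01 mem_setE.
  by case: ifPn => // _; rewrite cImM.
Qed.

Lemma mul01_le a K (f : L2_fun (leb01 R)) : {within I01, continuous a} ->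
  0 <= K -> (forall x, x \in `[0, 1] -> sqmod (a x) <= K) ->
  (\int[leb01 R]_x (sqmod (mul01 a f x))%:E <=
   K%:E * \int[leb01 R]_x (sqmod (f x))%:E)%E.
Proof.
move=> ca K0 aK; have sqmod_ge0 (z : C) : 0 <= sqmod z by rewrite addr_ge0// sqr_ge0.
have [f1 f2] := L2_fun_measurable f; have [m1 m2] := mul01_measurable f ca.
rewrite -ge0_integralZl_EFin//; first last.
- exact: measurable_sqmod.
- by move=> x _; rewrite lee_fin.
apply: ge0_le_integral => //.
- by move=> x _; rewrite lee_fin.
- exact: measurable_sqmod.
- apply: emeasurable_funM; first exact: measurable_cst.
  exact: measurable_sqmod.
- move=> x _; rewrite -EFinM lee_fin /mul01; case: ifPn => xI.
    by rewrite sqmodM ler_wpM2r// aK.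
  by rewrite /= expr0n /= addr0 mulr_ge0.
Qed.

Lemma L2_fun_sqmod_lty (f : L2_fun (leb01 R)) :
  (\int[leb01 R]_x (sqmod (f x))%:E < +oo)%E.
Proof.
have [/integrableP[_ FI] _] := L2_cintegrable f f.
apply: le_lt_trans FI; rewrite le_eqVlt; apply/orP; left; apply/eqP.
apply: eq_integral => x _ /=.
rewrite cReM cReJ cImJ mulrN opprK -!expr2 ger0_norm//.
by rewrite addr_ge0// sqr_ge0.
Qed.

Lemma mul01_L2 a (f : L2_fun (leb01 R)) : {within I01, continuous a} ->
  mul01 a f \in L2_pred (leb01 R).
Proof.
move=> ca; have [m1 m2] := mul01_measurable f ca.
have [K K0 aK] := within_sqmod_bounded ca.
apply: L2_pred_sqmod => //; apply: (le_lt_trans (mul01_le f ca K0 aK)).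
rewrite lte_mul_pinfty// ?lee_fin//; exact: L2_fun_sqmod_lty.
Qed.

Lemma ae_leb01 (P : R -> Prop) :
  {ae leb01 R, forall x, P x} <->
  {ae @lebesgue_measure R, forall x, x \in `[0, 1] -> P x}.
Proof.
have mI : measurable I01 by exact: measurable_itv.
split=> [[B [mB B0 PB]]|[B [mB B0 PB]]].
- exists (B `&` I01); split; [exact: measurableI|exact: B0|].
  by move=> x /= /not_implyP[xI Px]; split => //; exact: PB.
- exists (B `|` ~` I01); split.
  + by apply: measurableU => //; exact: measurableC.
  + suff : lebesgue_measure ((B `|` ~` I01) `&` I01) = 0%E by [].
    rewrite setIUl setICl setU0.
    apply/eqP; rewrite eq_le measure_ge0 andbT -B0.
    by apply: le_measure; rewrite ?inE//; exact: measurableI.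
  + move=> x /= Px; have [xI|] := pselect (I01 x); last by right.
    by left; apply: PB => /= /(_ xI).
Qed.

Lemma mul_op_class a (f g : L2_fun (leb01 R)) : {within I01, continuous a} ->
  {ae @lebesgue_measure R, forall x, x \in `[0, 1] -> g x = a x * f x} ->
  mul_op a (L2_class f) = L2_class g.
Proof.
move=> ca /ae_leb01 gaf; apply/L2_classP.
have I1 : {ae leb01 R, forall x, x \in `[0, 1]}.
  by apply/ae_leb01; exact: aeW.
have FF : Filter (almost_everywhere (leb01 R)) by exact: ae_filter_ringOfSetsType.
apply: filterS3 gaf I1 (L2_repr_class f) => x -> xI <-.
by rewrite insubdK ?mul01_L2// /mul01 xI.
Qed.

Lemma mul_opE a u : {within I01, continuous a} -> exists2 f : L2_fun (leb01 R),
  mul_op a u = L2_class f & f =1 mul01 a (repr (u : L2 (leb01 R))).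
Proof.
move=> ca; exists (L2Fun (mul01_L2 (repr (u : L2 (leb01 R))) ca)) => //.
by congr L2_class; apply: val_inj; rewrite insubdK ?mul01_L2.
Qed.

Lemma mul_op_bounded a : {within I01, continuous a} -> bounded_operator (mul_op a).
Proof.
move=> ca; split.
- move=> c u v; have [f ef fE] := mul_opE u ca; have [g eg gE] := mul_opE v ca.
  rewrite ef eg -L2_classZ -L2_classD.
  rewrite -{1}[u]L2_classK -{1}[v]L2_classK -L2_classZ -L2_classD.
  apply: mul_op_class => //; apply: aeW => x xI.
  by rewrite !L2_funDE !L2_funZE fE gE /mul01 xI; ring.
- have [K K0 aK] := within_sqmod_bounded ca.
  exists (K + 1)%:C => u; have [f ef fE] := mul_opE u ca.
  have /complex_realP[s us] : `|u| \is Num.real by exact: normr_real.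
  have s0 : 0 <= s by rewrite -ler0c -us normr_ge0.
  rewrite us -rmorphM -(L2_dot_norm (mul_op a u)) ?mulr_ge0 ?addr_ge0//.
  rewrite ef L2_dot_le; under eq_integral do rewrite fE.
  apply: (le_trans (mul01_le _ ca K0 aK)).
  apply: (@le_trans _ _ (K%:E * (s ^+ 2)%:E)%E).
    apply: lee_wpmul2l; first by rewrite lee_fin.
    by rewrite -L2_dot_le L2_classK L2_dot_norm// us.
  by rewrite -EFinM lee_fin exprMn ler_wpM2r ?sqr_ge0//; nra.
Qed.

Lemma cont_algebra : operator_algebra (cont_alg R).
Proof.
split.
- by move=> _ [a ca <-]; exact: mul_op_bounded.
- exists (fun=> 0); first by move=> x; exact: cvg_cst.
  apply/funext => u; have [|f -> fE] := @mul_opE (fun=> 0) u.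
    by move=> x; exact: cvg_cst.
  rewrite -L2_class0; apply/L2_classP; apply: aeW => x.
  by rewrite fE /mul01 mul0r; case: ifP.
- move=> _ _ [a ca <-] [b cb <-].
  have cab : {within I01, continuous (fun x => a x + b x)}.
    by move=> x; apply: cvgD; [exact: ca|exact: cb].
  exists (fun x => a x + b x) => //; apply/funext => u.
  have [f -> fE] := mul_opE u cab; have [g -> gE] := mul_opE u ca.
  have [h -> hE] := mul_opE u cb; rewrite -L2_classD; apply/L2_classP.
  apply: aeW => x; rewrite L2_funDE fE gE hE /mul01.
  by case: ifP; rewrite ?mulrDl ?addr0.
- move=> c _ [a ca <-].
  have cab : {within I01, continuous (fun x => c * a x)}.
    by move=> x; apply: cvgM; [exact: cvg_cst|exact: ca].
  exists (fun x => c * a x) => //; apply/funext => u.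
  have [f -> fE] := mul_opE u cab; have [g -> gE] := mul_opE u ca.
  rewrite -L2_classZ; apply/L2_classP.
  apply: aeW => x; rewrite L2_funZE fE gE /mul01.
  by case: ifP; rewrite ?mulrA ?mulr0.
- move=> _ _ [a ca <-] [b cb <-].
  have cab : {within I01, continuous (fun x => a x * b x)}.
    by move=> x; apply: cvgM; [exact: ca|exact: cb].
  exists (fun x => a x * b x) => //; apply/funext => u /=.
  have [f -> fE] := mul_opE u cab; have [g -> gE] := mul_opE u cb.
  symmetry; apply: (@mul_op_class a g f ca); apply: aeW => x xI.
  by rewrite fE gE /mul01 xI mulrA.
Qed.

End MulOp.

(* Main.v *)
Require Import Defs.
From HB Require Import structures.
From mathcomp Require Import all_boot all_order all_algebra.
From mathcomp Require Import complex ring lra.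
From mathcomp Require Import all_classical all_reals all_analysis.
From mathcomp Require Import measurable_realfun.

(** The theorem becomes elementary once all operators are written in the
    orthonormal basis of the Fourier modes e_z(x) = exp(2 pi i z x), z an integer.

    The basis. Completeness (fourier_total) rests on Chernoff's argument: if G is
    differentiable at x0, then (G - G(x0)) / (e_1 - e_1(x0)) is square integrable,
    and comparing Fourier coefficients expresses those of G as differences of
    those of the quotient, which tend to 0 by Bessel's inequality. It is applied to
    the primitive G of a function orthogonal to all modes.

    The operators. Integration by parts for absolutely continuous functions shows
    that (u, v) is in the graph of D_0 if and only if the coefficient of v at z is
    2 pi z times that of u, for all z (D0_coef). Self-adjointness is then testing
    against the modes. The resolvents are diagonal with eigenvalues tending to 0,
    hence compact (diagonal_operator_compact). The operator D is the restriction of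
    D_0 to the kernel of the boundary value f(1), which integration by parts
    against x makes a continuous functional on the graph; so D is closed. Its domain is
    dense because it contains the differences of modes. On this domain [D_0, a] is
    multiplication by a'/i, which is bounded. The operator (1 + D_0^2)^(-1/2) and the
    bounded transform F are diagonal, with eigenvalues (1 + lambda^2)^(-1/2) and
    f_z = lambda (1 + lambda^2)^(-1/2) for lambda = 2 pi z; a positive square root is
    determined by its square on eigenvectors, so F is unique.

    The commutator. The entry of [F, x] between e_p and e_(-q), for positive p and q,
    is i (f_p + f_q) / (2 pi (p + q)), comparable to that of the Hilbert matrix.
    Averaging it over N <= p, q < 2N gives unit vectors v_N and w_N such that
    the pairing of [F, x] v_N with w_N stays away from 0 while w_N tends weakly to 0,
    which a compact operator does not allow (not_compact_operator). As x is
    continuous, F does not define a Fredholm module over the continuous functions.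

    The analytic ingredient is the fundamental theorem of calculus for absolutely
    continuous functions, which is deduced from Lebesgue's differentiation theorem
    and the constancy of an absolutely continuous function with derivative zero
    almost everywhere (absolutely_continuous_derivative0). *)

Import Order.TTheory GRing.Theory Num.Theory.
Import numFieldNormedType.Exports.

Set Implicit Arguments.
Unset Strict Implicit.
Unset Printing Implicit Defensive.

Local Open Scope classical_set_scope.
Local Open Scope ring_scope.

(** * Complex numbers *)

Section Complex.
Local Open Scope complex_scope.
Context {R : realType}.
Local Notation C := R[i].
Local Notation Re := complex.Re.
Local Notation Im := complex.Im.

Lemma ge0_complexP (z : C) : 0 <= z -> exists2 r : R, 0 <= r & z = r%:C.
Proof.
move=> z0; have /complex_realP[r rz] : z \is Num.real by exact: ger0_real.
by exists r => //; rewrite -ler0c -rz.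
Qed.

Lemma gt0_complexP (z : C) : 0 < z -> exists2 r : R, 0 < r & z = r%:C.
Proof.
move=> z0; have [r r0 zr] := ge0_complexP (ltW z0).
by exists r => //; move: z0; rewrite zr ltcR.
Qed.

Lemma norm_complexE (z : C) : exists2 r : R, 0 <= r & `|z| = r%:C.
Proof. exact: ge0_complexP. Qed.

Lemma Re_norm_le (z : C) : `|Re z|%:C <= `|z|.
Proof. by have := normc_ge_Re z; case: z. Qed.

Lemma norm_i : `|'i| = 1 :> C.
Proof. by rewrite normc_def /= expr0n expr1n add0r sqrtr1. Qed.

Lemma norm_realC (r : R) : `|r%:C| = `|r|%:C.
Proof. by rewrite normc_def /= expr0n addr0 sqrtr_sqr. Qed.

Lemma conj_realC (r : R) : Num.conj r%:C = r%:C.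
Proof. by apply: cReIm_eq; rewrite ?cReJ ?cImJ /= ?oppr0. Qed.

Lemma conj_imaginary (r : R) : Num.conj ('i * r%:C) = - ('i * r%:C) :> C.
Proof. by simpc; apply: cReIm_eq; rewrite ?cReJ ?cImJ /= ?oppr0. Qed.

Lemma i_neq0 : 'i != 0 :> C.
Proof. by rewrite eq_complex /= oner_eq0 andbF. Qed.

Lemma imaginary_neq0 (r : R) : r != 0 -> 'i * r%:C != 0 :> C.
Proof. by move=> r0; simpc; rewrite eq_complex /= eqxx. Qed.

Lemma Im_norm_le (z : C) : `|Im z|%:C <= `|z|.
Proof.
have := Re_norm_le (z * 'i); rewrite ReiNIm normrN normrM.
by rewrite norm_i mulr1.
Qed.

Lemma norm_complex_le (x y : R) : `|x +i* y : C| <= (`|x| + `|y|)%:C.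
Proof.
have -> : x +i* y = x%:C + 'i * y%:C by simpc.
apply: le_trans (ler_normD _ _) _; rewrite rmorphD /= normrM !norm_realC.
by rewrite norm_i mul1r.
Qed.

Lemma complex_continuous (T : topologicalType) (f g : T -> R) :
  continuous f -> continuous g -> continuous (fun t => f t +i* g t : C).
Proof.
move=> cf cg t; apply/(@cvgrPdist_lt _ _ _ (nbhs t)) => e /gt0_complexP[r r0 ->].
have r20 : 0 < r / 2 by rewrite divr_gt0.
near=> s.
have h1 : `|f t - f s| < r / 2 by near: s; move/cvgrPdist_lt : (cf t); exact.
have h2 : `|g t - g s| < r / 2 by near: s; move/cvgrPdist_lt : (cg t); exact.
have -> : (f t +i* g t) - (f s +i* g s) =
  (f t - f s)%:C + 'i * (g t - g s)%:C by simpc.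
apply: le_lt_trans (ler_normD _ _) _.
rewrite normrM norm_i mul1r !norm_realC -rmorphD ltcR.
by rewrite [ltRHS](splitr r) ltrD.
Unshelve. all: by end_near. Qed.

End Complex.

(** * Orthonormal sequences in a Hilbert space *)

Section Dot.
Local Open Scope complex_scope.
Context {R : realType} {H : hilbertType R}.
Local Notation C := R[i].
Implicit Types (u v w : H) (a : C) (b : nat -> H) (c : nat -> C).

Lemma hdotDl u v w : hdot (u + v) w = hdot u w + hdot v w.
Proof. exact: linearDl. Qed.
Lemma hdotDr u v w : hdot u (v + w) = hdot u v + hdot u w.
Proof. exact: linearDr. Qed.
Lemma hdotZl a u v : hdot (a *: u) v = a * hdot u v.
Proof. exact: linearZl_LR. Qed.
Lemma hdotZr a u v : hdot u (a *: v) = Num.conj a * hdot u v.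
Proof. exact: linearZr_LR. Qed.
Lemma hdot0l u : hdot 0 u = 0. Proof. exact: linear0l. Qed.
Lemma hdotNl u v : hdot (- u) v = - hdot u v.
Proof. by rewrite -scaleN1r hdotZl mulN1r. Qed.
Lemma hdotNr u v : hdot u (- v) = - hdot u v.
Proof. by rewrite -scaleN1r hdotZr rmorphN rmorph1 mulN1r. Qed.
Lemma hdotBl u v w : hdot (u - v) w = hdot u w - hdot v w.
Proof. by rewrite hdotDl hdotNl. Qed.
Lemma hdotBr u v w : hdot u (v - w) = hdot u v - hdot u w.
Proof. by rewrite hdotDr hdotNr. Qed.
Lemma hdotC u v : hdot u v = Num.conj (hdot v u).
Proof. by rewrite hermC expr0 mul1r. Qed.
Lemma hdot_suml I (r : seq I) (P : pred I) (F : I -> H) v :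
  hdot (\sum_(i <- r | P i) F i) v = \sum_(i <- r | P i) hdot (F i) v.
Proof. exact: linear_sumlz. Qed.
Lemma hdot_sumr I (r : seq I) (P : pred I) (F : I -> H) v :
  hdot v (\sum_(i <- r | P i) F i) = \sum_(i <- r | P i) hdot v (F i).
Proof. exact: linear_sumr. Qed.

Lemma hdot_norm u : hdot u u = `|u| ^+ 2.
Proof. by rewrite hnormE sqrtCK. Qed.

Lemma hdot_le u v : `|hdot u v| <= `|u| * `|v|.
Proof.
rewrite -ler_sqr ?nnegrE ?mulr_ge0// exprMn -!hdot_norm.
exact: dot_CauchySchwarz.
Qed.

Lemma continuous_hdotl v : continuous (fun u => hdot u v).
Proof.
move=> u; apply/(@cvgrPdist_lt _ _ _ (nbhs u)) => e e0.
have v0 : 0 < `|v| + 1 by rewrite ltr_wpDl.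
near=> w; rewrite -hdotBl; apply: le_lt_trans (hdot_le _ _) _.
apply: (@le_lt_trans _ _ (`|u - w| * (`|v| + 1))).
  by rewrite ler_wpM2l// lerDl.
rewrite -ltr_pdivlMr//; near: w.
by move/cvgrPdist_lt : (@cvg_id _ (nbhs u)); apply; rewrite divr_gt0.
Unshelve. all: by end_near. Qed.

Definition orthonormal_seq b := forall j k, hdot (b j) (b k) = (j == k)%:R.

Definition partial_sum b c n := \sum_(k < n) c k *: b k.

Definition coef b u (k : nat) := hdot u (b k).

Lemma partial_sumS b c n : partial_sum b c n.+1 = partial_sum b c n + c n *: b n.
Proof. by rewrite /partial_sum big_ord_recr. Qed.

Section Orthonormal.
Variable b : nat -> H.
Hypothesis b1 : orthonormal_seq b.

Lemma coef_partial_sum c n k :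
  hdot (partial_sum b c n) (b k) = if (k < n)%N then c k else 0.
Proof.
elim: n => [|n IH]; first by rewrite /partial_sum big_ord0 hdot0l.
rewrite partial_sumS hdotDl IH hdotZl b1 ltnS [(k <= n)%N]leq_eqVlt [(k == n)%B]eq_sym.
by have [->|_] := eqVneq n k; rewrite /= ?ltnn ?mulr1 ?add0r// mulr0 addr0.
Qed.

Lemma hdot_partial_sum c n v :
  hdot (partial_sum b c n) v = \sum_(k < n) c k * Num.conj (hdot v (b k)).
Proof.
by rewrite hdot_suml; apply: eq_bigr => k _; rewrite hdotZl [hdot v _]hdotC conjCK.
Qed.

Lemma norm_partial_sum c n : `|partial_sum b c n| ^+ 2 = \sum_(k < n) `|c k| ^+ 2.
Proof.
rewrite -hdot_norm hdot_partial_sum; apply: eq_bigr => k _.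
by rewrite coef_partial_sum ltn_ord normCK.
Qed.

Lemma norm_partial_sumB c n m : (n <= m)%N ->
  `|partial_sum b c m - partial_sum b c n| ^+ 2 = \sum_(n <= k < m) `|c k| ^+ 2.
Proof.
move=> nm; rewrite -hdot_norm hdotBl !hdotBr !hdot_norm.
have e i j : (i <= j)%N ->
    hdot (partial_sum b c i) (partial_sum b c j) = `|partial_sum b c i| ^+ 2.
  move=> ij; rewrite hdot_partial_sum norm_partial_sum; apply: eq_bigr => k _.
  by rewrite coef_partial_sum (leq_trans (ltn_ord k) ij) normCK.
rewrite (hdotC (partial_sum b c m)) !e//.
rewrite (geC0_conj (exprn_ge0 _ (normr_ge0 _))) subrr subr0 !norm_partial_sum.
rewrite -!(big_mkord xpredT (fun k => `|c k| ^+ 2)).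
by rewrite (@big_cat_nat _ _ _ n 0 m)//= addrAC subrr add0r.
Qed.

Lemma norm_sub_partial_sum u n :
  `|u - partial_sum b (coef b u) n| ^+ 2 =
  `|u| ^+ 2 - \sum_(k < n) `|coef b u k| ^+ 2.
Proof.
rewrite -hdot_norm hdotBl !hdotBr !hdot_norm norm_partial_sum.
rewrite (hdotC u) hdot_partial_sum.
under eq_bigr do rewrite -normCK.
by rewrite geC0_conj ?subrr ?subr0//; apply: sumr_ge0 => k _; rewrite exprn_ge0.
Qed.

Lemma bessel u n : \sum_(k < n) `|coef b u k| ^+ 2 <= `|u| ^+ 2.
Proof. by rewrite -subr_ge0 -norm_sub_partial_sum exprn_ge0. Qed.

(** A bounded series of nonnegative reals is Cauchy, hence so is the orthonormal
    series, and the space is complete. Boundedness rather than convergence is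
    assumed because it is what Bessel's inequality provides. *)
Lemma riesz_fischer c (B : C) : (forall n, \sum_(k < n) `|c k| ^+ 2 <= B) ->
  exists u, partial_sum b c n @[n --> \oo] --> u.
Proof.
move=> cB; have [r r0 Br] : exists2 r : R, 0 <= r & B = r%:C.
  by apply: ge0_complexP; apply: le_trans (cB 0%N); rewrite big_ord0.
pose a k := complex.Re (`|c k| ^+ 2).
have aE k : `|c k| ^+ 2 = (a k)%:C.
  by have [s _ e] := ge0_complexP (exprn_ge0 2 (normr_ge0 (c k))); rewrite /a e.
have a0 k : 0 <= a k by rewrite -ler0c -aE exprn_ge0.
have sumE n m : \sum_(n <= k < m) `|c k| ^+ 2 = (\sum_(n <= k < m) a k)%:C.
  by rewrite rmorph_sum; apply: eq_bigr => k _; rewrite aE.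
have /cauchy_cvgP/cauchy_seriesP acauchy : cvgn (series a).
  apply: nondecreasing_is_cvgn.
    by apply/nondecreasing_seqP => n; rewrite /series /= big_nat_recr//= lerDl.
  exists r => _ [n _ <-]; rewrite -lecR -Br.
  by apply: le_trans (cB n); rewrite -(big_mkord xpredT (fun k => `|c k| ^+ 2)) sumE.
suff : cauchy (partial_sum b c n @[n --> \oo]) by move/cauchy_cvgP/cvg_ex.
apply/cauchy_ballP => _ /gt0_complexP[e e0 ->]; near_simpl.
have e20 : 0 < e ^+ 2 by rewrite exprn_gt0.
have [[P Q]] := acauchy _ e20; case=> -[N1 _ N1P] [N2 _ N2Q] PQ.
have key n m : (maxn N1 N2 <= n)%N -> (n <= m)%N ->
    `|partial_sum b c m - partial_sum b c n| < e%:C.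
  move=> Nn nm; rewrite -ltr_sqr ?nnegrE ?normr_ge0 ?ler0c ?(ltW e0)// norm_partial_sumB// sumE.
  rewrite -rmorphXn ltcR; apply: le_lt_trans (ler_norm _) _.
  apply: (PQ (n, m)); split; first by apply: N1P; rewrite /= (leq_trans _ Nn)// leq_maxl.
  by apply: N2Q; rewrite /= (leq_trans _ nm)// (leq_trans _ Nn)// leq_maxr.
exists ([set n | (maxn N1 N2 <= n)%N], [set n | (maxn N1 N2 <= n)%N]).
  by split; exists (maxn N1 N2).
move=> [n m] [/= Nn Nm]; rewrite -ball_normE /=.
have [nm|mn] := leqP n m; last by apply: key => //; exact: ltnW.
by rewrite distrC; exact: key.
Unshelve. all: by end_near. Qed.

End Orthonormal.
End Dot.

(** * Bounded, diagonal and compact operators *)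

Section Operator.
Local Open Scope complex_scope.
Context {R : realType} {H : hilbertType R}.
Local Notation C := R[i].
Implicit Types (u v w : H) (a : C) (c m : nat -> C) (A B : H -> H).

Lemma norm_lim_le (x : nat -> H) u (r : C) :
  (forall n, `|x n| <= r) -> x n @[n --> \oo] --> u -> `|u| <= r.
Proof.
move=> xr xu; have [s s0 rs] := ge0_complexP (le_trans (normr_ge0 _) (xr 0%N)).
have [t _ ut] := ge0_complexP (normr_ge0 u).
rewrite ut rs lecR; apply/ler_addgt0Pr => e e0.
have eC : 0 < e%:C by rewrite ltcR.
move/cvgrPdist_lt : xu => /(_ _ eC)[n _ /(_ n (leqnn n))] /= ue.
rewrite -lecR rmorphD/= -ut -rs addrC -(subrK (x n) u).
by apply: le_trans (ler_normD _ _) _; apply: lerD => //; exact: ltW.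
Qed.

Lemma linear0_of A : linear A -> A 0 = 0.
Proof. by move=> lA; have := lA (-1) 0 0; rewrite scaleN1r oppr0 addr0 scaleN1r addNr. Qed.

Lemma linearB_of A u v : linear A -> A (u - v) = A u - A v.
Proof. by move=> lA; rewrite addrC -scaleN1r lA scaleN1r addrC. Qed.

Lemma linearZ_of A a u : linear A -> A (a *: u) = a *: A u.
Proof. by move=> lA; have := lA a u 0; rewrite (linear0_of lA) !addr0. Qed.

Lemma linear_sum_of A (I : Type) (r : seq I) (F : I -> C) (x : I -> H) : linear A ->
  A (\sum_(i <- r) F i *: x i) = \sum_(i <- r) F i *: A (x i).
Proof.
move=> lA; elim: r => [|i r IH]; first by rewrite !big_nil linear0_of.
by rewrite !big_cons lA IH.
Qed.

Lemma bounded_operator_continuous A : bounded_operator A -> continuous A.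
Proof.
move=> [lA [M AM]] u; apply/(@cvgrPdist_lt _ _ _ (nbhs u)) => e e0.
have M0 : 0 < `|M| + 1 by rewrite ltr_wpDl.
near=> v; rewrite -linearB_of//.
have [->|uv] := eqVneq u v; first by rewrite subrr linear0_of// normr0.
have uv0 : 0 < `|u - v| by rewrite normr_gt0 subr_eq0.
have M'0 : 0 <= M by rewrite -(pmulr_lge0 _ uv0) (le_trans _ (AM _)).
apply: le_lt_trans (AM _) _.
apply: (@le_lt_trans _ _ ((`|M| + 1) * `|u - v|)).
  by rewrite ler_wpM2r// ger0_norm// lerDl.
rewrite mulrC -ltr_pdivlMr//; near: v.
by move/cvgrPdist_lt : (@cvg_id _ (nbhs u)); apply; rewrite divr_gt0.
Unshelve. all: by end_near. Qed.

Lemma closed_norm_le (f : H -> H) (r : C) : 0 <= r -> continuous f ->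
  closed [set u | `|f u| <= r].
Proof.
move=> r0 cf; have [s s0 ->] := ge0_complexP r0.
have -> : [set u | `|f u| <= s%:C] =
    (fun u => complex.Re `|f u|) @^-1` [set x : R | x <= s].
  apply/funext => u; apply/propext; have [t t0 e] := ge0_complexP (normr_ge0 (f u)).
  by rewrite /= e lecR.
apply: preimage_closed; last exact: closed_le.
move=> u _; apply: (@continuous_comp _ _ _ (fun u => `|f u|)).
  by apply: cvg_norm; exact: cf.
exact: cRe_continuous.
Qed.

(** A square [-s, s]^2 is compact, and an ultrafilter converges to each of its
    cluster points. *)
Lemma ultra_bounded_cvg (T : Type) (U : set_system T) (f : T -> C) (r : C) :
  UltraFilter U -> U [set x | `|f x| <= r] -> exists z : C, f x @[x --> U] --> z.
Proof.
move=> UU Ur; have [x /= /(le_trans (normr_ge0 _))/ge0_complexP[s s0 rs]] := filter_ex Ur.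
rewrite {}rs in Ur.
pose g (p : R * R) : C := p.1 +i* p.2.
have cK : compact (g @` (`[-s, s]%classic `*` `[-s, s]%classic)).
  apply: continuous_compact; last by apply: compact_setX; exact: segment_compact.
  apply: continuous_subspaceT; apply: complex_continuous => p.
    exact: cvg_fst.
  exact: cvg_snd.
have fK : U (f @^-1` (g @` (`[-s, s]%classic `*` `[-s, s]%classic))).
  apply: filterS Ur => y /= fy; exists (complex.Re (f y), complex.Im (f y)).
    split; rewrite /= in_itv /= -ler_norml -lecR; apply: le_trans fy.
      exact: Re_norm_le.
    exact: Im_norm_le.
  by rewrite /g /=; case: (f y).
have [z [_ fz]] := cK (f @ U) _ fK.
exists z => V Vz; have [//|] := in_ultra_setVsetC (f @^-1` V) UU.
by move=> /(fz (~` V) V)/(_ Vz)[? []].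
Qed.

Section Basis.
Variable b : nat -> H.
Hypothesis b1 : orthonormal_seq b.

Lemma coef_lim c u k : partial_sum b c n @[n --> \oo] --> u -> hdot u (b k) = c k.
Proof.
move=> cu; apply/esym.
have l1 : hdot (partial_sum b c n) (b k) @[n --> \oo] --> hdot u (b k).
  exact: cvg_comp cu (@continuous_hdotl _ _ (b k) u).
apply: (@cvg_unique _ (@norm_hausdorff _ C) _ _ _ _ _ l1).
apply: cvg_near_cst; exists k.+1 => // n /= kn.
by rewrite coef_partial_sum// kn.
Qed.

Hypothesis b_total : forall u, (forall k, hdot u (b k) = 0) -> u = 0.

Lemma coef_inj u v : (forall k, hdot u (b k) = hdot v (b k)) -> u = v.
Proof.
move=> uv; apply/eqP; rewrite -subr_eq0; apply/eqP; apply: b_total => k.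
by rewrite hdotBl uv subrr.
Qed.

(** Riesz-Fischer applied to the coefficients of u gives a sum with the same
    coefficients as u, which is u by totality. *)
Lemma expansion u : partial_sum b (coef b u) n @[n --> \oo] --> u.
Proof.
have [v uv] := riesz_fischer b1 (bessel b1 u).
have vu : v = u by apply: coef_inj => k; rewrite (coef_lim _ uv).
by rewrite vu in uv.
Qed.

Lemma parseval u v :
  \sum_(k < n) hdot u (b k) * Num.conj (hdot v (b k)) @[n --> \oo] --> hdot u v.
Proof.
have l : hdot (partial_sum b (coef b u) n) v @[n --> \oo] --> hdot u v.
  exact: (@continuous_cvg _ _ _ _ _ _ (fun w => hdot w v) _
    (@continuous_hdotl _ _ v u) (@expansion u)).
rewrite -[X in X @ _ --> _](_ : (fun n => hdot (partial_sum b (coef b u) n) v) = _)//.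
by apply/funext => n; rewrite hdot_partial_sum.
Qed.

Lemma hdot_ext u v u' v' :
  (forall k, hdot u (b k) * Num.conj (hdot v (b k)) =
             hdot u' (b k) * Num.conj (hdot v' (b k))) -> hdot u v = hdot u' v'.
Proof.
move=> e; apply: (@cvg_unique _ (@norm_hausdorff _ C) _ _ _ _ (@parseval u v)).
have -> : (fun n => \sum_(k < n) hdot u (b k) * Num.conj (hdot v (b k))) =
    (fun n => \sum_(k < n) hdot u' (b k) * Num.conj (hdot v' (b k))).
  by apply/funext => n; apply: eq_bigr => k _.
exact: parseval.
Qed.

(** By Parseval the inner product is a limit of nonnegative partial sums; real and
    imaginary parts are treated apart because the order of the complex numbers is
    partial. *)
Lemma hdot_coef_ge0 u v :
  (forall k, 0 <= hdot u (b k) * Num.conj (hdot v (b k))) -> 0 <= hdot u v.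
Proof.
move=> e0; have s0 n : exists2 r : R, 0 <= r &
    \sum_(k < n) hdot u (b k) * Num.conj (hdot v (b k)) = r%:C.
  by apply: ge0_complexP; apply: sumr_ge0 => k _.
have l1 : complex.Re (\sum_(k < n) hdot u (b k) * Num.conj (hdot v (b k)))
    @[n --> \oo] --> complex.Re (hdot u v).
  exact: (@continuous_cvg _ _ _ _ _ _ _ _ (@cRe_continuous R _) (@parseval u v)).
have l2 : complex.Im (\sum_(k < n) hdot u (b k) * Num.conj (hdot v (b k)))
    @[n --> \oo] --> complex.Im (hdot u v).
  exact: (@continuous_cvg _ _ _ _ _ _ _ _ (@cIm_continuous R _) (@parseval u v)).
have re0 : 0 <= complex.Re (hdot u v).
  rewrite -(cvg_lim (@Rhausdorff R) l1); apply: limr_ge; first by apply/cvg_ex; eexists; exact: l1.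
  by apply: nearW => n /=; have [r r0 ->] := s0 n.
have im0 : complex.Im (hdot u v) = 0.
  apply: (@cvg_unique _ (@Rhausdorff R) _ _ _ _ l2).
  by apply: cvg_near_cst; apply: nearW => n /=; have [r r0 ->] := s0 n.
by move: re0 im0; case: (hdot u v) => x y /= x0 ->; rewrite lecE /= eqxx.
Qed.

(** The expansion of u expresses it as a limit of combinations of basis vectors,
    and bounded operators are continuous. *)
Lemma bounded_operator_ext A B : bounded_operator A -> bounded_operator B ->
  (forall k, A (b k) = B (b k)) -> A = B.
Proof.
move=> bA bB AB; apply/funext => u.
have lA : A (partial_sum b (coef b u) n) @[n --> \oo] --> A u.
  exact: (@continuous_cvg _ _ _ _ _ _ _ _ (@bounded_operator_continuous _ bA u) (@expansion u)).
have lB : B (partial_sum b (coef b u) n) @[n --> \oo] --> B u.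
  exact: (@continuous_cvg _ _ _ _ _ _ _ _ (@bounded_operator_continuous _ bB u) (@expansion u)).
apply: (@cvg_unique _ (@norm_hausdorff _ H) _ _ _ _ lA).
suff -> : (fun n => A (partial_sum b (coef b u) n)) =
    (fun n => B (partial_sum b (coef b u) n)) by [].
apply/funext => n; case: bA bB => [linA _] [linB _].
by rewrite /partial_sum !linear_sum_of//; apply: eq_bigr => k _; rewrite AB.
Qed.

(** Bessel's inequality bounds the partial sums of the multiplied coefficients, so
    that Riesz-Fischer produces A u; additivity then holds coefficientwise. *)
Lemma diagonal_operator_exists m (M : C) : (forall k, `|m k| <= M) ->
  exists2 A, bounded_operator A & forall u k, hdot (A u) (b k) = m k * hdot u (b k).
Proof.
move=> mM; have M0 : 0 <= M by apply: le_trans (mM 0%N).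
have sumM u n : \sum_(k < n) `|m k * coef b u k| ^+ 2 <= (M * `|u|) ^+ 2.
  apply: (@le_trans _ _ (M ^+ 2 * \sum_(k < n) `|coef b u k| ^+ 2)).
    rewrite mulr_sumr; apply: ler_sum => k _; rewrite normrM exprMn.
    by rewrite ler_wpM2r ?exprn_ge0// lerXn2r ?nnegrE.
  by rewrite exprMn ler_wpM2l ?exprn_ge0// bessel.
have /choice[A AE] u : exists w,
    partial_sum b (fun k => m k * coef b u k) n @[n --> \oo] --> w.
  exact: (@riesz_fischer _ _ b b1 (fun k => m k * coef b u k) _ (sumM u)).
have Ac u k : hdot (A u) (b k) = m k * hdot u (b k) by rewrite (coef_lim _ (AE u)).
exists A => //; split.
  move=> a u v; apply: coef_inj => k.
  by rewrite hdotDl hdotZl !Ac hdotDl hdotZl mulrDr mulrCA.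
exists M => u; apply: norm_lim_le (AE u) => n.
by rewrite -ler_sqr ?nnegrE ?mulr_ge0// norm_partial_sum.
Qed.

Lemma partial_sum_coef_continuous n :
  continuous (fun u => partial_sum b (coef b u) n).
Proof.
elim: n => [|n IH] u.
  by rewrite /partial_sum; under eq_fun do rewrite big_ord0; rewrite ?big_ord0; exact: cvg_cst.
under eq_fun do rewrite partial_sumS; rewrite ?partial_sumS.
apply: cvgD; first exact: IH.
by apply: cvgZl; exact: continuous_hdotl.
Qed.

(** Along an ultrafilter on X each coefficient converges, because X is bounded.
    Uniform smallness of the tails turns this coordinatewise convergence into the
    Cauchy property, and the space is complete. *)
Lemma precompact_coef (X : set H) (r : C) : (forall u, X u -> `|u| <= r) ->
  (forall e : R, 0 < e -> exists N, forall u, X u ->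
    `|u - partial_sum b (coef b u) N| <= e%:C) -> precompact X.
Proof.
move=> Xr Xe; have [->|/set0P[u0 Xu0]] := eqVneq X set0.
  by exists set0 => //; split; [exact: compact0|exact: closed0].
have r0 : 0 <= r by apply: le_trans (Xr _ Xu0).
have /choice[N NE] (e : R) : exists N, 0 < e -> forall u, X u ->
    `|u - partial_sum b (coef b u) N| <= e%:C.
  by have [/Xe[N NE]|e0] := pselect (0 < e); [exists N|exists 0%N].
pose Y := [set u | `|u| <= r] `&` \bigcap_(e in [set e : R | 0 < e])
  [set u | `|u - partial_sum b (coef b u) (N e)| <= e%:C].
have cY : closed Y.
  apply: closedI; first by apply: (@closed_norm_le id r r0) => u; exact: cvg_id.
  apply: closed_bigI => e /= e0; apply: closed_norm_le; first by rewrite ler0c ltW.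
  by move=> u; apply: cvgB; [exact: cvg_id|exact: partial_sum_coef_continuous].
exists Y; first by move=> u Xu; split=> [|e e0] /=; [exact: Xr|exact: NE].
split=> //; rewrite compact_ultra => U UU UY /=.
have PU := @ultra_proper _ _ UU.
have /choice[z zE] k : exists z : C, hdot u (b k) @[u --> U] --> z.
  apply: (@ultra_bounded_cvg _ _ _ (r * `|b k|)) => //.
  apply: filterS UY => u [/= ur _]; apply: le_trans (hdot_le _ _) _.
  by rewrite ler_wpM2r.
have zN n : partial_sum b (coef b u) n @[u --> U] --> partial_sum b z n.
  elim: n => [|n IH].
    by rewrite /partial_sum; under eq_fun do rewrite big_ord0; rewrite ?big_ord0; exact: cvg_cst.
  under eq_fun do rewrite partial_sumS; rewrite ?partial_sumS.
  by apply: cvgD => //; apply: cvgZl; exact: zE.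
have : cauchy U.
  apply: cauchy_exP => _ /gt0_complexP[e e0 ->].
  have e20 : 0 < e / 2 by rewrite divr_gt0.
  have e20C : 0 < (e / 2)%:C by rewrite ltcR.
  exists (partial_sum b z (N (e / 2))).
  have /cvgrPdist_lt/(_ _ e20C) zU := zN (N (e / 2)).
  apply: filterS2 UY zU => u [_ /(_ _ e20) /= uN] zu.
  rewrite -ball_normE /= [e in e%:C]splitr rmorphD /=.
  rewrite -(subrK (partial_sum b (coef b u) (N (e / 2))) (partial_sum b z _)) -addrA.
  apply: le_lt_trans (ler_normD _ _) _; apply: ltr_leD => //.
  by rewrite distrC.
move=> /cauchy_cvgP/cvg_ex[p Up]; exists p; split=> //.
by apply: cY => V /Up UV; exact: filter_ex (filterI UY UV).
Qed.

(** On the unit ball the tail of A u beyond n is at most the supremum of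
    `|m k| over k >= n, by Bessel's inequality. *)
Lemma diagonal_operator_compact A m (M : C) : linear A ->
  (forall k, `|m k| <= M) -> m k @[k --> \oo] --> (0 : C) ->
  (forall u k, hdot (A u) (b k) = m k * hdot u (b k)) -> compact_operator A.
Proof.
move=> lA mM m0 AE; split=> //.
(* the tail is a limit of finite sums, which Bessel's inequality bounds *)
have tail u (e : C) n : (forall k, (n <= k)%N -> `|m k| <= e) -> `|u| <= 1 ->
    `|A u - partial_sum b (coef b (A u)) n| <= e.
  move=> me u1; have e0 : 0 <= e by apply: le_trans (me n _).
  have lim : partial_sum b (coef b (A u)) (k + n)%N - partial_sum b (coef b (A u)) n
      @[k --> \oo] --> A u - partial_sum b (coef b (A u)) n.
    apply: cvgB; last exact: cvg_cst.
    have := @expansion (A u); rewrite -(cvg_shiftn n); exact.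
  apply: norm_lim_le lim => k; rewrite -ler_sqr ?nnegrE// norm_partial_sumB ?leq_addl//.
  apply: (@le_trans _ _ (e ^+ 2 * \sum_(n <= j < k + n) `|coef b u j| ^+ 2)).
    rewrite mulr_sumr !big_nat; apply: ler_sum => j /andP[nj _].
    rewrite /coef AE normrM exprMn ler_wpM2r ?exprn_ge0// lerXn2r ?nnegrE//.
    exact: me.
  rewrite -[leRHS]mulr1 ler_wpM2l ?exprn_ge0//.
  apply: (@le_trans _ _ (`|u| ^+ 2)); last by rewrite exprn_ile1.
  apply: le_trans (bessel b1 u (k + n)).
  rewrite -(big_mkord xpredT (fun j => `|coef b u j| ^+ 2)).
  rewrite [leRHS](@big_cat_nat _ _ _ n) ?leq_addl//= lerDr.
  by apply: sumr_ge0 => j _; rewrite exprn_ge0.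
apply: (@precompact_coef _ M) => [_ [u /= u1 <-]|e e0].
  have := @tail u M 0%N (fun k _ => mM k) u1.
  by rewrite /partial_sum big_ord0 subr0.
have eC : 0 < e%:C by rewrite ltcR.
have [n _ nP] := (iffLR (cvgrPdist_lt _ _) m0) _ eC.
exists n => _ [u /= u1 <-]; apply: tail => // k nk.
by have := nP k nk; rewrite /= sub0r normrN => /ltW.
Qed.

(** A cluster point y of the vectors A (v n) would make the pairing of A (v n)
    with w n close, infinitely often, to that of y with w n. But y is up to a
    small error a finite combination of basis vectors, and w n is eventually
    orthogonal to such a combination. *)
Lemma not_compact_operator A (v w : nat -> H) (r : R) : 0 < r ->
  (forall n, `|v n| <= 1) -> (forall n, `|w n| <= 1) ->
  (forall k, \forall n \near \oo, hdot (b k) (w n) = 0) ->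
  (forall n, r%:C <= `|hdot (A (v n)) (w n)|) -> ~ compact_operator A.
Proof.
move=> r0 v1 w1 bw Avw [_ [K imK [cK _]]].
have [|y [_ yc]] := cK (A (v n) @[n --> \oo]).
  by exists 0%N => // n _; apply: imK; exists (v n) => //=.
have r20 : 0 < (r / 2)%:C by rewrite ltcR divr_gt0.
have /cvgrPdist_lt/(_ _ r20)[N _ /(_ N (leqnn N)) /= yN] := @expansion y.
have : \forall n \near \oo, hdot (partial_sum b (coef b y) N) (w n) = 0.
  elim: N {yN} => [|N IH]; first by apply: nearW => n; rewrite /partial_sum big_ord0 hdot0l.
  apply: filterS2 IH (bw N) => n n1 n2.
  by rewrite partial_sumS hdotDl n1 hdotZl n2 mulr0 addr0.
move=> [n0 _ n0P].
have [_ [[n /= n0n <-] yA]] : (A \o v) @` [set n | (n0 <= n)%N] `&` ball y (r / 2)%:C !=set0.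
  apply: yc; last exact: nbhsx_ballx.
  by exists n0 => // n n0n; exists n.
rewrite -ball_normE /= in yA.
have := Avw n; rewrite -(subrK y (A (v n))) hdotDl.
have -> : hdot y (w n) = hdot (y - partial_sum b (coef b y) N) (w n).
  by rewrite hdotBl n0P// subr0.
apply/negP; rewrite lt_geF//; apply: le_lt_trans (ler_normD _ _) _.
rewrite [r in r%:C]splitr rmorphD /=.
by apply: ltrD; apply: le_lt_trans (hdot_le _ _) _; [rewrite distrC in yA|];
  apply: le_lt_trans (ler_piMr _ (w1 n)) _.
Qed.

End Basis.
End Operator.

(** * Cousin's lemma and derivatives of complex functions *)

Section Cousin.
Context {R : realType}.

(** Compactness of [a, b] in the form that suits predicates of intervals that are
    additive under concatenation: the supremum of the c with P a c is attained
    and cannot lie before b, because P holds on every small interval around it.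
    As in Cousin's theorem on gauges, the local hypothesis only concerns intervals
    that contain the tag x. *)
Lemma cousin (P : R -> R -> Prop) (a b : R) : a <= b ->
  (forall x y z, a <= x -> x <= y -> y <= z -> z <= b ->
     P x y -> P y z -> P x z) ->
  (forall x, a <= x -> x <= b -> exists2 d, 0 < d &
     forall s t, a <= s -> s <= x -> x <= t -> t <= b ->
       x - d < s -> t < x + d -> P s t) ->
  P a b.
Proof.
move=> ab Padd Ploc.
pose S := [set c | [/\ a <= c, c <= b & P a c]].
have Paa : P a a.
  have [d d0] := Ploc a (lexx a) ab.
  by apply; rewrite ?lexx// ?ltrBlDr ltrDl.
have Sa : S a by split.
have Sb : has_sup S by split; [exists a|exists b => c [_ ? _]].
pose s := sup S.
have a_s : a <= s by apply: ub_le_sup => //; exact: Sb.2.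
have s_b : s <= b by apply: ge_sup; [exists a|move=> c [_ ? _]].
have [d d0 dP] := Ploc s a_s s_b.
have [c [ac cb Pac] sdc] := sup_adherent d0 Sb.
have cs : c <= s by apply: ub_le_sup; [exact: Sb.2|split].
(* t lies beyond s unless s = b *)
pose t := Num.min (s + d / 2) b.
have d20 : 0 < d / 2 by rewrite divr_gt0.
have st : s <= t by rewrite le_min s_b lerDl ltW.
have tb : t <= b by rewrite ge_min lexx orbT.
have td : t < s + d by rewrite gt_min ltrD2l gtr_pMr// invf_lt1 ?ltr1n.
have Pat : P a t.
  by apply: (Padd a c t) => //; [exact: le_trans st|exact: dP].
have ts : t <= s.
  by apply: ub_le_sup; [exact: Sb.2|split => //; exact: le_trans st].
suff tE : t = b by rewrite -tE.
move: ts; rewrite {1}/t ge_min => /orP[|bs].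
  by rewrite gerDl leNgt d20.
by apply/eqP; rewrite eq_le tb/= (le_trans bs).
Qed.

End Cousin.

Section Derivative.
Local Open Scope complex_scope.
Context {R : realType}.
Local Notation C := R[i].
Implicit Types (f g : R -> C) (A : set R).

(** First order approximation, which unlike the difference quotient makes sense at
    y = x. *)
Lemma has_derivative_withinP A f x l : has_derivative_within A f x l <->
  forall e : R, 0 < e -> exists2 d, 0 < d & forall y, A y -> `|y - x| < d ->
    `|f y - f x - l * (y - x)%:C| <= (e * `|y - x|)%:C.
Proof.
split=> [/cvgrPdist_lt fl e e0|fl].
- have eC : 0 < e%:C by rewrite ltcR.
  have := fl _ eC; rewrite /within /= => /nbhs_ballP[d /= d0 dP].
  exists d => // y Ay yx; have [->|yNx] := eqVneq y x.
    by rewrite !subrr mulr0 subrr !normr0 mulr0.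
  have yx0 : (y - x)%:C != 0 by rewrite eq_complex /= eqxx andbT subr_eq0.
  have := dP y; rewrite -ball_normE /= distrC => /(_ yx yNx Ay)/ltW.
  rewrite -[X in X <= _](mulfK (x := `|(y - x)%:C|)) ?normr_eq0//.
  rewrite -normrM mulrBl mulfVK// distrC ler_pdivrMr ?normr_gt0//.
  by rewrite norm_realC rmorphM.
- apply/cvgrPdist_lt => _ /gt0_complexP[e e0 ->].
  have e20 : 0 < e / 2 by rewrite divr_gt0.
  have [d d0 dP] := fl _ e20.
  rewrite /within /=; apply/nbhs_ballP; exists d => //= y; rewrite -ball_normE /=.
  move=> yx yNx Ay; have yx0 : (y - x)%:C != 0 by rewrite eq_complex /= eqxx andbT subr_eq0.
  have fe : _ := dP y Ay; rewrite distrC in yx; have {}fe := fe yx.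
  rewrite -[X in X < _](mulfK (x := `|(y - x)%:C|)) ?normr_eq0//.
  rewrite -normrM mulrBl mulfVK// distrC ltr_pdivrMr ?normr_gt0//.
  apply: le_lt_trans fe _.
  rewrite norm_realC -rmorphM ltcR.
  by rewrite ltr_pM2r ?normr_gt0 ?subr_eq0// gtr_pMr// invf_lt1 ?ltr1n.
Qed.

Lemma has_derivative_within_continuous A f x l : has_derivative_within A f x l ->
  f @ within A (nbhs x) --> f x.
Proof.
move=> /has_derivative_withinP/(_ 1 ltr01)[d d0 dP].
apply/cvgrPdist_lt => _ /gt0_complexP[e e0 ->].
have [k _ lk] := norm_complexE l.
have k0 : 0 <= k by rewrite -ler0c -lk.
pose r := Num.min d (e / (k + 2)).
have r0 : 0 < r by rewrite lt_min d0 divr_gt0//; lra.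
rewrite /within /=; apply/nbhs_ballP; exists r => //= y; rewrite -ball_normE /=.
rewrite distrC lt_min => /andP[yd ye] Ay; rewrite distrC.
rewrite -(subrK (l * (y - x)%:C) (f y - f x)).
apply: le_lt_trans (ler_normD _ _) _.
apply: (@le_lt_trans _ _ ((`|y - x| * (k + 1))%:C)); last first.
  rewrite ltcR; move: ye; rewrite ltr_pdivlMr ?ltr_wpDl//; apply: le_lt_trans.
  by rewrite ler_wpM2l// lerD2l ler1n.
rewrite mulrDr mulr1 [X in _ <= X%:C]addrC [X in _ <= X]rmorphD; apply: lerD.
  by have := dP y Ay yd; rewrite mul1r.
rewrite normrM lk norm_realC -rmorphM.
by rewrite mulrC.
Qed.

Lemma has_derivative_within_cst A (c : C) x : has_derivative_within A (fun=> c) x 0.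
Proof.
apply/has_derivative_withinP => e e0; exists 1 => // y _ _.
by rewrite subrr mul0r subr0 normr0 ler0c mulr_ge0// ltW.
Qed.

Lemma has_derivative_within_id A x : has_derivative_within A (@id01 R) x 1.
Proof.
apply/has_derivative_withinP => e e0; exists 1 => // y _ _.
by rewrite /id01 -rmorphB mul1r subrr normr0 ler0c mulr_ge0// ltW.
Qed.

Lemma has_derivative_withinM A f g x l m : A x ->
  has_derivative_within A f x l -> has_derivative_within A g x m ->
  has_derivative_within A (fun y => f y * g y) x (l * g x + f x * m).
Proof.
move=> Ax fl gm.
have gx : g y @[y --> within A x^'] --> g x.
  move=> B /(has_derivative_within_continuous gm); rewrite /within /=.
  by move=> /nbhs_ballP[d d0 dB]; apply/nbhs_ballP; exists d => // y /dB.
rewrite /has_derivative_within.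
have -> : (fun y => (f y * g y - f x * g x) / (y - x)%:C) =
    (fun y => (f y - f x) / (y - x)%:C * g y + f x * ((g y - g x) / (y - x)%:C)).
  by apply/funext => y; ring.
exact: cvgD (cvgM fl gx) (cvgM (cvg_cst (f x)) gm).
Qed.

Lemma has_derivative_withinD A f g x l m :
  has_derivative_within A f x l -> has_derivative_within A g x m ->
  has_derivative_within A (fun y => f y + g y) x (l + m).
Proof.
move=> fl gm; rewrite /has_derivative_within.
have -> : (fun y => (f y + g y - (f x + g x)) / (y - x)%:C) =
    (fun y => (f y - f x) / (y - x)%:C + (g y - g x) / (y - x)%:C).
  by apply/funext => y; ring.
exact: cvgD fl gm.
Qed.

Lemma has_derivative_within_conj A f x l : has_derivative_within A f x l ->
  has_derivative_within A (fun y => Num.conj (f y)) x (Num.conj l).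
Proof.
move=> /has_derivative_withinP fl; apply/has_derivative_withinP => e e0.
have [d d0 dP] := fl e e0; exists d => // y Ay yx.
have <- : Num.conj (y - x)%:C = (y - x)%:C by exact: conj_realC.
by rewrite -rmorphM -!rmorphB norm_conjC; exact: dP.
Qed.

End Derivative.

(** * Absolutely continuous functions *)

Section AbsolutelyContinuous.
Local Open Scope complex_scope.
Context {R : realType}.
Local Notation C := R[i].
Local Notation mu := (@lebesgue_measure R).
Implicit Types (f g : R -> C).

Lemma lebesgue_measure_disjoint_itv n (s t : 'I_n -> R) : (forall i, s i <= t i) ->
  trivIset setT (fun i => `]s i, t i[%classic) ->
  mu (\big[setU/set0]_(i < n) `]s i, t i[%classic) = (\sum_(i < n) (t i - s i))%:E.
Proof.
move=> st tI; have mE i : mu `]s i, t i[%classic = (t i - s i)%:E.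
  rewrite lebesgue_measure_itv /= lte_fin; case: ltP => [//|ts].
  by have -> : t i = s i; [apply/eqP; rewrite eq_le ts st|rewrite subrr].
rewrite measure_semi_additive_ord//.
- by rewrite -sumEFin; apply: eq_bigr => i _; exact: mE.
- by apply: bigsetU_measurable => i _; exact: measurable_itv.
Qed.

(** Cover the exceptional null set by an open set U of small measure, and let P s t
    say that the increment of g over [s, t] is at most e (t - s), up to the
    increments of g over finitely many disjoint intervals inside U. This predicate
    is additive and holds locally: near a point where g' = 0 with no interval at
    all, and near an exceptional point with the single interval [s, t]. By Cousin's
    lemma P a b holds, and absolute continuity makes the sum over U small. *)
Lemma absolutely_continuous_derivative0 (a b : R) g : a <= b ->
  absolutely_continuous a b g ->
  {ae mu, forall x, x \in `[a, b] -> has_derivative_within `[a, b] g x 0} ->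
  g b = g a.
Proof.
move=> ab acg [N [mN N0 NP]].
have key (e : R) : 0 < e -> `|g b - g a| <= (e * (b - a) + e)%:C.
  move=> e0; have [d d0 dP] := acg e e0.
  have Noo : (mu N < +oo)%E by rewrite N0.
  have [U [oU NU UNd]] := lebesgue_regularity_outer mN Noo d0.
  have Ud : (mu U < d%:E)%E.
    apply: le_lt_trans UNd; rewrite -[leRHS]add0e -N0.
    rewrite -[X in (mu X <= _)%E](setDUK NU) measureU//.
    - by apply: measurableD => //; exact: open_measurable.
    - by rewrite setDIK.
  pose P (s t : R) := exists n (l r : 'I_n -> R),
    [/\ forall i, [/\ s <= l i, l i <= r i, r i <= t & `[l i, r i] `<=` U],
        trivIset setT (fun i => `]l i, r i[%classic) &
        `|g t - g s| <= (e * (t - s))%:C + \sum_(i < n) `|g (r i) - g (l i)|].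
  have [n [l [r [lr tI gab]]]] : P a b.
    apply: cousin => //.
    - move=> x y z _ xy yz _ [n1 [l1 [r1 [lr1 t1 g1]]]] [n2 [l2 [r2 [lr2 t2 g2]]]].
      pose l i := match fintype.split i with inl j => l1 j | inr j => l2 j end.
      pose r i := match fintype.split i with inl j => r1 j | inr j => r2 j end.
      exists (n1 + n2)%N, l, r; split.
      + move=> i; rewrite /l /r; case: fintype.splitP => j _.
          by have [? ? ? ?] := lr1 j; split=> //; exact: le_trans yz.
        by have [? ? ? ?] := lr2 j; split=> //; exact: le_trans xy _.
      + have disj j k (u : R) : `]l1 j, r1 j[%classic u -> `]l2 k, r2 k[%classic u -> False.
          rewrite /= !in_itv /= => /andP[_ u1] /andP[u2 _].
          have [_ _ r1y _] := lr1 j; have [yl2 _ _ _] := lr2 k.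
          have := lt_trans u2 u1; rewrite ltNge => /negP; apply.
          exact: le_trans r1y yl2.
        move=> i1 i2 _ _; rewrite /l /r -[i1]fintype.splitK -[i2]fintype.splitK !fintype.unsplitK.
        case: (fintype.split i1) (fintype.split i2) => [j1|j1] [j2|j2] /= [u [u1 u2]].
        * by congr (fintype.unsplit (inl _)); apply: t1 => //; exists u.
        * by case: (disj _ _ _ u1 u2).
        * by case: (disj _ _ _ u2 u1).
        * by congr (fintype.unsplit (inr _)); apply: t2 => //; exists u.
      + rewrite big_split_ord /=.
        have -> : \sum_(i < n1) `|g (r (lshift n2 i)) - g (l (lshift n2 i))| =
            \sum_(i < n1) `|g (r1 i) - g (l1 i)|.
          apply: eq_bigr => i _.
          by rewrite /l /r -[lshift _ _]/(fintype.unsplit (inl i)) fintype.unsplitK.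
        have -> : \sum_(i < n2) `|g (r (rshift n1 i)) - g (l (rshift n1 i))| =
            \sum_(i < n2) `|g (r2 i) - g (l2 i)|.
          apply: eq_bigr => i _.
          by rewrite /l /r -[rshift _ _]/(fintype.unsplit (inr i)) fintype.unsplitK.
        have -> : g z - g x = (g z - g y) + (g y - g x) by rewrite addrA subrK.
        have -> : (e * (z - x))%:C = (e * (z - y))%:C + (e * (y - x))%:C.
          by rewrite -rmorphD -mulrDr addrA subrK.
        apply: le_trans (ler_normD _ _) _; apply: le_trans (lerD g2 g1) _.
        by rewrite le_eqVlt; apply/orP; left; apply/eqP; ring.
    - move=> x ax xb; have [Nx|Nx] := pselect (N x).
        have /nbhs_ballP[d1 /= d10 d1U] := open_nbhs_nbhs (conj oU (NU _ Nx)).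
        exists d1 => // s t as_ sx xt tb xs tx.
        exists 1%N, (fun=> s), (fun=> t); split.
        + move=> _; split=> //; first exact: le_trans xt.
          move=> u /=; rewrite in_itv /= => /andP[su ut]; apply: d1U.
          by rewrite -ball_normE /= ltr_distlC; apply/andP; split;
             [exact: lt_le_trans su|exact: le_lt_trans tx].
        + by move=> i j _ _ _; rewrite !ord1.
        + by rewrite big_ord1 lerDr ler0c mulr_ge0 ?(ltW e0)// subr_ge0 (le_trans sx).
      have gx : has_derivative_within `[a, b] g x 0.
        apply: contrapT => gx; apply: Nx; apply: NP => /= /(_ _).
        by apply: contra_not gx; apply; rewrite in_itv /= ax.
      have [d1 d10 d1P] := (iffLR (has_derivative_withinP _ _ _ _)) gx e e0.
      exists d1 => // s t as_ sx xt tb xs tx.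
      exists 0%N, (fun=> 0), (fun=> 0); split; [by case|by case|].
      rewrite big_ord0 addr0.
      have Is : `[a, b]%classic s by rewrite /= in_itv /= as_ (le_trans sx).
      have It : `[a, b]%classic t by rewrite /= in_itv /= tb andbT (le_trans ax).
      have := d1P t It; rewrite mul0r subr0 ger0_norm ?subr_ge0// ltrBlDl => /(_ tx) ht.
      have := d1P s Is; rewrite mul0r subr0 distrC ger0_norm ?subr_ge0// ltrBlDr -ltrBlDl => hs.
      have -> : g t - g s = (g t - g x) - (g s - g x) by ring.
      have -> : (e * (t - s))%:C = (e * (t - x))%:C + (e * (x - s))%:C.
        by rewrite -rmorphD -mulrDr addrA subrK.
      apply: le_trans (ler_normB _ _) _; by apply: lerD => //; apply: hs.
  apply: le_trans gab _; rewrite rmorphD /= lerD2l; apply: ltW; apply: dP => //.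
    by move=> i; have [] := lr i.
  rewrite -lte_fin -lebesgue_measure_disjoint_itv//; last by move=> i; have [] := lr i.
  apply: le_lt_trans Ud; apply: le_measure; rewrite ?inE.
  - by apply: bigsetU_measurable => i _; exact: measurable_itv.
  - exact: open_measurable.
  - move=> x; rewrite -bigcup_seq => -[i _] /= xlr; have [_ _ _] := lr i; apply.
    exact: subset_itv_oo_cc.
apply/eqP; rewrite -subr_eq0 -normr_eq0; have [r r0 rE] := norm_complexE (g b - g a).
rewrite rE eq_complex /= eqxx andbT eq_le r0 andbT.
apply/ler_addgt0Pr => e e0; rewrite add0r.
have k0 : 0 < b - a + 1 by rewrite ltr_wpDl ?subr_ge0.
have := key (e / (b - a + 1)) (divr_gt0 e0 k0).
rewrite rE lecR => /le_trans; apply; rewrite -{2}[_ / _]mulr1 -mulrDr mulfVK//.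
by rewrite gt_eqF.
Qed.

End AbsolutelyContinuous.

Section AbsolutelyContinuousAlgebra.
Local Open Scope complex_scope.
Context {R : realType}.
Local Notation C := R[i].
Local Notation I01 := (`[0, 1]%classic : set R).
Implicit Types (f g : R -> C).

Lemma lipschitz_absolutely_continuous (a b K : R) f :
  (forall s t, a <= s -> s <= t -> t <= b -> `|f t - f s| <= (K * (t - s))%:C) ->
  absolutely_continuous a b f.
Proof.
(* K may be negative if there is no pair s < t *)
move=> fK e e0; pose L := Num.max K 0 + 1.
have L0 : 0 < L by rewrite ltr_wpDl// le_max lexx orbT.
exists (e / L); first exact: divr_gt0.
move=> n s t st _; rewrite ltr_pdivlMr// mulrC => sum_lt.
apply: (@le_lt_trans _ _ (L * \sum_(i < n) (t i - s i))%:C); last by rewrite ltcR.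
rewrite mulr_sumr rmorph_sum; apply: ler_sum => i _; have [as_ sti tb] := st i.
apply: le_trans (fK _ _ as_ sti tb) _; rewrite lecR ler_wpM2r ?subr_ge0//.
by rewrite /L ler_wpDr// le_max lexx.
Qed.

(** The mean value inequality; the mean value theorem itself fails for complex
    values, so Cousin's lemma replaces it. The added 1 absorbs the error term of
    the first order approximation. *)
Lemma bounded_derivative_lipschitz (a b K : R) f (df : R -> C) :
  (forall x, x \in `[a, b] -> has_derivative_within `[a, b] f x (df x)) ->
  (forall x, x \in `[a, b] -> `|df x| <= K%:C) ->
  forall s t, a <= s -> s <= t -> t <= b -> `|f t - f s| <= ((K + 1) * (t - s))%:C.
Proof.
move=> fdf dfK s t as_ st tb.
apply: (cousin (P := fun s t => `|f t - f s| <= ((K + 1) * (t - s))%:C)) => //.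
  move=> x y z _ _ _ _ h1 h2; rewrite -(subrK (f y) (f z)) -addrA.
  have -> : (K + 1) * (z - x) = (K + 1) * (z - y) + (K + 1) * (y - x) by ring.
  by apply: le_trans (ler_normD _ _) _; rewrite rmorphD /= addrC addrC; exact: lerD.
move=> x sx xt.
have Ix : x \in `[a, b] by rewrite in_itv /= (le_trans as_ sx) (le_trans xt tb).
have [d d0 dP] := (iffLR (has_derivative_withinP _ _ _ _)) (fdf x Ix) 1 ltr01.
have near_tag y : y \in `[a, b] -> `|y - x| < d -> `|f y - f x| <= ((K + 1) * `|y - x|)%:C.
  move=> Iy yx; rewrite -(subrK (df x * (y - x)%:C) (f y - f x)).
  apply: le_trans (ler_normD _ _) _.
  have -> : ((K + 1) * `|y - x|)%:C = (1 * `|y - x|)%:C + (K * `|y - x|)%:C.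
    by rewrite -rmorphD -mulrDl [1 + K]addrC.
  apply: lerD; first exact: dP.
  by rewrite normrM norm_realC rmorphM /= ler_wpM2r ?ler0c// dfK.
exists d => // u v su ux xv vt xdu vxd.
have Iu : u \in `[a, b] by rewrite in_itv /= (le_trans as_ su) (le_trans ux)// (le_trans xt).
have Iv : v \in `[a, b] by rewrite in_itv /= (le_trans vt tb) (le_trans as_)// (le_trans sx).
have := near_tag v Iv; rewrite ger0_norm ?subr_ge0// ltrBlDl => /(_ vxd) hv.
have := near_tag u Iu; rewrite distrC ger0_norm ?subr_ge0// ltrBlDr -ltrBlDl => /(_ xdu) hu.
have -> : f v - f u = (f v - f x) + (f x - f u) by rewrite addrA subrK.
have -> : (K + 1) * (v - u) = (K + 1) * (v - x) + (K + 1) * (x - u) by ring.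
apply: le_trans (ler_normD _ _) _; rewrite [leRHS]rmorphD; apply: lerD => //.
by rewrite distrC.
Qed.

Lemma absolutely_continuous_linear (a b : R) (c : C) f g :
  absolutely_continuous a b f -> absolutely_continuous a b g ->
  absolutely_continuous a b (fun x => c * f x + g x).
Proof.
move=> acf acg e e0; have [k k0 ck] := norm_complexE c.
have k10 : 0 < k + 1 by rewrite ltr_wpDl.
have [d d0 dP] := acf (e / 2 / (k + 1)) (divr_gt0 (divr_gt0 e0 (ltr0Sn _ 1)) k10).
have [d' d'0 d'P] := acg (e / 2) (divr_gt0 e0 (ltr0Sn _ 1)).
exists (Num.min d d'); first by rewrite lt_min d0.
move=> n s t st tI; rewrite lt_min => /andP[sd sd'].
apply: (@le_lt_trans _ _ (\sum_(i < n) ((k + 1)%:C * `|f (t i) - f (s i)| +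
                                        `|g (t i) - g (s i)|))).
  apply: ler_sum => i _.
  have -> : c * f (t i) + g (t i) - (c * f (s i) + g (s i)) =
    c * (f (t i) - f (s i)) + (g (t i) - g (s i)) by ring.
  apply: le_trans (ler_normD _ _) _; rewrite lerD2r.
  by rewrite normrM ck ler_wpM2r// lecR lerDl.
rewrite big_split /= -mulr_sumr [e]splitr [ltRHS]rmorphD; apply: ltrD; last exact: d'P.
have := dP n s t st tI sd; rewrite [ltRHS]rmorphM [in ltRHS]fmorphV.
by rewrite ltr_pdivlMr ?ltcR// mulrC.
Qed.

Lemma absolutely_continuous_within f : absolutely_continuous 0 1 f ->
  {within I01, continuous f}.
Proof.
move=> acf; apply/subspace_continuousP => x Ix.
apply/cvgrPdist_lt => _ /gt0_complexP[e e0 ->]; have [d d0 dP] := acf e e0.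
rewrite /within /=; apply/nbhs_ballP; exists d => //= y; rewrite -ball_normE /= => xy Iy.
move: Ix Iy; rewrite /= !in_itv /= => /andP[x0 x1] /andP[y0 y1].
have key (u v : R) : 0 <= u -> u <= v -> v <= 1 -> v - u < d -> `|f v - f u| < e%:C.
  move=> u0 uv v1 uvd; have := dP 1%N (fun=> u) (fun=> v).
  rewrite !big_ord1; apply=> //.
  by move=> i j _ _ _; rewrite !ord1.
have [le_xy|/ltW le_yx] := leP x y.
  by rewrite distrC; apply: key => //; move: xy; rewrite distrC ger0_norm// subr_ge0.
by apply: key => //; move: xy; rewrite ger0_norm// subr_ge0.
Qed.

Lemma within_norm_bounded f : {within I01, continuous f} ->
  exists2 K : R, 0 <= K & forall x, x \in `[0, 1] -> `|f x| <= K%:C.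
Proof.
move=> /within_sqmod_bounded[K K0 fK]; exists (Num.sqrt K); first exact: sqrtr_ge0.
by move=> x /fK xK; rewrite normc_def lecR ler_wsqrtr.
Qed.

Lemma absolutely_continuousM f g :
  absolutely_continuous 0 1 f -> absolutely_continuous 0 1 g ->
  absolutely_continuous 0 1 (fun x => f x * g x).
Proof.
move=> acf acg e e0.
have [K K0 fK] := within_norm_bounded (absolutely_continuous_within acf).
have [L L0 gL] := within_norm_bounded (absolutely_continuous_within acg).
have K10 : 0 < K + 1 by rewrite ltr_wpDl.
have L10 : 0 < L + 1 by rewrite ltr_wpDl.
have [d d0 dP] := acf (e / 2 / (L + 1)) (divr_gt0 (divr_gt0 e0 (ltr0Sn _ 1)) L10).
have [d' d'0 d'P] := acg (e / 2 / (K + 1)) (divr_gt0 (divr_gt0 e0 (ltr0Sn _ 1)) K10).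
exists (Num.min d d'); first by rewrite lt_min d0.
move=> n s t st tI; rewrite lt_min => /andP[sd sd'].
apply: (@le_lt_trans _ _ (\sum_(i < n) ((L + 1)%:C * `|f (t i) - f (s i)| +
                                        (K + 1)%:C * `|g (t i) - g (s i)|))).
  apply: ler_sum => i _; have [s0 sti t1] := st i.
  have Is : s i \in `[0, 1] by rewrite in_itv /= s0 (le_trans sti).
  have It : t i \in `[0, 1] by rewrite in_itv /= t1 (le_trans s0).
  have -> : f (t i) * g (t i) - f (s i) * g (s i) =
      g (t i) * (f (t i) - f (s i)) + f (s i) * (g (t i) - g (s i)) by ring.
  apply: le_trans (ler_normD _ _) _; rewrite !normrM.
  apply: lerD; apply: ler_wpM2r => //.
    by apply: le_trans (gL _ It) _; rewrite lecR lerDl.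
  by apply: le_trans (fK _ Is) _; rewrite lecR lerDl.
rewrite big_split /= -!mulr_sumr [e]splitr [ltRHS]rmorphD; apply: ltrD.
  have := dP n s t st tI sd; rewrite [ltRHS]rmorphM [in ltRHS]fmorphV.
  by rewrite ltr_pdivlMr ?ltcR// mulrC.
have := d'P n s t st tI sd'; rewrite [ltRHS]rmorphM [in ltRHS]fmorphV.
by rewrite ltr_pdivlMr ?ltcR// mulrC.
Qed.

End AbsolutelyContinuousAlgebra.

(** * The fundamental theorem of calculus *)

Section Antiderivative.
Context {R : realType}.
Local Notation mu := (@lebesgue_measure R).
Local Notation I01 := (`[0, 1]%classic : set R).
Implicit Types (h k : R -> R).

Definition antiderivative k (x : R) : R := \int[mu]_(t in `]-oo, x]%classic) k t.

Section Integrable.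
Variable k : R -> R.
Hypothesis ik : mu.-integrable setT (EFin \o k).

Lemma integrable_sub (A : set R) : measurable A -> mu.-integrable A (EFin \o k).
Proof. by move=> mA; exact: integrableS ik. Qed.

Lemma antiderivativeB (s t : R) : s <= t ->
  antiderivative k t - antiderivative k s = \int[mu]_(x in `]s, t]%classic) k x.
Proof.
move=> st; apply: Rintegral_itvB; rewrite ?bnd_simp//.
by apply: integrable_sub; exact: measurable_itv.
Qed.

(** The increments add up to at most the integral of `|k| over the union of the
    intervals, whose measure is the sum of their lengths. *)
Lemma antiderivative_absolutely_continuous (e : R) : 0 < e ->
  exists2 d : R, 0 < d & forall n (s t : 'I_n -> R), (forall i, s i <= t i) ->
    trivIset setT (fun i => `]s i, t i[%classic) ->
    \sum_(i < n) (t i - s i) < d ->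
    \sum_(i < n) `|antiderivative k (t i) - antiderivative k (s i)| < e.
Proof.
move=> e0; have [d [d0 dP]] := integral_normr_continuous ik e0.
exists d => // n s t st tI std.
pose A := \big[setU/set0]_(i < n) `]s i, t i[%classic.
have mA : measurable A by apply: bigsetU_measurable => i _; exact: measurable_itv.
have iA : mu.-integrable A (EFin \o (fun x => `|k x|)).
  by have := integrable_abse (integrable_sub mA); apply: eq_integrable.
have mk B : measurable B -> measurable_fun B (EFin \o (fun x => `|k x|)).
  move=> mB; have /integrableP[mk _] := ik.
  by apply: measurable_funTS; apply/measurable_EFinP; apply: measurableT_comp => //;
     exact/measurable_EFinP.
apply: (@le_lt_trans _ _ (\int[mu]_(x in A) `|k x|)%R); last first.
  have Ad : (mu A < d%:E)%E by rewrite /A lebesgue_measure_disjoint_itv.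
  exact: dP.
rewrite -lee_fin /Rintegral fineK; last exact: integrable_fin_num.
rewrite ge0_integral_bigsetU//; first last.
- exact: mk.
- exact: sub_trivIset tI.
- exact: index_enum_uniq.
rewrite -sumEFin; apply: lee_sum => i _; rewrite antiderivativeB//.
have iB : mu.-integrable `]s i, t i]%classic (EFin \o k).
  by apply: integrable_sub; exact: measurable_itv.
rewrite integral_itv_bndo_bndc; last by apply: mk; exact: measurable_itv.
rewrite EFin_normr_Rintegral//.
by have /integrableP[mkB _] := iB; exact: (le_abse_integral mu (measurable_itv _) mkB).
Qed.

Lemma antiderivative_derivative :
  {ae mu, forall x, derivable (antiderivative k) x 1 /\
                    derive1 (antiderivative k) x = k x}.
Proof.
apply: FTC1Ny; first by move=> y; apply: integrable_sub; exact: measurable_itv.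
by apply: open_integrable_locally => //; exact: openT.
Qed.

End Integrable.

Lemma derivable_approx (u : R -> R) x : derivable u x 1 -> forall e : R, 0 < e ->
  exists2 d, 0 < d & forall y, `|y - x| < d ->
    `|u y - u x - derive1 u x * (y - x)| <= e * `|y - x|.
Proof.
move=> /cvg_ex[l ul] e e0.
have -> : derive1 u x = l by rewrite derive1E; apply/cvg_lim => //; exact: Rhausdorff.
have /cvgrPdist_lt/(_ _ e0) := ul; rewrite /= => /nbhs_ballP[d /= d0 dP].
exists d => // y yx; have [->|yNx] := eqVneq y x.
  by rewrite !subrr mulr0 subrr !normr0 mulr0.
have yx0 : y - x != 0 by rewrite subr_eq0.
have := dP (y - x); rewrite -ball_normE /= sub0r normrN => /(_ yx yx0).
rewrite [_ *: 1]mulr1 subrK -[_ *: _]/((y - x)^-1 * (u y - u x)) => /ltW.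
rewrite -[X in X <= _](mulfK (x := `|y - x|)) ?normr_eq0// -normrM mulrBl.
by rewrite mulrAC mulVf// mul1r distrC ler_pdivrMr ?normr_gt0.
Qed.

End Antiderivative.

Section Primitive.
Local Open Scope complex_scope.
Context {R : realType}.
Local Notation C := R[i].
Local Notation mu := (@lebesgue_measure R).
Local Notation I01 := (`[0, 1]%classic : set R).
Local Notation Re := complex.Re.
Local Notation Im := complex.Im.
Implicit Types (h : R -> R) (f g F : R -> C).

(** Both measures agree on the measurable subsets of [0,1]. *)
Lemma integral_leb01 (k : R -> \bar R) :
  (\int[leb01 R]_(x in I01) k x = \int[mu]_(x in I01) k x)%E.
Proof.
by apply: eq_measure_integral => A mA AI; rewrite /leb01 /= /mrestr setIidl.
Qed.

Lemma integrable_leb01 h : (leb01 R).-integrable setT (EFin \o h) ->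
  mu.-integrable setT (EFin \o (h \_ I01)).
Proof.
move=> ih; have mI : measurable I01 by exact: measurable_itv.
rewrite -restrict_EFin -integrable_mkcond//.
have ihI : (leb01 R).-integrable I01 (EFin \o h) by exact: integrableS ih.
have /integrableP[mh hoo] := ihI; apply/integrableP; split=> //.
by rewrite -integral_leb01.
Qed.

Lemma Rintegral_leb01 h : (leb01 R).-integrable setT (EFin \o h) ->
  \int[leb01 R]_x h x = \int[mu]_(x in I01) h x.
Proof.
move=> ih; have mI : measurable I01 by exact: measurable_itv.
have mCI : measurable (~` I01 : set (measurableTypeR R)) by exact: measurableC.
congr fine; rewrite -integral_leb01.
have N0 : leb01 R (~` I01) = 0%E.
  by rewrite /leb01 /= /mrestr setICl measure0.
by rewrite (negligible_integral mCI measurableT ih N0) setTD setCK.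
Qed.

(** On [0,1] this is the integral of f from 0 to x; cutting f off outside makes the
    integrand integrable on the line. *)
Definition primitive f (x : R) : C :=
  antiderivative ((fun t => Re (f t)) \_ I01) x +i*
  antiderivative ((fun t => Im (f t)) \_ I01) x.

Lemma antiderivative_restrict_0 h : antiderivative (h \_ I01) 0 = 0.
Proof.
rewrite /antiderivative -Rintegral_mkcondr.
have -> : `]-oo, (0 : R)]%classic `&` I01 = [set 0].
  apply/seteqP; split => x /=; rewrite !in_itv /=.
    by move=> [x0 /andP[x0' _]]; apply/eqP; rewrite eq_le x0.
  by move=> ->; rewrite lexx ler01.
exact: Rintegral_set1.
Qed.

Lemma antiderivative_restrict_1 h : (leb01 R).-integrable setT (EFin \o h) ->
  antiderivative (h \_ I01) 1 = \int[leb01 R]_x h x.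
Proof.
move=> ih; rewrite /antiderivative -Rintegral_mkcondr Rintegral_leb01//.
congr Rintegral; apply/seteqP; split => x /=; rewrite !in_itv /=; first by case.
by move=> /andP[-> ->].
Qed.

Lemma primitive0 f : primitive f 0 = 0.
Proof. by rewrite /primitive !antiderivative_restrict_0. Qed.

Lemma primitive1 f : cintegrable (leb01 R) f -> primitive f 1 = cintegral (leb01 R) f.
Proof. by move=> [f1 f2]; rewrite /primitive !antiderivative_restrict_1. Qed.

Lemma primitive_absolutely_continuous f : cintegrable (leb01 R) f ->
  absolutely_continuous 0 1 (primitive f).
Proof.
move=> [/integrable_leb01 f1 /integrable_leb01 f2] e e0.
have e20 : 0 < e / 2 by rewrite divr_gt0.
have [d1 d10 P1] := antiderivative_absolutely_continuous f1 e20.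
have [d2 d20 P2] := antiderivative_absolutely_continuous f2 e20.
exists (Num.min d1 d2); first by rewrite lt_min d10.
move=> n s t st tI; rewrite lt_min => /andP[sd1 sd2].
have st' i : s i <= t i by have [] := st i.
set u := antiderivative _ in P1; set v := antiderivative _ in P2.
apply: (@le_lt_trans _ _ (\sum_(i < n) (`|u (t i) - u (s i)| + `|v (t i) - v (s i)|))%:C).
  rewrite rmorph_sum; apply: ler_sum => i _; exact: norm_complex_le.
by rewrite ltcR big_split /= [e]splitr; apply: ltrD; [exact: P1|exact: P2].
Qed.

Lemma has_derivative_within_complex (A : set R) (u v : R -> R) x :
  derivable u x 1 -> derivable v x 1 ->
  has_derivative_within A (fun y => u y +i* v y) x (derive1 u x +i* derive1 v x).
Proof.
move=> /derivable_approx D1 /derivable_approx D2; apply/has_derivative_withinP => e e0.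
have e20 : 0 < e / 2 by rewrite divr_gt0.
have [d1 d10 P1] := D1 _ e20; have [d2 d20 P2] := D2 _ e20.
exists (Num.min d1 d2); first by rewrite lt_min d10.
move=> y _; rewrite lt_min => /andP[yd1 yd2].
have := lerD (P1 _ yd1) (P2 _ yd2); rewrite -mulrDl -splitr -lecR.
apply: le_trans; apply: le_trans (norm_complex_le _ _).
by rewrite le_eqVlt; apply/orP; left; apply/eqP; congr `|_|; simpc.
Qed.

Lemma primitive_derivative f : cintegrable (leb01 R) f ->
  {ae mu, forall x, x \in `[0, 1] -> has_derivative_within I01 (primitive f) x (f x)}.
Proof.
move=> [/integrable_leb01 f1 /integrable_leb01 f2].
have FF : Filter (almost_everywhere mu) by exact: ae_filter_ringOfSetsType.
apply: filterS2 (antiderivative_derivative f1) (antiderivative_derivative f2) => x.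
move=> [d1 e1] [d2 e2] Ix; have := @has_derivative_within_complex I01 _ _ _ d1 d2.
have fxE : f x = Re (f x) +i* Im (f x) by case: (f x).
by rewrite e1 e2 !patchE (@mem_set R I01 x Ix) -fxE.
Qed.

(** F and the primitive of f have the same derivative almost everywhere, so their
    difference, which is absolutely continuous, is constant. *)
Lemma absolutely_continuous_FTC F f : absolutely_continuous 0 1 F ->
  cintegrable (leb01 R) f ->
  {ae mu, forall x, x \in `[0, 1] -> has_derivative_within I01 F x (f x)} ->
  cintegral (leb01 R) f = F 1 - F 0.
Proof.
move=> acF cf dF.
have := absolutely_continuous_derivative0 ler01
  (absolutely_continuous_linear (-1) (primitive_absolutely_continuous cf) acF).
rewrite primitive0 mulr0 add0r primitive1// mulN1r => <-; first by ring.
have FF : Filter (almost_everywhere mu) by exact: ae_filter_ringOfSetsType.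
apply: filterS2 (primitive_derivative cf) dF => x d1 d2 Ix.
have := has_derivative_withinD (has_derivative_withinM Ix
  (has_derivative_within_cst I01 (-1) x) (d1 Ix)) (d2 Ix).
by rewrite mul0r add0r mulN1r addNr.
Qed.

End Primitive.

(** * Continuous functions and exponentials in L^2([0,1]) *)

Section L2Functions.
Local Open Scope complex_scope.
Context {R : realType}.
Local Notation C := R[i].
Local Notation mu := (@lebesgue_measure R).
Local Notation leb := (leb01 R).
Local Notation I01 := (`[0, 1]%classic : set R).
Local Notation Re := complex.Re.
Local Notation Im := complex.Im.
Implicit Types (a da : R -> C) (f df g : L2_fun leb).

Lemma cst1_L2 : (fun=> 1 : C) \in L2_pred leb.
Proof.
apply: L2_pred_sqmod; [exact: measurable_cst|exact: measurable_cst|].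
rewrite integral_cst// /= expr1n expr0n addr0 mul1e.
rewrite /leb01 /= /mrestr setTI lebesgue_measure_itv /=.
by case: ifP => _; rewrite -?EFinB ltry.
Qed.

Definition L2_one : L2_fun leb := L2Fun cst1_L2.

(** The default value 0 is not reached when a is continuous on [0,1], see
    mulf_mul01. *)
Definition mulf a f : L2_fun leb := insubd (0 : L2_fun leb) (mul01 a f).

Definition fun01 a : L2_fun leb := mulf a L2_one.

Definition L2_of a : L2_01 R := L2_class (fun01 a).

Lemma mulf_mul01 a f : {within I01, continuous a} -> mulf a f =1 mul01 a f.
Proof. by move=> ca x; rewrite insubdK// mul01_L2. Qed.

Lemma mulfE a f x : {within I01, continuous a} -> x \in `[0, 1] ->
  mulf a f x = a x * f x.
Proof. by move=> ca Ix; rewrite mulf_mul01// /mul01 Ix. Qed.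

Lemma fun01E a x : {within I01, continuous a} -> x \in `[0, 1] -> fun01 a x = a x.
Proof. by move=> ca Ix; rewrite mulfE// mulr1. Qed.

Lemma hdot_L2E f g : hdot (L2_class f : L2_01 R) (L2_class g) =
  cintegral leb (fun x => f x * Num.conj (g x)).
Proof. exact: L2_dotE. Qed.

Lemma L2_class_eq01 f g : (forall x, x \in `[0, 1] -> f x = g x) ->
  L2_class f = L2_class g :> L2_01 R.
Proof. by move=> fg; apply/L2_classP/ae_leb01/aeW. Qed.

Lemma L2_ofZ a (c : C) : {within I01, continuous a} ->
  L2_of (fun x => c * a x) = c *: L2_of a.
Proof.
move=> ca; rewrite /L2_of -L2_classZ; apply: L2_class_eq01 => x Ix.
have cca : {within I01, continuous (fun x => c * a x)}.
  by move=> y; apply: cvgM; [exact: cvg_cst|exact: ca].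
by rewrite (fun01E cca Ix) L2_funZE (fun01E ca Ix).
Qed.

Lemma cintegrableD (h k : R -> C) : cintegrable leb h -> cintegrable leb k ->
  cintegrable leb (fun x => h x + k x).
Proof.
move=> [h1 h2] [k1 k2]; split.
- have := integrableD measurableT h1 k1; apply: eq_integrable => // x _ /=.
  by rewrite cReD.
- have := integrableD measurableT h2 k2; apply: eq_integrable => // x _ /=.
  by rewrite cImD.
Qed.

Lemma derivative_within_continuous (h dh : R -> C) :
  (forall x, x \in `[0, 1] -> has_derivative_within I01 h x (dh x)) ->
  {within I01, continuous h}.
Proof.
move=> hdh; apply/subspace_continuousP => x Ix.
exact: has_derivative_within_continuous (hdh x Ix).
Qed.

Lemma bounded_derivative_absolutely_continuous (h dh : R -> C) (K : R) :
  (forall x, x \in `[0, 1] -> has_derivative_within I01 h x (dh x)) ->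
  (forall x, x \in `[0, 1] -> `|dh x| <= K%:C) -> absolutely_continuous 0 1 h.
Proof.
move=> hdh dhK; apply: lipschitz_absolutely_continuous.
exact: bounded_derivative_lipschitz hdh dhK.
Qed.

Lemma eq_absolutely_continuous (h k : R -> C) :
  (forall x, x \in `[0, 1] -> h x = k x) ->
  absolutely_continuous 0 1 h -> absolutely_continuous 0 1 k.
Proof.
move=> hk ach e e0; have [d d0 dP] := ach e e0; exists d => // n s t st tI sd.
have := dP n s t st tI sd; congr (_ < _); apply: eq_bigr => i _.
have [s0 sti t1] := st i.
by rewrite !hk// in_itv /= ?s0 ?t1 ?(le_trans s0) ?(le_trans sti).
Qed.

Lemma eq_has_derivative_within (h k : R -> C) x l :
  (forall y, y \in `[0, 1] -> h y = k y) -> x \in `[0, 1] ->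
  has_derivative_within I01 h x l -> has_derivative_within I01 k x l.
Proof.
move=> hk Ix /has_derivative_withinP hl; apply/has_derivative_withinP => e e0.
have [d d0 dP] := hl e e0; exists d => // y Iy yx.
by have := dP y Iy yx; rewrite !hk.
Qed.

(** The fundamental theorem of calculus for the product of f and the conjugate
    of a. *)
Lemma integration_by_parts01 f df a da : absolutely_continuous 0 1 f ->
  {ae mu, forall x, x \in `[0, 1] -> has_derivative_within I01 f x (df x)} ->
  (forall x, x \in `[0, 1] -> has_derivative_within I01 a x (da x)) ->
  {within I01, continuous da} ->
  hdot (L2_class df : L2_01 R) (L2_of a) + hdot (L2_class f : L2_01 R) (L2_of da) =
  f 1 * Num.conj (a 1) - f 0 * Num.conj (a 0).
Proof.
move=> acf fdf ada cda; have ca := derivative_within_continuous ada.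
have [K _ daK] := within_norm_bounded cda.
rewrite !hdot_L2E -cintegralD; [|exact: L2_cintegrable|exact: L2_cintegrable].
have acja : absolutely_continuous 0 1 (fun x => Num.conj (a x)).
  apply: (@bounded_derivative_absolutely_continuous _ (fun x => Num.conj (da x)) K).
    by move=> x Ix; apply: has_derivative_within_conj; exact: ada.
  by move=> x Ix; rewrite norm_conjC daK.
apply: (absolutely_continuous_FTC (absolutely_continuousM acf acja)).
  by apply: cintegrableD; exact: L2_cintegrable.
have FF : Filter (almost_everywhere mu) by exact: ae_filter_ringOfSetsType.
apply: filterS fdf => x fx Ix; rewrite !fun01E//.
apply: has_derivative_withinM => //; first exact: fx.
by apply: has_derivative_within_conj; exact: ada.
Qed.

End L2Functions.

Section Exponentials.
Local Open Scope complex_scope.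
Context {R : realType}.
Local Notation C := R[i].
Local Notation leb := (leb01 R).
Local Notation I01 := (`[0, 1]%classic : set R).
Implicit Types (l m x : R) (z w : int).

Definition expi l x : C := cos (l * x) +i* sin (l * x).

Lemma expiD l m x : expi (l + m) x = expi l x * expi m x.
Proof. by rewrite /expi mulrDl cosD sinD; simpc; rewrite [sin _ * cos _ + _]addrC. Qed.

Lemma expi0 x : expi 0 x = 1.
Proof. by rewrite /expi mul0r cos0 sin0. Qed.

Lemma expi_at0 l : expi l 0 = 1.
Proof. by rewrite /expi mulr0 cos0 sin0. Qed.

Lemma expiN l x : expi (- l) x = Num.conj (expi l x).
Proof. by rewrite /expi mulNr cosN sinN; apply: cReIm_eq; rewrite ?cReJ ?cImJ. Qed.

Lemma norm_expi l x : `|expi l x| = 1.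
Proof. by rewrite normc_def /expi /= cos2Dsin2 sqrtr1. Qed.

Lemma expi_derivative (A : set R) l x :
  has_derivative_within A (expi l) x ('i * l%:C * expi l x).
Proof.
have dl : is_derive x 1 (fun y => l * y) l.
  by apply: is_derive_eq; exact: mulr1.
have dc : is_derive x 1 (cos \o (fun y => l * y)) (- sin (l * x) * l).
  exact: is_derive1_comp.
have ds : is_derive x 1 (sin \o (fun y => l * y)) (cos (l * x) * l).
  exact: is_derive1_comp.
have := @has_derivative_within_complex _ A _ _ x
  (@ex_derive _ _ _ _ _ _ _ dc) (@ex_derive _ _ _ _ _ _ _ ds).
rewrite !derive1E !derive_val.
by congr has_derivative_within; rewrite /expi; simpc; congr (_ +i* _); rewrite mulrC ?mulrN.
Qed.

Lemma expi_within_continuous l : {within I01, continuous (expi l)}.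
Proof. by apply: derivative_within_continuous => x _; exact: expi_derivative. Qed.

(** The eigenvalue of D_0 at the mode z. *)
Definition freq z : R := 2 * pi * z%:~R.

Lemma expi_at1 z : expi (freq z) 1 = 1.
Proof.
have e1 : expi (freq 1) 1 = 1.
  by rewrite /freq mulr1 /expi mulr1 mulr_natl cos2pi sin2pi.
have en (n : nat) : expi (freq n) 1 = 1.
  elim: n => [|n IH]; first by rewrite /freq mulr0 expi0.
  by rewrite -addn1 PoszD /freq rmorphD mulrDr expiD IH e1 mulr1.
case: (intP z) => [|n|n]; first by rewrite /freq mulr0 expi0.
  exact: en.
by rewrite /freq rmorphN mulrN expiN en rmorph1.
Qed.

End Exponentials.

(** * The Fourier modes and their completeness *)

Section FourierBasis.
Local Open Scope complex_scope.
Context {R : realType}.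
Local Notation C := R[i].
Local Notation mu := (@lebesgue_measure R).
Local Notation leb := (leb01 R).
Local Notation I01 := (`[0, 1]%classic : set R).
Implicit Types (a : R -> C) (f df g : L2_fun leb) (z w : int) (u : L2_01 R).

Definition fourier z : L2_01 R := L2_of (expi (freq z)).

Lemma freq0 : freq 0 = 0 :> R. Proof. by rewrite /freq mulr0. Qed.

Lemma freqD z w : freq (z + w) = freq z + freq w :> R.
Proof. by rewrite /freq rmorphD mulrDr. Qed.

Lemma freqN z : freq (- z) = - freq z :> R.
Proof. by rewrite /freq rmorphN mulrN. Qed.

Lemma freq_inj : injective (@freq R).
Proof.
move=> z w; rewrite /freq => /mulfI; rewrite mulf_neq0 ?pnatr_eq0 ?gt_eqF ?pi_gt0//.
by move=> /(_ isT) /intr_inj.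
Qed.

Lemma fourier0E : L2_of (fun=> 1) = fourier 0.
Proof. by congr L2_of; apply/funext => x; rewrite freq0 expi0. Qed.

(** Integration by parts against a mode, whose values at 0 and at 1 are both 1. *)
Lemma fourier_derivative f df z : absolutely_continuous 0 1 f ->
  {ae mu, forall x, x \in `[0, 1] -> has_derivative_within I01 f x (df x)} ->
  hdot (L2_class df : L2_01 R) (fourier z) =
  f 1 - f 0 + 'i * (freq z)%:C * hdot (L2_class f : L2_01 R) (fourier z).
Proof.
move=> acf fdf; have cE := @expi_within_continuous R (freq z).
have := integration_by_parts01 acf fdf (fun x _ => @expi_derivative R I01 (freq z) x).
rewrite L2_ofZ// hdotZr conj_imaginary expi_at0 expi_at1 rmorph1 !mulr1 mulNr.
move=> <-; first by rewrite subrK.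
by move=> x; apply: cvgM; [exact: cvg_cst|exact: cE].
Qed.

(** Integration by parts against x, whose values at the end points are 0 and 1:
    this recovers f 1, which no Fourier coefficient does. *)
Lemma integration_by_parts_id f df : absolutely_continuous 0 1 f ->
  {ae mu, forall x, x \in `[0, 1] -> has_derivative_within I01 f x (df x)} ->
  hdot (L2_class df : L2_01 R) (L2_of (@id01 R)) + hdot (L2_class f : L2_01 R) (fourier 0) =
  f 1.
Proof.
move=> acf fdf.
have := integration_by_parts01 acf fdf (fun x _ => @has_derivative_within_id R I01 x).
rewrite fourier0E => ->; last by move=> x; exact: cvg_cst.
by rewrite /id01 rmorph0 rmorph1 mulr0 mulr1 subr0.
Qed.

Lemma fun01_differentiable a (da : R -> C) :
  (forall x, x \in `[0, 1] -> has_derivative_within I01 a x (da x)) ->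
  {within I01, continuous da} ->
  absolutely_continuous 0 1 (fun01 a) /\
  {ae mu, forall x, x \in `[0, 1] -> has_derivative_within I01 (fun01 a) x (fun01 da x)}.
Proof.
move=> ada cda; have ca := derivative_within_continuous ada.
have aE y : y \in `[0, 1] -> a y = fun01 a y by move=> Iy; rewrite fun01E.
have [K _ daK] := within_norm_bounded cda; split.
  apply: eq_absolutely_continuous aE _.
  exact: bounded_derivative_absolutely_continuous ada daK.
apply: aeW => x Ix; rewrite (fun01E cda Ix).
by apply: (eq_has_derivative_within aE) => //; exact: ada.
Qed.

Lemma fourier_differentiable z :
  [/\ absolutely_continuous 0 1 (fun01 (expi (freq z) : R -> C)),
      {ae mu, forall x, x \in `[0, 1] -> has_derivative_within I01
        (fun01 (expi (freq z))) x
        (fun01 (fun y => 'i * (freq z)%:C * expi (freq z) y) x)},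
      fun01 (expi (freq z) : R -> C) 0 = 1, fun01 (expi (freq z) : R -> C) 1 = 1 &
      L2_class (fun01 (fun y => 'i * (freq z)%:C * expi (freq z) y)) =
        ('i * (freq z)%:C) *: fourier z].
Proof.
have cE := @expi_within_continuous R (freq z).
have [|ac dE] := @fun01_differentiable _ _ (fun x _ => @expi_derivative R I01 (freq z) x).
  by move=> x; apply: cvgM; [exact: cvg_cst|exact: cE].
split=> //.
- by rewrite fun01E// ?expi_at0// in_itv /= lexx ler01.
- by rewrite fun01E// ?expi_at1// in_itv /= lexx ler01.
- exact: L2_ofZ.
Qed.

(** Two distinct modes are periodic eigenfunctions of the derivative with distinct
    imaginary eigenvalues, hence orthogonal by integration by parts. The square
    norm of a mode is the integral of 1, that is the increment of x over [0,1]. *)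
Lemma fourier_orthonormal z w : hdot (fourier z) (fourier w) = (z == w)%:R.
Proof.
have [<-|zw] := eqVneq z w.
  have cE := @expi_within_continuous R (freq z).
  have c1 : {within I01, continuous (fun=> 1 : C)} by move=> y; exact: cvg_cst.
  have -> : hdot (fourier z) (fourier z) = hdot (L2_of (fun=> 1)) (fourier 0).
    rewrite -fourier0E !hdot_L2E; congr cintegral; apply/funext => x.
    rewrite -!normCK !mulf_mul01// /mul01; case: ifP => _ //.
    by rewrite !mulr1 norm_expi normr1.
  have did x : x \in `[0, 1] -> has_derivative_within I01 (@id01 R) x 1.
    by move=> _; exact: has_derivative_within_id.
  have cid := derivative_within_continuous did.
  have [ac dE] := fun01_differentiable did c1.
  have := fourier_derivative 0 ac dE.
  rewrite freq0 mulr0 mul0r addr0 => ->.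
  by rewrite !fun01E ?in_itv /= ?lexx ?ler01// /id01 rmorph0 rmorph1 subr0.
have [ac dE e0 e1 ce] := fourier_differentiable z.
have := fourier_derivative w ac dE.
rewrite e0 e1 ce subrr add0r hdotZl -/(fourier z) => /eqP.
rewrite -subr_eq0 -mulrBl mulf_eq0 => /orP[|/eqP//].
rewrite -mulrBr -rmorphB => /eqP/eqP; apply: contraTeq => _.
by apply: imaginary_neq0; rewrite subr_eq0; apply: contra_neq zw; exact: freq_inj.
Qed.

End FourierBasis.

Section Completeness.
Local Open Scope complex_scope.
Context {R : realType}.
Local Notation C := R[i].
Local Notation mu := (@lebesgue_measure R).
Local Notation leb := (leb01 R).
Local Notation I01 := (`[0, 1]%classic : set R).
Implicit Types (f df : L2_fun leb) (z : int) (u : L2_01 R).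

Lemma ae_dense01 (P : R -> Prop) : {ae mu, forall x, x \in `[0, 1] -> P x} ->
  forall x d : R, x \in `[0, 1] -> 0 < d ->
  exists y, [/\ y \in `[0, 1], y != x, `|y - x| < d & P y].
Proof.
move=> [N [mN N0 NP]] x d; rewrite in_itv /= => /andP[x0 x1] d0.
have [al [be [albe al0 be1 near_tag]]] : exists al be : R, [/\ al < be, 0 <= al, be <= 1 &
    forall y, al < y -> y < be -> y != x /\ `|y - x| < d].
  have [xlt1|x1'] := ltP x 1.
    exists x, (Num.min (x + d) 1); split => //.
    - by rewrite lt_min ltrDl d0.
    - by rewrite ge_min lexx orbT.
    - move=> y xy; rewrite lt_min => /andP[yd _].
      by rewrite gt_eqF// gtr0_norm ?subr_gt0// ltrBlDl.
  have xE : x = 1 by apply/eqP; rewrite eq_le x1.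
  exists (Num.max (1 - d) 0), 1; split => //.
  - by rewrite gt_max ltr01 gtrBl d0.
  - by rewrite le_max lexx orbT.
  - move=> y; rewrite gt_max => /andP[yd _] y1; rewrite xE lt_eqF//.
    by rewrite distrC gtr0_norm ?subr_gt0// ltrBlDr -ltrBlDl.
apply: contrapT => noy.
have sub : `]al, be[%classic `<=` N.
  move=> y /=; rewrite in_itv /= => /andP[aly ybe]; apply: NP => /= Py.
  have [yx yd] := near_tag y aly ybe.
  have Iy : y \in `[0, 1] by rewrite in_itv /= (le_trans al0 (ltW aly)) (le_trans (ltW ybe)).
  by apply: noy; exists y; split=> //; exact: Py.
have : (mu `]al, be[%classic <= mu N)%E.
  by apply: le_measure; rewrite ?inE//; exact: measurable_itv.
rewrite N0 lebesgue_measure_itv /= lte_fin albe -EFinB lee_fin subr_le0.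
by rewrite leNgt albe.
Qed.

(** The points where h = c are dense in [0,1], and the difference quotients at such
    a point vanish along the others. *)
Lemma ae_const_derivative (h : R -> C) (dh : R -> C) (c : C) :
  {ae mu, forall x, x \in `[0, 1] -> h x = c} ->
  {ae mu, forall x, x \in `[0, 1] -> has_derivative_within I01 h x (dh x)} ->
  {ae mu, forall x, x \in `[0, 1] -> dh x = 0}.
Proof.
move=> hc hdh; have hc_dense := ae_dense01 hc.
have FF : Filter (almost_everywhere mu) by exact: ae_filter_ringOfSetsType.
apply: filterS2 hc hdh => x hxc hx Ix.
have [r r0 rE] := norm_complexE (dh x).
apply/eqP; rewrite -normr_eq0 rE eq_complex /= eqxx andbT eq_le r0 andbT.
apply/ler_addgt0Pr => e e0; rewrite add0r.
have [d d0 dP] := (iffLR (has_derivative_withinP _ _ _ _)) (hx Ix) e e0.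
have [y [Iy yx yd hy]] := hc_dense _ _ Ix d0.
have := dP y Iy yd; rewrite hy hxc// subrr sub0r normrN normrM rE norm_realC.
by rewrite -rmorphM lecR ler_pM2r// normr_gt0 subr_eq0.
Qed.

(** Otherwise the sums in Bessel's inequality would be unbounded. *)
Lemma const_coef_eq0 {H : hilbertType R} (b : nat -> H) (v : H) (r : C) :
  orthonormal_seq b -> (forall k, `|hdot v (b k)| = r) -> r = 0.
Proof.
move=> b1 vr; have [s s0 rs] : exists2 s : R, 0 <= s & r = s%:C.
  by rewrite -(vr 0%N); exact: norm_complexE.
have [t t0 vt] := ge0_complexP (normr_ge0 v).
suff -> : r = 0 by []. rewrite rs; apply/eqP; rewrite eq_complex /= eqxx andbT.
apply: contrapT => /negP s_neq0.
have s_gt0 : 0 < s ^+ 2 by rewrite exprn_gt0// lt_neqAle eq_sym s_neq0.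
have [n] : exists n : nat, t ^+ 2 < n%:R * s ^+ 2.
  exists (Num.bound (t ^+ 2 / s ^+ 2)).
  by rewrite -ltr_pdivrMr// archi_boundP// divr_ge0// exprn_ge0.
apply/negP; rewrite -leNgt -lecR.
have := bessel b1 v n; rewrite vt rmorphXn /=; apply: le_trans.
rewrite (eq_bigr (fun=> r ^+ 2)); last by move=> k _; rewrite /coef vr.
by rewrite sumr_const card_ord rs rmorphM rmorphXn /= rmorph_nat -[X in _ <= X]mulr_natl.
Qed.

Lemma expi_neq (x y : R) : 0 < y < 1 -> x \in `[0, 1] -> x != y ->
  expi (freq 1) x != expi (freq 1) y.
Proof.
move=> /andP[y0 y1]; rewrite in_itv /= => /andP[x0 x1] xy.
have key (t : R) : 0 < t < 1 -> cos (2 * pi * t) != 1.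
  move=> /andP[t0 t1]; have -> : 2 * pi * t = (pi * t) *+ 2 by rewrite mulr2n; ring.
  rewrite cos_mulr2n -subr_eq0 lt_eqF//.
  have := @sin_gt0_pi R (pi * t); rewrite mulr_gt0 ?pi_gt0//= gtr_pMr ?pi_gt0//.
  move=> /(_ t1) s0; have := cos2Dsin2 (pi * t); move: (cos _) (sin _) s0 => c s s0.
  by rewrite mulr2n; nra.
apply/eqP => e.
have : expi (freq 1) (x - y) = 1 :> C.
  have -> : expi (freq 1) (x - y) = expi (freq 1) x * Num.conj (expi (freq 1) y) :> C.
    rewrite -expiN /expi mulrBr cosB sinB mulNr cosN sinN; simpc.
    by congr (_ +i* _); ring.
  by rewrite e -normCK norm_expi expr1n.
move=> [ec _]; rewrite /freq mulr1 in ec.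
case: (ltP y x) => yx.
  by have := key (x - y); rewrite ec eqxx => /(_ _)/negP; apply=> //; apply/andP; split; lra.
have {}yx : x < y by rewrite lt_neqAle xy.
have := key (y - x); rewrite -opprB mulrN cosN ec eqxx => /(_ _)/negP; apply=> //.
by apply/andP; split; lra.
Qed.

(** The quotient q of the increments of G and of exp(2 pi i x) at x0 extends
    continuously to x0, both increments being of first order and the derivative of
    the exponential not being zero. The end points are excluded because the
    exponential takes the same value at 0 and 1. *)
Lemma quotient_continuous (G : R -> C) (x0 : R) (l : C) : 0 < x0 < 1 ->
  {within I01, continuous G} -> has_derivative_within I01 G x0 l ->
  exists2 q : R -> C, {within I01, continuous q} &
    forall x, x \in `[0, 1] ->
      q x * (expi (freq 1) x - expi (freq 1) x0) = G x - G x0.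
Proof.
move=> x01 cG Gl; pose E : R -> C := expi (freq 1).
have cE : {within I01, continuous E} := @expi_within_continuous R (freq 1).
have f10 : freq 1 != 0 :> R by rewrite -freq0 (inj_eq (@freq_inj R)).
have E'0 : 'i * (freq 1)%:C * E x0 != 0.
  by rewrite mulf_neq0 ?imaginary_neq0// -normr_eq0 norm_expi oner_eq0.
have Ix0 : x0 \in `[0, 1] by rewrite in_itv /=; lra.
pose q x := if x == x0 then l / ('i * (freq 1)%:C * E x0)
            else (G x - G x0) / (E x - E x0).
have qx0 : q x0 = l / ('i * (freq 1)%:C * E x0) by rewrite /q eqxx.
have qE x : x != x0 -> q x = (G x - G x0) / (E x - E x0).
  by move=> xx0; rewrite /q (negbTE xx0).
exists q; last first.
  move=> x Ix; have [->|xx0] := eqVneq x x0; first by rewrite !subrr mulr0.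
  by rewrite qE// mulfVK// subr_eq0 expi_neq.
apply/subspace_continuousP => x Ix; have [->|xx0] := eqVneq x x0.
  have El := @expi_derivative R I01 (freq 1) x0.
  have h : (G y - G x0) / (y - x0)%:C / ((E y - E x0) / (y - x0)%:C)
      @[y --> within I01 x0^'] --> q x0.
    by rewrite qx0; apply: cvgM; [exact: Gl|apply: cvgV; [exact: E'0|exact: El]].
  move=> B Bl; have /nbhs_ballP[d d0 dB] := h B Bl.
  apply/nbhs_ballP; exists d => // y yx Iy.
  have [->|yx0] := eqVneq y x0; first exact: nbhs_singleton Bl.
  have Bq := dB y yx yx0 Iy; rewrite /= invf_div mulrA mulfVK -?(qE y yx0) in Bq.
    exact: Bq.
  by rewrite eq_complex /= eqxx andbT subr_eq0.
have cq : (G y - G x0) / (E y - E x0) @[y --> within I01 (nbhs x)] --> q x.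
  have cG' : G y @[y --> within I01 (nbhs x)] --> G x.
    exact: (iffLR (subspace_continuousP _ _)) cG x Ix.
  have cE' : E y @[y --> within I01 (nbhs x)] --> E x.
    exact: (iffLR (subspace_continuousP _ _)) cE x Ix.
  have E0 : E x - E x0 != 0 by rewrite subr_eq0 expi_neq.
  rewrite (qE x xx0).
  exact: cvgM (cvgB cG' (cvg_cst (G x0))) (cvgV E0 (cvgB cE' (cvg_cst (E x0)))).
move=> B Bl; have /nbhs_ballP[d /= d0 dB] := cq B Bl.
apply/nbhs_ballP; exists (Num.min d `|x - x0|); first by rewrite /= lt_min d0 normr_gt0 subr_eq0.
move=> y; rewrite -ball_normE /= lt_min => /andP[yd yx] Iy.
have yx0 : y != x0 by apply: contraTneq yx => ->; rewrite ltxx.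
have Bq : B ((G y - G x0) / (E y - E x0)) by apply: (dB y) => //; rewrite -ball_normE.
by rewrite -(qE y yx0) in Bq.
Qed.

End Completeness.

Section Totality.
Local Open Scope complex_scope.
Context {R : realType}.
Local Notation C := R[i].
Local Notation mu := (@lebesgue_measure R).
Local Notation leb := (leb01 R).
Local Notation I01 := (`[0, 1]%classic : set R).
Implicit Types (f df : L2_fun leb) (z : int) (u : L2_01 R).

Lemma L2_ofD (a b : R -> C) : {within I01, continuous a} -> {within I01, continuous b} ->
  L2_of (fun x => a x + b x) = L2_of a + L2_of b.
Proof.
move=> ca cb; have cab : {within I01, continuous (fun x => a x + b x)}.
  by move=> x; apply: cvgD; [exact: ca|exact: cb].
rewrite /L2_of -L2_classD; apply: L2_class_eq01 => x Ix.
by rewrite (fun01E cab Ix) L2_funDE (fun01E ca Ix) (fun01E cb Ix).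
Qed.

Lemma within_continuousM (a b : R -> C) :
  {within I01, continuous a} -> {within I01, continuous b} ->
  {within I01, continuous (fun x => a x * b x)}.
Proof. by move=> ca cb x; apply: cvgM; [exact: ca|exact: cb]. Qed.

Lemma within_continuous_cst (c : C) : {within I01, continuous (fun=> c : C)}.
Proof. by move=> x; exact: cvg_cst. Qed.

Lemma eq_L2_of (a b : R -> C) : {within I01, continuous a} ->
  {within I01, continuous b} -> (forall x, x \in `[0, 1] -> a x = b x) -> L2_of a = L2_of b.
Proof.
move=> ca cb ab; apply: L2_class_eq01 => x Ix.
by rewrite (fun01E ca Ix) (fun01E cb Ix) ab.
Qed.

Lemma hdot_modulation (q : R -> C) (p : int) z : {within I01, continuous q} ->
  hdot (L2_of (fun x => expi (freq p) x * q x)) (fourier z) = hdot (L2_of q) (fourier (z - p)).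
Proof.
move=> cq; have c1 := @expi_within_continuous R (freq p).
have cz := @expi_within_continuous R (freq z).
have cz1 := @expi_within_continuous R (freq (z - p)).
rewrite !hdot_L2E; congr cintegral; apply/funext => x.
have cq1 := within_continuousM c1 cq.
rewrite (mulf_mul01 _ cq1) (mulf_mul01 _ cz) (mulf_mul01 _ cq) (mulf_mul01 _ cz1).
rewrite /mul01; case: ifP => _; last by rewrite !mul0r.
rewrite !mulr1 freqD freqN expiD expiN rmorphM /= conjCK; ring.
Qed.

(** Chernoff's argument for the convergence of Fourier series at a point of
    differentiability. Write E x = exp(2 pi i x) and G - G x0 = q (E - E x0) with q
    continuous. In Fourier coefficients the right hand side is
    t (z - 1) - E x0 * t z, where t z is the coefficient of q at z. As it vanishes
    for z <> 0, the modulus of t is constant on the integers z >= 0, and on those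
    z < 0, hence zero by Bessel's inequality. The coefficients at 0 then give the
    claim. *)
Lemma fourier_pointwise (G : R -> C) (x0 : R) (l : C) : 0 < x0 < 1 ->
  {within I01, continuous G} -> has_derivative_within I01 G x0 l ->
  (forall z, z != 0 -> hdot (L2_of G) (fourier z) = 0) -> G x0 = hdot (L2_of G) (fourier 0).
Proof.
move=> x01 cG Gl G0; have [q cq qE] := quotient_continuous x01 cG Gl.
have c1 := @expi_within_continuous R (freq 1).
pose E0 : C := expi (freq 1) x0.
have nE0 : `|E0| = 1 by exact: norm_expi.
have cq1 := within_continuousM c1 cq.
have ccst := @within_continuous_cst.
have cE0 := within_continuousM (ccst (- E0)) cq.
have cG0 := within_continuousM (ccst (G x0)) (ccst 1).
have cS : {within I01, continuous (fun x => expi (freq 1) x * q x + - E0 * q x)}.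
  by move=> x; exact: cvgD (cq1 x) (cE0 x).
have cS' : {within I01, continuous
    (fun x => G x0 * 1 + (expi (freq 1) x * q x + - E0 * q x))}.
  by move=> x; exact: cvgD (cG0 x) (cS x).
have GE : L2_of G = G x0 *: fourier 0 +
    (L2_of (fun x => expi (freq 1) x * q x) - E0 *: L2_of q).
  rewrite -fourier0E -scaleNr -(L2_ofZ _ (ccst 1)) -(L2_ofZ _ cq) -(L2_ofD cq1 cE0) -(L2_ofD cG0 cS).
  apply: (eq_L2_of cG cS') => x Ix.
  by rewrite mulr1 mulNr [E0 * _]mulrC [_ * q x]mulrC -mulrBr qE// addrC subrK.
have [t tE] : exists t : int -> C, forall z, hdot (L2_of q) (fourier z) = t z.
  by exists (fun z => hdot (L2_of q) (fourier z)).
have Gz z : hdot (L2_of G) (fourier z) = G x0 * (0 == z)%:R + (t (z - 1) - E0 * t z).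
  by rewrite GE hdotDl hdotBl !hdotZl (hdot_modulation 1 _ cq) fourier_orthonormal !tE.
have step z : z != 0 -> `|t (z - 1)| = `|t z|.
  move=> z0; have := Gz z.
  rewrite (G0 z z0) [(0 == z)%B]eq_sym (negbTE z0) mulr0 add0r => e.
  have -> : t (z - 1) = E0 * t z by apply/eqP; rewrite -subr_eq0 -e.
  by rewrite normrM nE0 mul1r.
have t_pos (n : nat) : `|t n| = `|t 0|.
  elim: n => [//|n <-]; have := step (Posz n.+1) isT.
  by rewrite -[in t (_ - 1)]addn1 PoszD addrK.
have t_neg (n : nat) : `|t (Negz n)| = `|t (-1)|.
  elim: n => [//|n <-]; have := step (Negz n) isT.
  by rewrite !NegzE -[n.+2]addn1 PoszD opprD.
have orth (s : nat -> int) : injective s -> orthonormal_seq (fun n => fourier (s n) : L2_01 R).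
  by move=> s_inj i j; rewrite fourier_orthonormal (inj_eq s_inj).
have tz0 : `|t 0| = 0.
  apply: (const_coef_eq0 (v := L2_of q) (orth Posz _)) => [i j []//|k].
  by rewrite tE t_pos.
have tz1 : `|t (-1)| = 0.
  apply: (const_coef_eq0 (v := L2_of q) (orth Negz _)) => [i j []//|k].
  by rewrite tE t_neg.
have := Gz 0; rewrite eqxx mulr1 sub0r => ->.
by move: tz0 tz1 => /normr0_eq0 -> /normr0_eq0 ->; rewrite mulr0 subrr addr0.
Qed.

(** The primitive G of u is periodic, because the coefficient of u at 0 vanishes,
    and its coefficients at z <> 0 vanish by integration by parts. As G is
    differentiable almost everywhere, it is almost everywhere equal to its mean,
    so its derivative u is zero. *)
Lemma fourier_total u : (forall z, hdot u (fourier z) = 0) -> u = 0.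
Proof.
move=> u0; pose f : L2_fun leb := repr (u : L2 leb).
have uE : u = L2_class f by rewrite L2_classK.
have cf : cintegrable leb f.
  have := L2_cintegrable f (L2_one (R := R)).
  by congr cintegrable; apply/funext => x; rewrite rmorph1 mulr1.
pose G := primitive f; have acG : absolutely_continuous 0 1 G.
  exact: primitive_absolutely_continuous.
have cG := absolutely_continuous_within acG.
have dG := primitive_derivative cf.
have GE y : y \in `[0, 1] -> G y = fun01 G y by move=> Iy; rewrite (fun01E cG Iy).
have I0 : (0 : R) \in `[0, 1] by rewrite in_itv /= lexx ler01.
have I1 : (1 : R) \in `[0, 1] by rewrite in_itv /= lexx ler01.
have G1 : G 1 = 0.
  rewrite /G primitive1// -(u0 0) -fourier0E uE hdot_L2E.
  apply: eq_cintegral_ae => //; first exact: L2_cintegrable.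
  apply/ae_leb01; apply: aeW => x Ix.
  by rewrite (fun01E (@within_continuous_cst 1) Ix) rmorph1 mulr1.
have FF : Filter (almost_everywhere mu) by exact: ae_filter_ringOfSetsType.
have dG' : {ae mu, forall x, x \in `[0, 1] ->
    has_derivative_within I01 (fun01 G) x (f x)}.
  by apply: filterS dG => x Gx Ix; apply: (eq_has_derivative_within GE) => //; exact: Gx.
have Gz z : z != 0 -> hdot (L2_of G) (fourier z) = 0.
  move=> z0; have := fourier_derivative z (eq_absolutely_continuous GE acG) dG'.
  rewrite -uE u0 -!GE// G1 /G primitive0 subrr add0r => /esym/eqP.
  rewrite mulf_eq0 => /orP[|/eqP//]; rewrite (negbTE (imaginary_neq0 _))//.
  by rewrite -freq0 (inj_eq (@freq_inj R)).
(* fourier_pointwise applies inside the interval only *)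
have ends : {ae mu, forall x, x \in `[0, 1] -> 0 < x < 1}.
  exists [set 0; 1]; split.
  - by apply: measurableU; exact: measurable_set1.
  - apply/eqP; rewrite eq_le measure_ge0 andbT (le_trans (measureU2 _ _ _))//=.
    by rewrite !lebesgue_measure_set1 adde0.
  - move=> x /= /not_implyP[]; rewrite in_itv /= => /andP[x0 x1] x01.
    have [->|xn0] := eqVneq x 0; first by left.
    right; apply/eqP/negPn/negP => xn1; apply: x01.
    by rewrite !lt_neqAle x0 x1 eq_sym xn0 xn1.
have Gc : {ae mu, forall x, x \in `[0, 1] -> G x = hdot (L2_of G) (fourier 0)}.
  apply: filterS2 ends dG => x x01 Gx Ix.
  exact: fourier_pointwise (x01 Ix) cG (Gx Ix) Gz.
have f0 := ae_const_derivative Gc dG.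
rewrite uE -L2_class0; apply/L2_classP/ae_leb01.
by apply: filterS f0 => x fx Ix; rewrite fx.
Qed.

End Totality.

(** * The operator D_0 in Fourier coefficients *)

Section FourierCoefficients.
Local Open Scope complex_scope.
Context {R : realType}.
Local Notation C := R[i].
Local Notation mu := (@lebesgue_measure R).
Local Notation leb := (leb01 R).
Local Notation I01 := (`[0, 1]%classic : set R).
Implicit Types (f df : L2_fun leb) (z w : int) (u v : L2_01 R).

(** The enumeration 0, -1, 1, -2, 2, and so on, needed because the series above are
    indexed by the natural numbers. *)
Definition int_of_nat (k : nat) : int := if odd k then Negz k./2 else Posz k./2.

Definition nat_of_int z : nat :=
  match z with Posz n => n.*2 | Negz n => n.*2.+1 end.

Lemma nat_of_intK : cancel nat_of_int int_of_nat.
Proof.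
by case=> n; rewrite /int_of_nat /= odd_double ?doubleK//= uphalf_double.
Qed.

Lemma int_of_natK : cancel int_of_nat nat_of_int.
Proof.
move=> k; rewrite /int_of_nat; case: ifP => /= ko; last first.
  by rewrite -[RHS]odd_double_half ko.
by rewrite -[RHS]odd_double_half ko.
Qed.

Definition fourier_basis (k : nat) : L2_01 R := fourier (int_of_nat k).

Lemma fourier_basisE z : fourier z = fourier_basis (nat_of_int z).
Proof. by rewrite /fourier_basis nat_of_intK. Qed.

Lemma fourier_basis_orthonormal : orthonormal_seq fourier_basis.
Proof.
by move=> j k; rewrite /fourier_basis fourier_orthonormal (inj_eq (can_inj int_of_natK)).
Qed.

Lemma fourier_basis_total u : (forall k, hdot u (fourier_basis k) = 0) -> u = 0.
Proof. by move=> u0; apply: fourier_total => z; rewrite fourier_basisE. Qed.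

Lemma fourier_inj u v : (forall z, hdot u (fourier z) = hdot v (fourier z)) -> u = v.
Proof.
by move=> uv; apply: (coef_inj fourier_basis_total) => k; exact: uv.
Qed.

Lemma fourier_multiplier_exists (m : int -> C) (M : C) : (forall z, `|m z| <= M) ->
  exists2 A : L2_01 R -> L2_01 R, bounded_operator A &
    forall u z, hdot (A u) (fourier z) = m z * hdot u (fourier z).
Proof.
move=> mM; have [A bA AE] := diagonal_operator_exists fourier_basis_orthonormal
  fourier_basis_total (m := m \o int_of_nat) (fun k => mM _).
by exists A => // u z; rewrite fourier_basisE AE /= nat_of_intK.
Qed.

Lemma momentum_op_linear (bc : (R -> C) -> Prop) : bc (fun=> 0) ->
  (forall (c : C) (f g : R -> C), bc f -> bc g -> bc (fun x => c * f x + g x)) ->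
  momentum_op bc (0, 0) /\
  forall (c : C) p q, momentum_op bc p -> momentum_op bc q ->
    momentum_op bc (c *: p.1 + q.1, c *: p.2 + q.2).
Proof.
move=> bc0 bcD; have FF : Filter (almost_everywhere mu) by exact: ae_filter_ringOfSetsType.
split.
  exists 0, 0; split => //.
  - by rewrite L2_class0 scaler0.
  - by move=> e e0; exists 1 => // n s t _ _ _; rewrite big1 ?ltcR// => i _; rewrite subrr normr0.
  - by apply: aeW => x _; exact: has_derivative_within_cst.
move=> c _ _ [f [df [-> acf bcf fdf]]] [g [dg [-> acg bcg gdg]]].
exists (c *: f + g), (c *: df + dg); split => /=.
- by rewrite !L2_classD !L2_classZ scalerDr !scalerA mulrC.
- exact: absolutely_continuous_linear acf acg.
- exact: bcD.
- apply: filterS2 fdf gdg => x fx gx Ix.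
  have := has_derivative_withinD (has_derivative_withinM Ix
    (has_derivative_within_cst I01 c x) (fx Ix)) (gx Ix).
  by rewrite mul0r add0r.
Qed.

(** From left to right this is integration by parts. Conversely the coefficient of
    v at 0 vanishes, so that i v has a periodic primitive G; it has the same
    coefficients as u except at 0, hence differs from u by a constant, which D_0
    maps to 0. *)
Lemma D0_coef u v : D0_op R (u, v) <->
  forall z, hdot v (fourier z) = (freq z)%:C * hdot u (fourier z).
Proof.
have i0 : 'i != 0 :> C by rewrite eq_complex /= oner_eq0 andbF.
split=> [[f [df [[-> ->] acf f01 fdf]]] z|uv].
  by rewrite hdotZl (fourier_derivative z acf fdf) f01 subrr add0r mulrA mulrA mulVf// mul1r.
pose g : L2_fun leb := repr ('i *: v : L2 leb).
have gE : L2_class g = 'i *: v :> L2_01 R by rewrite L2_classK.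
have v0 : hdot v (fourier 0) = 0 by rewrite uv freq0 mul0r.
have [G [acG G0 G1 dG]] : exists G : R -> C, [/\ absolutely_continuous 0 1 G, G 0 = 0, G 1 = 0 &
    {ae mu, forall x, x \in `[0, 1] -> has_derivative_within I01 G x (g x)}].
  have cg : cintegrable leb g.
    have := L2_cintegrable g (L2_one (R := R)).
    by congr cintegrable; apply/funext => x; rewrite rmorph1 mulr1.
  exists (primitive g); split.
  - exact: primitive_absolutely_continuous.
  - exact: primitive0.
  - rewrite primitive1//; transitivity (hdot ('i *: v) (fourier 0)); last by rewrite hdotZl v0 mulr0.
    rewrite -gE -fourier0E hdot_L2E; apply: eq_cintegral_ae => //; first exact: L2_cintegrable.
    apply/ae_leb01; apply: aeW => x Ix.
    by rewrite (fun01E (@within_continuous_cst _ 1) Ix) rmorph1 mulr1.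
  - exact: primitive_derivative.
have cG := absolutely_continuous_within acG.
have GE y : y \in `[0, 1] -> G y = fun01 G y by move=> Iy; rewrite (fun01E cG Iy).
have I0 : (0 : R) \in `[0, 1] by rewrite in_itv /= lexx ler01.
have I1 : (1 : R) \in `[0, 1] by rewrite in_itv /= lexx ler01.
have FF : Filter (almost_everywhere mu) by exact: ae_filter_ringOfSetsType.
(* G represents an element of dom D_0 with image v *)
have DG : D0_op R (L2_of G, v).
  exists (fun01 G), g; split.
  - by rewrite gE scalerA mulVf// scale1r.
  - exact: eq_absolutely_continuous GE acG.
  - by rewrite -!GE// G0 G1.
  - by apply: filterS dG => x Gx Ix; apply: (eq_has_derivative_within GE) => //; exact: Gx.
have G_coef z : hdot v (fourier z) = (freq z)%:C * hdot (L2_of G) (fourier z).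
  have [f [df [[-> ->] acf f01 fdf]]] := DG.
  by rewrite hdotZl (fourier_derivative z acf fdf) f01 subrr add0r mulrA mulrA mulVf// mul1r.
have [//||_ lin] := @momentum_op_linear (fun h : R -> C => h 0 = h 1).
  by move=> c h k -> ->.
have D1 : D0_op R (fourier 0, 0).
  have [ac dE e0 e1 ce] := @fourier_differentiable R 0.
  exists (fun01 (expi (freq 0))), (fun01 (fun y => 'i * (freq 0)%:C * expi (freq 0) y)).
  split=> //; last by rewrite e0 e1.
  by congr (_, _); rewrite ce [in RHS]freq0 mulr0 scale0r scaler0.
have := lin (hdot u (fourier 0) - hdot (L2_of G) (fourier 0)) _ _ D1 DG.
rewrite /= scaler0 add0r; congr (D0_op R (_, _)); apply: fourier_inj => z.
rewrite hdotDl hdotZl fourier_orthonormal; have [<-|z0] := eqVneq 0 z.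
  by rewrite mulr1 subrK.
rewrite mulr0 add0r; apply: (@mulfI _ (freq z)%:C); last by rewrite -G_coef uv.
by rewrite eq_complex /= eqxx andbT -freq0 (inj_eq (@freq_inj R)) eq_sym.
Qed.

Lemma D0_fourier z : D0_op R (fourier z, (freq z)%:C *: fourier z).
Proof.
by apply/D0_coef => w; rewrite hdotZl fourier_orthonormal; case: eqVneq => [->//|_]; rewrite !mulr0.
Qed.

Lemma D0_linear : linear_operator (D0_op R).
Proof.
have [//||D00 lin] := @momentum_op_linear (fun h : R -> C => h 0 = h 1).
  by move=> c h k -> ->.
split=> // v /D0_coef v0; apply: fourier_total => z.
by rewrite v0 hdot0l mulr0.
Qed.

Lemma D0_functional u v (w : L2_01 R) : D0_op R (u, v) -> D0_op R (u, w) -> v = w.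
Proof.
move=> /D0_coef uv /D0_coef uw; apply: fourier_inj => z.
by rewrite uv uw.
Qed.

(** Testing an element of the adjoint against the modes gives the coefficient
    relation of D0_coef; the converse inclusion is Parseval's identity, as the
    frequencies are real. *)
Lemma D0_adjoint : op_adjoint (D0_op R) = D0_op R.
Proof.
apply/seteqP; split=> [[u v] uv|[u v] Duv [u' v'] Duv'].
  apply/D0_coef => z.
  have e : hdot ((freq z)%:C *: fourier z) u = hdot (fourier z) v := uv _ (D0_fourier z).
  by rewrite [LHS]hdotC -e hdotZl rmorphM /= conj_realC -hdotC.
move/D0_coef : Duv => uv; move/D0_coef : Duv' => uv'.
change (hdot v' u = hdot u' v).
apply: (hdot_ext fourier_basis_orthonormal fourier_basis_total) => k.
rewrite /fourier_basis uv uv' [in RHS]rmorphM /= conj_realC.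
by rewrite -mulrA mulrCA.
Qed.

End FourierCoefficients.

(** * The operator D *)

Section MinimalOperator.
Local Open Scope complex_scope.
Context {R : realType}.
Local Notation C := R[i].
Local Notation mu := (@lebesgue_measure R).
Local Notation leb := (leb01 R).
Local Notation I01 := (`[0, 1]%classic : set R).
Local Notation H := (L2_01 R).
Implicit Types (z w : int) (u v : L2_01 R).

Lemma D_op_sub : D_op R `<=` D0_op R.
Proof.
by move=> p [f [df [-> acf [f0 f1] fdf]]]; exists f, df; split=> //; rewrite f0 f1.
Qed.

Lemma D_op_linear : linear_operator (D_op R).
Proof.
have [//||D00 lin] := @momentum_op_linear R (fun h : R -> C => h 0 = 0 /\ h 1 = 0).
  by move=> c h k [-> ->] [-> ->]; rewrite mulr0 addr0.
split=> // v /D_op_sub Dv; have [_ _] := @D0_linear R; exact.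
Qed.

(** The value f 1, when p is the class of f paired with that of f'/i: see
    integration_by_parts_id. *)
Definition endpoint_functional (p : H * H) : C :=
  hdot ('i *: p.2) (L2_of (@id01 R)) + hdot p.1 (fourier 0).

(** Given that f 0 = f 1, the boundary condition of D says that f 1 = 0. So the
    graph of D is cut out of that of D_0 by a functional which is continuous on
    pairs, whence D is closed. *)
Lemma D_opE : D_op R = D0_op R `&` [set p | endpoint_functional p = 0].
Proof.
apply/seteqP; split=> [p Dp|p [[f [df [-> acf f01 fdf]]]]].
  split; first exact: D_op_sub.
  case: Dp => [f [df [-> acf [f0 f1] fdf]]].
  rewrite /endpoint_functional /= scalerA mulfV ?i_neq0// scale1r.
  by rewrite -[RHS]f1 -(integration_by_parts_id acf fdf).
rewrite /= /endpoint_functional /= scalerA mulfV ?i_neq0// scale1r.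
rewrite (integration_by_parts_id acf fdf) => f1.
by exists f, df; split=> //; rewrite f01 f1.
Qed.

Lemma D_op_fourierB z w :
  D_op R (fourier z - fourier w, (freq z)%:C *: fourier z - (freq w)%:C *: fourier w).
Proof.
rewrite D_opE; split.
  apply/D0_coef => y; rewrite !hdotBl !hdotZl mulrBr.
  have := @D0_fourier R z => /D0_coef/(_ y); rewrite hdotZl => ->.
  by have := @D0_fourier R w => /D0_coef/(_ y); rewrite hdotZl => ->.
have e y : hdot ('i *: ((freq y)%:C *: fourier y)) (L2_of (@id01 R)) + hdot (fourier y) (fourier 0) = 1.
  have [ac dE e0 e1 ce] := @fourier_differentiable R y.
  by rewrite scalerA -ce (integration_by_parts_id ac dE).
change (hdot ('i *: ((freq z)%:C *: fourier z - (freq w)%:C *: fourier w)) (L2_of (@id01 R)) +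
  hdot (fourier z - fourier w) (fourier 0) = 0).
by rewrite scalerBr !hdotBl addrACA -opprD !e subrr.
Qed.

Lemma op_dom_linear (T : set (H * H)) : linear_operator T ->
  forall (c : C) u v, op_dom T u -> op_dom T v -> op_dom T (c *: u + v).
Proof.
move=> [_ lin _] c u v [u' Tu] [v' Tv]; exists (c *: u' + v').
exact: lin Tu Tv.
Qed.

Lemma op_dom_sum (T : set (H * H)) (n : nat) (c : nat -> C) (x : nat -> H) :
  linear_operator T -> (forall k, op_dom T (x k)) ->
  op_dom T (\sum_(k < n) c k *: x k).
Proof.
move=> lT Tx; elim: n => [|n IH].
  by rewrite big_ord0; exists 0; case: lT.
by rewrite big_ord_recr /= addrC; apply: op_dom_linear.
Qed.

Lemma dense_norm (A : set H) : (forall u (e : R), 0 < e ->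
  exists2 v, A v & `|u - v| < e%:C) -> dense A.
Proof.
move=> Ad O [u Ou] oO.
have /nbhs_ballP[e' /= /gt0_complexP[e e0 ->] eO] := open_nbhs_nbhs (conj oO Ou).
have [v Av uv] := Ad u e e0; exists v; split=> //.
by apply: eO; rewrite -ball_normE.
Qed.

(** A difference of two modes vanishes at the end points. Since the mean m of M
    modes has norm M^(-1/2), every mode is close to the element b k - m of the
    domain, and so is every finite combination of modes. *)
Lemma dense_op_dom_D : dense (op_dom (D_op R)).
Proof.
apply: dense_norm => u e e0; pose b := @fourier_basis R.
have b1 : orthonormal_seq b := @fourier_basis_orthonormal R.
have e20 : 0 < (e / 2)%:C :> C by rewrite ltcR divr_gt0.
have /cvgrPdist_lt/(_ _ e20)[n _ /(_ n (leqnn n)) /= un] :=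
  @expansion _ _ _ b1 (@fourier_basis_total R) u.
set c := coef b u in un.
pose s := \sum_(k < n) c k; have [t t0 st] := norm_complexE s.
have [M M0 tM] : exists2 M : nat, (0 < M)%N & t ^+ 2 < (e / 2) ^+ 2 * M%:R.
  exists (Num.bound (t ^+ 2 / (e / 2) ^+ 2)).+1 => //.
  rewrite mulrC -ltr_pdivrMr ?exprn_gt0 ?divr_gt0//.
  apply: lt_trans (archi_boundP _) _; first by rewrite divr_ge0// exprn_ge0// ltW// divr_gt0.
  by rewrite ltr_nat.
pose m := partial_sum b (fun=> M%:R^-1) M.
have M0C : M%:R != 0 :> C by rewrite pnatr_eq0 -lt0n.
have mE : m = \sum_(j < M) M%:R^-1 *: b j by [].
have Dbm k : op_dom (D_op R) (b k - m).
  have -> : b k - m = \sum_(j < M) M%:R^-1 *: (b k - b j).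
    under eq_bigr do rewrite scalerBr; rewrite sumrB -mE; congr (_ - _).
    by rewrite sumr_const card_ord scalerMnl -[_ *+ M]mulr_natl mulfV// scale1r.
  apply: (@op_dom_sum _ M (fun=> M%:R^-1) (fun j => b k - b j)); first exact: D_op_linear.
  by move=> j; eexists; exact: D_op_fourierB.
exists (\sum_(k < n) c k *: (b k - m)); first exact: (@op_dom_sum _ n c _ D_op_linear Dbm).
have -> : \sum_(k < n) c k *: (b k - m) = partial_sum b c n - s *: m.
  by under eq_bigr do rewrite scalerBr; rewrite sumrB -scaler_suml.
rewrite opprB addrA addrAC; apply: le_lt_trans (ler_normD _ _) _.
rewrite [e]splitr rmorphD /=; apply: ltrD => //.
rewrite normrZ st -ltr_sqr ?nnegrE ?mulr_ge0 ?(ltW e20) ?ler0c// exprMn.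
rewrite norm_partial_sum// sumr_const card_ord ger0_norm ?invr_ge0 ?ler0n//.
have -> : M%:R^-1 ^+ 2 *+ M = M%:R^-1 :> C.
  by rewrite -mulr_natl expr2 mulrA mulfV// mul1r.
rewrite ltr_pdivrMr ?ltr0n//.
by rewrite -[M%:R](rmorph_nat (real_complex R)) -!rmorphXn -rmorphM ltcR.
Qed.

Lemma dense_op_dom_D0 : dense (op_dom (D0_op R)).
Proof.
move=> O O0 oO; have [u [Ou [v Duv]]] := dense_op_dom_D O0 oO.
by exists u; split=> //; exists v; exact: D_op_sub.
Qed.

Lemma D_op_symmetric : symmetric_operator (D_op R).
Proof.
split; [exact: D_op_linear|exact: dense_op_dom_D|].
move=> p /D_op_sub; rewrite -[X in X p]D0_adjoint => Dp q /D_op_sub.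
exact: Dp.
Qed.

Lemma D0_op_selfadjoint : selfadjoint_operator (D0_op R).
Proof.
by split; [exact: D0_linear|exact: dense_op_dom_D0|exact: D0_adjoint].
Qed.

Lemma closed_eq0 (T : topologicalType) (f : T -> C) : continuous f ->
  closed [set x | f x = 0].
Proof.
move=> cf; apply: (@preimage_closed _ _ f [set 0]); first by move=> x _; exact: cf.
exact: accessible_closed_set1 (hausdorff_accessible (@norm_hausdorff _ C)) _.
Qed.

Lemma D_op_closed : closed (D_op R).
Proof.
have c1 (y : H) : continuous (fun p : H * H => hdot p.1 y).
  move=> p; apply: (@continuous_comp _ _ _ fst (fun u => hdot u y)); first exact: cvg_fst.
  exact: continuous_hdotl.
have c2 (y : H) : continuous (fun p : H * H => hdot p.2 y).
  move=> p; apply: (@continuous_comp _ _ _ snd (fun u => hdot u y)); first exact: cvg_snd.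
  exact: continuous_hdotl.
have -> : D_op R = (\bigcap_(z in [set: int])
    [set p : H * H | hdot p.2 (fourier z) - (freq z)%:C * hdot p.1 (fourier z) = 0]) `&`
    [set p | 'i * hdot p.2 (L2_of (@id01 R)) + hdot p.1 (fourier 0) = 0].
  rewrite D_opE /endpoint_functional; congr (_ `&` _); last first.
    by apply/funext => p /=; rewrite hdotZl.
  apply/seteqP; split=> [[u v] /D0_coef uv z _ /=|[u v] /= uv]; first by rewrite uv subrr.
  by apply/D0_coef => z; apply/eqP; rewrite -subr_eq0; apply/eqP; exact: uv.
apply: closedI.
  apply: closed_bigI => z _; apply: closed_eq0 => p.
  exact: cvgB (c2 (fourier z) p) (cvgM (cvg_cst (freq z)%:C) (c1 (fourier z) p)).
apply: closed_eq0 => p.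
exact: cvgD (cvgM (cvg_cst 'i) (c2 _ p)) (c1 _ p).
Qed.

End MinimalOperator.

(** * The resolvent of D_0 and its commutators *)

Section Resolvent.
Local Open Scope complex_scope.
Context {R : realType}.
Local Notation C := R[i].
Local Notation H := (L2_01 R).
Implicit Types (z : int) (u v : L2_01 R) (s : C).

Lemma freq_ge (k : nat) : k%:R <= `|freq (int_of_nat k) : R|.
Proof.
have p2 : 2 <= (pi : R) by exact: pi_ge2.
rewrite /freq normrM [`|2 * pi|]ger0_norm ?mulr_ge0 ?pi_ge0//.
have key (n : nat) : (k <= n.*2)%N -> k%:R <= 2 * pi * n%:R :> R.
  move=> kn; apply: (@le_trans _ _ (n.*2)%:R); first by rewrite ler_nat.
  rewrite -mul2n natrM -mulrA ler_wpM2l//.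
  by rewrite -[leLHS]mul1r ler_wpM2r//; apply: le_trans p2; rewrite ler1n.
rewrite /int_of_nat; case: ifP => ko.
  rewrite NegzE mulrNz normrN -pmulrn ger0_norm//; apply: key.
  by rewrite doubleS -{1}(odd_double_half k) ko add1n ltnW.
by rewrite -pmulrn ger0_norm//; apply: key; rewrite -{1}(odd_double_half k) ko.
Qed.

Lemma resolvent_multiplier_cvg s :
  ((freq (int_of_nat k))%:C - s)^-1 @[k --> \oo] --> (0 : C).
Proof.
apply/cvgrPdist_lt => _ /gt0_complexP[e e0 ->]; have [t t0 st] := norm_complexE s.
exists (Num.bound (t + e^-1)) => // k /= kn; rewrite sub0r normrN normfV.
have [d d0 dE] := norm_complexE ((freq (int_of_nat k))%:C - s).
have kd : k%:R - t <= d.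
  rewrite -lecR -dE rmorphB /= -st lerBlDr.
  apply: (@le_trans _ _ `|(freq (int_of_nat k))%:C : C|).
    by rewrite norm_realC lecR freq_ge.
  by rewrite -{1}(subrK s (freq _)%:C) ler_normD.
have ed : e^-1 < d.
  apply: lt_le_trans kd; rewrite ltrBrDl; apply: lt_le_trans (archi_boundP _) _.
    by rewrite addr_ge0// invr_ge0 ltW.
  by rewrite ler_nat.
have d_gt0 : 0 < d by apply: lt_trans ed; rewrite invr_gt0.
by rewrite dE -fmorphV ltcR -[ltRHS]invrK ltf_pV2 ?posrE ?invr_gt0.
Qed.

Lemma is_resolvent_coef s A : is_resolvent (D0_op R) s A ->
  forall u z, hdot u (fourier z) = ((freq z)%:C - s) * hdot (A u) (fourier z).
Proof.
move=> [bA AE] u z.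
have : op_graph A (u, A u) by [].
rewrite -AE => -[v [w [/D0_coef Dv wE uE]]].
have uv : u = v - s *: A u by rewrite -wE.
by rewrite {1}uv hdotBl hdotZl mulrBl Dv.
Qed.

Lemma norm_fourier z : `|fourier z : H| = 1.
Proof.
apply/eqP; rewrite -sqrp_eq1// -hdot_norm.
by have := @fourier_orthonormal R z z; rewrite eqxx => ->.
Qed.

(** A resolvent is diagonal in the Fourier basis, with eigenvalues tending to 0. *)
Lemma resolvent_compact s A : is_resolvent (D0_op R) s A -> compact_operator A.
Proof.
move=> rA; have AE := is_resolvent_coef rA; have [[lA [M AM]] _] := rA.
have fs z : (freq z)%:C - s != 0.
  have := AE (fourier z) z; rewrite fourier_orthonormal eqxx => /esym/eqP.
  by apply: contraTneq => ->; rewrite mul0r eq_sym oner_eq0.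
have Ac u z : hdot (A u) (fourier z) = ((freq z)%:C - s)^-1 * hdot u (fourier z).
  by rewrite (AE u z) mulKf.
apply: (diagonal_operator_compact (@fourier_basis_orthonormal R) (@fourier_basis_total R)
  (m := fun k => ((freq (int_of_nat k))%:C - s)^-1) (M := M)) => //.
- move=> k; have := Ac (fourier (int_of_nat k)) (int_of_nat k).
  rewrite fourier_orthonormal eqxx mulr1 => <-; apply: le_trans (hdot_le _ _) _.
  by rewrite norm_fourier mulr1; apply: le_trans (AM _) _; rewrite norm_fourier mulr1.
- exact: resolvent_multiplier_cvg.
- by move=> u k; exact: Ac.
Qed.

Lemma resolvent_exists : exists s A, is_resolvent (D0_op R) s A.
Proof.
have fi z : 1 <= `|(freq z)%:C - 'i : C|.
  apply: le_trans (Im_norm_le _); simpc; rewrite /= ?sub0r ?add0r ?oppr0 ?normrN ?normr1 ?lexx//.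
have fi0 z : (freq z)%:C - 'i != 0 :> C.
  by rewrite -normr_gt0; apply: lt_le_trans (fi z).
have [|A bA AE] := @fourier_multiplier_exists R (fun z => ((freq z)%:C - 'i)^-1) 1.
  by move=> z; rewrite normfV invf_le1//; apply: lt_le_trans (fi z).
exists 'i, A; split=> //; apply/seteqP; split=> -[u w].
  move=> [v [w' [/D0_coef Dv w'E uE]]]; apply: fourier_inj => z.
  have uv : u = v - 'i *: w by rewrite -w'E.
  by rewrite [RHS]AE uv hdotBl hdotZl Dv -mulrBl mulKf.
rewrite /op_graph /= => ->; exists (u + 'i *: A u), (- ('i *: A u)).
split=> //=; last by rewrite addrK.
apply/D0_coef => z; rewrite hdotDl hdotZl.
have -> : hdot u (fourier z) = ((freq z)%:C - 'i) * hdot (A u) (fourier z).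
  by rewrite AE mulVKf.
by rewrite mulrBl subrK.
Qed.

Lemma D0_compact_resolvent : compact_resolvent (D0_op R).
Proof. by split; [exact: resolvent_exists|move=> s A; exact: resolvent_compact]. Qed.

End Resolvent.

Section Commutator.
Local Open Scope complex_scope.
Context {R : realType}.
Local Notation C := R[i].
Local Notation mu := (@lebesgue_measure R).
Local Notation leb := (leb01 R).
Local Notation I01 := (`[0, 1]%classic : set R).
Local Notation H := (L2_01 R).
Implicit Types (a da : R -> C) (u v : L2_01 R).

(** The product rule; the boundary condition survives multiplication by a. *)
Lemma D_op_leibniz a da u v : {within I01, continuous da} ->
  (forall x, x \in `[0, 1] -> has_derivative_within I01 a x (da x)) ->
  D_op R (u, v) -> D_op R (mul_op a u, 'i^-1 *: mul_op da u + mul_op a v).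
Proof.
move=> cda ada [f [df [[-> ->] acf [f0 f1] fdf]]].
have ca := derivative_within_continuous ada.
have [K _ daK] := within_norm_bounded cda.
have aca := bounded_derivative_absolutely_continuous ada daK.
have mE (b : R -> C) (g : L2_fun leb) : {within I01, continuous b} ->
    mul_op b (L2_class g : H) = L2_class (mulf b g).
  by move=> cb; apply: (mul_op_class cb); apply: aeW => x Ix; exact: mulfE.
have [lin_a _] := mul_op_bounded ca.
have afE y : y \in `[0, 1] -> a y * f y = mulf a f y by move=> Iy; rewrite (mulfE _ ca Iy).
have I0 : (0 : R) \in `[0, 1] by rewrite in_itv /= lexx ler01.
have I1 : (1 : R) \in `[0, 1] by rewrite in_itv /= lexx ler01.
exists (mulf a f), (mulf da f + mulf a df); split.
- rewrite (linearZ_of _ _ lin_a) (mE _ _ ca) (mE _ _ cda) (mE _ _ ca).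
  by rewrite L2_classD scalerDr.
- exact: eq_absolutely_continuous afE (absolutely_continuousM aca acf).
- by rewrite -(afE 0 I0) -(afE 1 I1) f0 f1 !mulr0.
- have FF : Filter (almost_everywhere mu) by exact: ae_filter_ringOfSetsType.
  apply: filterS fdf => x fx Ix.
  apply: (eq_has_derivative_within afE Ix).
  rewrite L2_funDE (mulfE _ cda Ix) (mulfE _ ca Ix).
  exact: has_derivative_withinM Ix (ada x Ix) (fx Ix).
Qed.

(** On dom D the commutator is multiplication by a', up to the factor 1/i. *)
Lemma commutator_bounded a : smooth01 a ->
  op_dom (D_op R) `<=` op_dom (op_commutator (D0_op R) (mul_op a)) /\
  exists M : C, forall u v, op_dom (D_op R) u ->
    op_commutator (D0_op R) (mul_op a) (u, v) -> `|v| <= M * `|u|.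
Proof.
move=> [d [da dn]].
have cd1 : {within I01, continuous (d 1%N)} := derivative_within_continuous (dn 1%N).
have ad x : x \in `[0, 1] -> has_derivative_within I01 a x (d 1%N x).
  by move=> Ix; apply: (eq_has_derivative_within da Ix); exact: (dn 0%N).
split.
  move=> u [v Duv]; have Dau := D_op_leibniz cd1 ad Duv.
  exists ('i^-1 *: mul_op (d 1%N) u + mul_op a v - mul_op a v).
  exists ('i^-1 *: mul_op (d 1%N) u + mul_op a v), (mul_op a v); split=> //=.
  - by exists (mul_op a u) => //; exact: D_op_sub.
  - by exists v => //; exact: D_op_sub.
have [_ [M MP]] := mul_op_bounded cd1.
exists M => u w [v Duv]; have Dau := D_op_leibniz cd1 ad Duv.
move=> [v1 [v2 [[w1 w1E D1] [w2 D2 v2E] wE]]].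
have {}w1E : w1 = mul_op a u := w1E; have {}v2E : v2 = mul_op a w2 := v2E.
have {}wE : w = v1 - v2 := wE; rewrite w1E in D1.
have {}D1 : D0_op R (mul_op a u, v1) := D1; have {}D2 : D0_op R (u, w2) := D2.
rewrite wE v2E (D0_functional D1 (D_op_sub Dau)) (D0_functional D2 (D_op_sub Duv)) addrK.
by rewrite normrZ normfV norm_i invr1 mul1r.
Qed.

End Commutator.

(** * The bounded transform *)

Section BoundedTransform.
Local Open Scope complex_scope.
Context {R : realType}.
Local Notation C := R[i].
Local Notation H := (L2_01 R).
Implicit Types (z : int) (u v : L2_01 R).

(** The eigenvalue of (1 + D_0^2)^(-1/2) at the mode z. *)
Definition inv_sqrt_freq z : R := (Num.sqrt (1 + freq z ^+ 2))^-1.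

(** The eigenvalue of the bounded transform at the mode z. *)
Definition transform_freq z : R := freq z * inv_sqrt_freq z.

Lemma inv_sqrt_freq_gt0 z : 0 < inv_sqrt_freq z.
Proof. by rewrite invr_gt0 sqrtr_gt0 ltr_pwDl// sqr_ge0. Qed.

Lemma inv_sqrt_freq_sqr z : inv_sqrt_freq z ^+ 2 * (1 + freq z ^+ 2) = 1.
Proof.
have f0 : 0 < 1 + freq z ^+ 2 :> R by rewrite ltr_pwDl// sqr_ge0.
by rewrite exprVn sqr_sqrtr ?(ltW f0)// mulVf// gt_eqF.
Qed.

Lemma inv_sqrt_freqC z : (inv_sqrt_freq z)%:C * (inv_sqrt_freq z)%:C *
  (1 + (freq z)%:C * (freq z)%:C) = 1 :> C.
Proof.
rewrite -(rmorph1 (real_complex R)) -!rmorphM -rmorphD -rmorphM.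
by rewrite -[in RHS](inv_sqrt_freq_sqr z) !expr2.
Qed.

Lemma sqr_le1 (r : R) : r ^+ 2 <= 1 -> `|r%:C| <= 1 :> C.
Proof. by move=> r1; rewrite norm_realC lecR -(@expr_le1 _ 2)// real_normK ?num_real. Qed.

Lemma inv_sqrt_freq_le1 z : `|(inv_sqrt_freq z)%:C| <= 1 :> C.
Proof.
apply: sqr_le1; rewrite -(inv_sqrt_freq_sqr z) ler_peMr ?sqr_ge0//.
by rewrite lerDl sqr_ge0.
Qed.

Lemma transform_freqC z :
  (transform_freq z)%:C = (freq z)%:C * (inv_sqrt_freq z)%:C :> C.
Proof. exact: rmorphM. Qed.

Lemma transform_freq_le1 z : `|(transform_freq z)%:C| <= 1 :> C.
Proof.
apply: sqr_le1; rewrite -(inv_sqrt_freq_sqr z) exprMn mulrC ler_wpM2l ?sqr_ge0//.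
by rewrite lerDr.
Qed.

Lemma transform_freqN z : transform_freq (- z) = - transform_freq z.
Proof. by rewrite /transform_freq /inv_sqrt_freq freqN sqrrN mulNr. Qed.

Lemma transform_freq_ge z : 1 <= (freq z : R) -> 1 / 2 <= transform_freq z.
Proof.
move=> f1; have s0 := inv_sqrt_freq_gt0 z; have := inv_sqrt_freq_sqr z.
rewrite /transform_freq; move: (inv_sqrt_freq z) (freq z : R) s0 f1 => s f s0 f1 e.
have sp : s <= f * s by rewrite ler_peMl// ltW.
have {}e : (f * s) ^+ 2 + s ^+ 2 = 1 by rewrite -e; ring.
by move: (f * s) sp e => p sp e; nra.
Qed.

Section Square.
Variable S : H -> H.
Hypothesis SE : forall u z, hdot (S u) (fourier z) = (inv_sqrt_freq z)%:C * hdot u (fourier z).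

(** The coefficient of u at z is 1 + freq z ^ 2 times that of w. *)
Lemma inv_1sqr_coef u w : op_inv (op_add (op_graph id) (op_comp (D0_op R) (D0_op R))) (u, w) ->
  w = S (S u).
Proof.
move=> [v [w' [vE [x /D0_coef Dwx /D0_coef Dxw'] uE]]].
have {}uE : u = w + w' by rewrite -[w]vE.
apply: fourier_inj => z; rewrite !SE uE hdotDl Dxw' Dwx.
by rewrite -{1}[hdot w _]mul1r -(inv_sqrt_freqC z); ring.
Qed.

End Square.

(** Positivity determines S' on an eigenvector e of its square: if S' (S' e) = s^2 e
    with s > 0, then w = S' e - s e satisfies S' w = - s w, and pairing this with w
    shows that w = 0. As S and S' agree on the modes, they are equal. *)
Lemma inv_sqrt_unique (S S' : H -> H) :
  is_inv_sqrt_1sqr (D0_op R) S -> is_inv_sqrt_1sqr (D0_op R) S' ->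
  (forall u z, hdot (S u) (fourier z) = (inv_sqrt_freq z)%:C * hdot u (fourier z)) -> S = S'.
Proof.
move=> [bS _ _] [bS' S'0 S'E] SE.
have SS u : S' (S' u) = S (S u).
  apply: (inv_1sqr_coef SE); rewrite -S'E //.
have Sez z : S (fourier z) = (inv_sqrt_freq z)%:C *: fourier z.
  apply: fourier_inj => w; rewrite SE hdotZl fourier_orthonormal.
  by case: eqVneq => [->//|_]; rewrite !mulr0.
apply: (bounded_operator_ext (@fourier_basis_orthonormal R) (@fourier_basis_total R) bS bS').
move=> k; rewrite /fourier_basis; move: (int_of_nat k) => z; rewrite Sez.
have [lS _] := bS; have [lS' _] := bS'.
set s := (inv_sqrt_freq z)%:C; have s0 : 0 < s by rewrite ltcR inv_sqrt_freq_gt0.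
pose w := S' (fourier z) - s *: fourier z.
have Sw : S' w = - (s *: w).
  rewrite /w (linearB_of _ _ lS') (linearZ_of _ _ lS') SS Sez -/s.
  by rewrite (linearZ_of _ _ lS) Sez -/s scalerBr opprB.
have := S'0 w; rewrite Sw hdotNl hdotZl oppr_ge0 pmulr_rle0// hdot_norm.
move=> w_le0; have w_eq0 : `|w| ^+ 2 = 0.
  by apply/eqP; rewrite eq_le w_le0 exprn_ge0.
move/eqP : w_eq0; rewrite expf_eq0 /= normr_eq0 subr_eq0 => /eqP.
by move=> ->.
Qed.

Lemma bounded_transform_exists : exists F : H -> H,
  [/\ bounded_transform (D0_op R) F,
      forall F', bounded_transform (D0_op R) F' -> F' = F &
      forall u z, hdot (F u) (fourier z) = (transform_freq z)%:C * hdot u (fourier z)].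
Proof.
have [S bS SE] := fourier_multiplier_exists inv_sqrt_freq_le1.
have [F bF FE] := fourier_multiplier_exists transform_freq_le1.
have D0S u : D0_op R (S u, F u).
  by apply/D0_coef => z; rewrite FE SE transform_freqC mulrA.
have graphF : op_graph F = op_comp (D0_op R) (op_graph S).
  apply/seteqP; split=> -[u v].
    by move=> vE; have {}vE : v = F u := vE; exists (S u); rewrite ?vE //; exact: D0S.
  by move=> [w wE D]; have {}wE : w = S u := wE; apply: D0_functional (D0S u); rewrite -wE.
have S_sqrt : is_inv_sqrt_1sqr (D0_op R) S.
  split=> //.
  - move=> u; apply: (hdot_coef_ge0 (@fourier_basis_orthonormal R) (@fourier_basis_total R)) => k.
    by rewrite SE -mulrA -normCK mulr_ge0 ?exprn_ge0// ler0c ltW// inv_sqrt_freq_gt0.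
  - apply/seteqP; split=> -[u w]; last by move/(inv_1sqr_coef SE).
    move=> wE; have {}wE : w = S (S u) := wE.
    exists w, (u - w); split=> //; last by rewrite addrC subrK.
    exists (F (S u)); first by rewrite /= wE; exact: D0S.
    apply/D0_coef => z; rewrite hdotBl FE wE !SE transform_freqC.
    by rewrite -{1}[hdot u _]mul1r -(inv_sqrt_freqC z); ring.
exists F; split=> //; first by split=> //; exists S.
move=> F' [bF' [S' S'_sqrt graphF']].
have FF' : op_graph F' = op_graph F by rewrite graphF' graphF (inv_sqrt_unique S_sqrt S'_sqrt SE).
apply/funext => u; have : op_graph F' (u, F' u) by [].
by rewrite FF'.
Qed.

End BoundedTransform.

(** * The commutator [F, x] is not compact *)

Section NonCompact.
Local Open Scope complex_scope.
Context {R : realType}.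
Local Notation C := R[i].
Local Notation leb := (leb01 R).
Local Notation I01 := (`[0, 1]%classic : set R).
Local Notation H := (L2_01 R).
Implicit Types (p q z : int) (u v : L2_01 R).

Lemma within_continuous_id01 : {within I01, continuous (@id01 R)}.
Proof.
by apply: derivative_within_continuous => x _; exact: has_derivative_within_id.
Qed.

Lemma mul_op_L2_of (a b : R -> C) :
  {within I01, continuous a} -> {within I01, continuous b} ->
  mul_op a (L2_of b : H) = L2_of (fun x => a x * b x).
Proof.
move=> ca cb; have cab := within_continuousM ca cb.
apply: (mul_op_class ca); apply: aeW => x Ix.
by rewrite (fun01E cab Ix) (fun01E cb Ix).
Qed.

Lemma fourier_id01 z : z != 0 -> hdot (L2_of (@id01 R)) (fourier z) = 'i / (freq z)%:C.
Proof.
move=> z0; have c1 := @within_continuous_cst R 1.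
have [ac dE] := fun01_differentiable (fun x _ => @has_derivative_within_id R I01 x) c1.
have := fourier_derivative z ac dE.
rewrite -/(L2_of (fun=> 1)) fourier0E fourier_orthonormal eq_sym (negbTE z0).
have f0 : (freq z)%:C != 0 :> C.
  by rewrite eq_complex /= eqxx andbT -freq0 (inj_eq (@freq_inj R)).
have I0 : (0 : R) \in `[0, 1] by rewrite in_itv /= lexx ler01.
have I1 : (1 : R) \in `[0, 1] by rewrite in_itv /= lexx ler01.
rewrite (fun01E within_continuous_id01 I0) (fun01E within_continuous_id01 I1).
rewrite /id01 rmorph0 rmorph1 subr0 -/(L2_of (@id01 R)) => e.
have i2 : 'i * 'i = - 1 :> C by rewrite -expr2 sqr_i.
apply: (mulfI (mulf_neq0 (@i_neq0 R) f0)).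
apply: (@addrI _ 1); rewrite -e.
have -> : 'i * (freq z)%:C * ('i / (freq z)%:C) = 'i * 'i * ((freq z)%:C / (freq z)%:C) :> C by ring.
by rewrite mulfV// i2 mulr1 subrr.
Qed.

Lemma fourier_mul_id01 p z : p != z ->
  hdot (mul_op (@id01 R) (fourier p)) (fourier z) = 'i / (freq (z - p))%:C.
Proof.
move=> pz; have cp := @expi_within_continuous R (freq p).
rewrite (mul_op_L2_of within_continuous_id01 cp).
have -> : (fun x => @id01 R x * expi (freq p) x) = (fun x => expi (freq p) x * @id01 R x).
  by apply/funext => x; rewrite mulrC.
rewrite (hdot_modulation _ _ within_continuous_id01) fourier_id01//.
by rewrite subr_eq0 eq_sym.
Qed.

Variable F : H -> H.
Hypothesis FE : forall u z, hdot (F u) (fourier z) = (transform_freq z)%:C * hdot u (fourier z).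
Hypothesis lF : linear F.

(** The (q, p) entry is the difference of the eigenvalues of F, which are odd in the
    frequency, times a Fourier coefficient of x. *)
Lemma commutator_coef (p q : nat) : (0 < p + q)%N ->
  hdot (commutator F (mul_op (@id01 R)) (fourier p)) (fourier (- (q : int))) =
  'i * ((transform_freq p + transform_freq q) / freq (p + q)%N)%:C.
Proof.
move=> pq0; have pq : (p : int) != - (q : int) by rewrite -subr_eq0 opprK -PoszD -lt0n.
have [lX _] := mul_op_bounded within_continuous_id01.
have Fe : F (fourier p) = (transform_freq p)%:C *: fourier p.
  apply: fourier_inj => w; rewrite FE hdotZl fourier_orthonormal.
  by case: eqVneq => [->//|_]; rewrite !mulr0.
rewrite /commutator hdotBl FE Fe (linearZ_of _ _ lX) hdotZl (fourier_mul_id01 pq).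
have -> : - Posz q - Posz p = - Posz (p + q) by rewrite PoszD opprD addrC.
rewrite freqN transform_freqN [in RHS]rmorphM fmorphV rmorphD !rmorphN invrN; ring.
Qed.

(** Take the normalized sums v n of the N modes p in [N, 2N[, and w n of those of
    opposite frequency, where N = n + 1. The N^2 entries of the commutator between
    them are i (f_p + f_q) / (2 pi (p + q)), with f_p and f_q at least 1/2: as in the
    Hilbert matrix, each is at least 1 / (8 pi N) in modulus and they have the same
    phase. So the pairing, N^(-1) times their sum, does not tend to 0, although the
    w n are eventually orthogonal to each mode. *)
Lemma commutator_not_compact : ~ compact_operator (commutator F (mul_op (@id01 R))).
Proof.
have [lX _] := mul_op_bounded within_continuous_id01.
have lK : linear (commutator F (mul_op (@id01 R))).
  move=> c u v; rewrite /commutator lX !lF lX scalerBr opprD !addrA; congr (_ + _).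
  by rewrite addrAC.
pose N n : R := n.+1%:R; pose r n : C := (Num.sqrt (N n))^-1%:C.
have N0 n : 0 < N n by rewrite ltr0n.
have r2 n : `|r n| ^+ 2 = (N n)^-1%:C.
  rewrite /r norm_realC -rmorphXn real_normK ?num_real// exprVn sqr_sqrtr// ltW.
have rE n : r n * Num.conj (r n) = (N n)^-1%:C by rewrite -normCK r2.
pose v n : H := partial_sum (fun k => fourier (Posz (n.+1 + k))) (fun=> r n) n.+1.
pose w n : H := partial_sum (fun k => fourier (- Posz (n.+1 + k))) (fun=> r n) n.+1.
have orth_v n : orthonormal_seq (fun k => fourier (Posz (n.+1 + k)) : H).
  by move=> i j; rewrite fourier_orthonormal eqz_nat eqn_add2l.
have orth_w n : orthonormal_seq (fun k => fourier (- Posz (n.+1 + k)) : H).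
  by move=> i j; rewrite fourier_orthonormal eqr_opp eqz_nat eqn_add2l.
have norm1 (b : nat -> H) n : orthonormal_seq b -> `|partial_sum b (fun=> r n) n.+1| <= 1.
  move=> b1; rewrite -ler_sqr ?nnegrE// norm_partial_sum// expr1n.
  have N1 : (N n)^-1 *+ n.+1 = 1 by rewrite -mulr_natl -/(N n) mulfV// gt_eqF.
  by rewrite sumr_const card_ord r2 -rmorphMn N1.
apply: (not_compact_operator (@fourier_basis_orthonormal R) (@fourier_basis_total R)
  (v := v) (w := w) (r := (8 * pi)^-1)).
- by rewrite invr_gt0 mulr_gt0 ?pi_gt0.
- by move=> n; exact: norm1.
- by move=> n; exact: norm1.
- move=> k; exists `|int_of_nat k|%N => // n /= kn.
  rewrite hdotC hdot_suml big1 ?rmorph0// => j _; rewrite hdotZl fourier_orthonormal.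
  case: eqVneq => [e|_]; last by rewrite mulr0.
  by move: kn; rewrite -e abszN absz_nat => /(leq_ltn_trans (leq_addr _ _)); rewrite ltnn.
- move=> n; pose t (j k : nat) : R :=
    (transform_freq (n.+1 + j)%N + transform_freq (n.+1 + k)%N) /
    freq ((n.+1 + j) + (n.+1 + k))%N.
  have KE : hdot (commutator F (mul_op (@id01 R)) (v n)) (w n) =
      'i * ((N n)^-1 * \sum_(j < n.+1) \sum_(k < n.+1) t j k)%:C.
    rewrite /v /partial_sum (linear_sum_of _ _ _ lK) hdot_suml.
    rewrite rmorphM rmorph_sum mulrA mulr_sumr; apply: eq_bigr => j _.
    rewrite hdotZl hdot_sumr rmorph_sum !mulr_sumr; apply: eq_bigr => k _.
    rewrite hdotZr (commutator_coef (p := (n.+1 + j)%N) (q := (n.+1 + k)%N)); last by rewrite addSn.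
    transitivity ((N n)^-1%:C * ('i * (t j k)%:C)); first by rewrite -rE -mulrA.
    by rewrite mulrA [_ * 'i]mulrC.
  have t_ge j k : (j < n.+1)%N -> (k < n.+1)%N -> (8 * pi * N n)^-1 <= t j k.
    move=> jn kn; have p2 : 2 <= (pi : R) by exact: pi_ge2.
    have f_ge (m : nat) : 1 <= freq (n.+1 + m)%N :> R.
      rewrite /freq -pmulrn -[leLHS]mulr1; apply: ler_pM => //; first by nra.
      by rewrite addSn ler1n.
    have ft : 1 <= transform_freq (n.+1 + j)%N + transform_freq (n.+1 + k)%N :> R.
      by rewrite [leLHS]splitr; apply: lerD; apply: transform_freq_ge; exact: f_ge.
    have f0 : 0 < freq ((n.+1 + j) + (n.+1 + k))%N :> R.
      by rewrite -addnA; apply: lt_le_trans (f_ge _).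
    have fN : freq ((n.+1 + j) + (n.+1 + k))%N <= 8 * pi * N n.
      rewrite /freq -pmulrn [8 * pi * _]mulrAC [leRHS]mulrC.
      have -> : pi * (8 * N n) = 2 * pi * (4 * N n) by ring.
      rewrite ler_wpM2l ?mulr_ge0 ?pi_ge0// -natrM ler_nat.
      by rewrite -[4%N]/(2 + 2)%N mulnDl !mul2n -!addnn; apply: leq_add; rewrite leq_add2l ltnW.
    rewrite /t; apply: (@le_trans _ _ (freq ((n.+1 + j) + (n.+1 + k))%N)^-1).
      by rewrite lef_pV2 ?posrE// (lt_le_trans f0).
    by rewrite -[leLHS]mul1r ler_wpM2r// invr_ge0 ltW.
  rewrite KE normrM norm_i mul1r norm_realC lecR.
  apply: le_trans (ler_norm _); rewrite ler_pdivlMl//.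
  apply: (@le_trans _ _ (\sum_(j < n.+1) \sum_(k < n.+1) (8 * pi * N n)^-1)).
    have sum_cst (x : R) : \sum_(j < n.+1) x = N n * x.
      by rewrite sumr_const card_ord -mulr_natl.
    have -> : (8 * pi * N n)^-1 = (N n)^-1 * (8 * pi)^-1 by rewrite invfM mulrC.
    by rewrite !sum_cst mulVKf ?gt_eqF.
  by apply: ler_sum => j _; apply: ler_sum => k _; exact: t_ge.
Qed.

End NonCompact.

(** * The theorem *)

Unset Implicit Arguments.

Theorem proposition3p5 (R : realType) :
  [/\ symmetric_operator (D_op R) /\ closed (D_op R),
      D_op R `<=` D0_op R /\ selfadjoint_operator (D0_op R),
      compact_resolvent (D0_op R),
      dense (op_dom (D_op R)) /\
      (forall a : R -> R[i], smooth01 a ->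
         op_dom (D_op R) `<=` op_dom (op_commutator (D0_op R) (mul_op a)) /\
         exists M : R[i], forall u v, op_dom (D_op R) u ->
           op_commutator (D0_op R) (mul_op a) (u, v) -> `|v| <= M * `|u|) &
      exists F : L2_01 R -> L2_01 R,
        [/\ bounded_transform (D0_op R) F,
            forall F', bounded_transform (D0_op R) F' -> F' = F,
            ~ compact_operator (commutator F (mul_op (id01 R))) &
            ~ fredholm_module (cont_alg R) F]].
Proof.
split.
- by split; [exact: D_op_symmetric|exact: D_op_closed].
- by split; [exact: D_op_sub|exact: D0_op_selfadjoint].
- exact: D0_compact_resolvent.
- by split; [exact: dense_op_dom_D|move=> a; exact: commutator_bounded].
- have [F [bF F_unique FE]] := @bounded_transform_exists R.
  have [[lF _] _] := bF.
  have nK := commutator_not_compact FE lF.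
  exists F; split=> // -[_ _ [Fs _ FP]]; apply: nK.
  have [|_ _ //] := FP (mul_op (@id01 R)).
  by exists (@id01 R) => //; exact: within_continuous_id01.
Qed.
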